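(* $$\int_{\mathcal D}t^7\,dt\,dX_0\,dX_1\,dX_2\,dX_3=\frac{7\,\zeta(3)}{80},$$ where $$\mathcal D=\Big\{(t,X_0,X_1,X_2,X_3)\in\mathbb R^5:\ t>0,\ 1-\frac1{t^4}\le\sum_{l=0}^3X_l^2,\ |X_l|\le\tfrac12\ (l=0,\dots,3),\ \sum_{l=0}^3|X_l|\le1\Big\}$$ and $\zeta$ is the Riemann zeta function.
   Context: The integral, denoted $\mathrm{vol}\,\Gamma_{4,H}$ in the paper, is the normalisation of the invariant measure on $\mathrm{SL}_2(\mathbb H)$ restricted to shortest reduced bases over the Hurwitz integers, in Gram–Schmidt coordinates $\boldsymbol\alpha=(t,0)$, $\boldsymbol\beta=(t(X_0+X_1\mathrm i+X_2\mathrm j+X_3\mathrm k),1/t)$. *)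

(* Defs.v *)
From mathcomp Require Import all_boot all_order all_algebra.
From mathcomp Require Import all_classical all_reals all_analysis.

Set Implicit Arguments.
Unset Strict Implicit.
Unset Printing Implicit Defensive.

Import Order.TTheory GRing.Theory Num.Theory.
Import numFieldNormedType.Exports.

Local Open Scope classical_set_scope.
Local Open Scope ring_scope.

(* The Dirichlet series 1 + 2^-s + 3^-s + ..., which is the Riemann zeta
   function on the half-line s > 1 (a junk value when the series diverges). *)
Definition riemann_zeta (R : realType) (s : R) : R :=
  limn (series (fun n : nat => n.+1%:R `^ (- s))).

(* R^5 is the left-nested product ((((R * R) * R) * R) * R), with points
   (t, x0, x1, x2, x3); [measurableTypeR R] is R with its Borel
   sets. *)
Notation R5 R :=
  (measurableTypeR R * measurableTypeR R * measurableTypeR R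
     * measurableTypeR R * measurableTypeR R)%type.

Definition lebesgue5 (R : realType) : {measure set (R5 R) -> \bar R} :=
  (@lebesgue_measure R \x @lebesgue_measure R \x @lebesgue_measure R
     \x @lebesgue_measure R \x @lebesgue_measure R)%E.
Arguments lebesgue5 : clear implicits.

Definition domainD (R : realType) : set (R5 R) :=
  [set p | let: (t, x0, x1, x2, x3) := p in
     [/\ 0 < t,
         1 - 1 / t ^+ 4 <= x0 ^+ 2 + x1 ^+ 2 + x2 ^+ 2 + x3 ^+ 2,
         [/\ `|x0| <= 1 / 2, `|x1| <= 1 / 2, `|x2| <= 1 / 2 & `|x3| <= 1 / 2] &
         `|x0| + `|x1| + `|x2| + `|x3| <= 1]].
Arguments domainD : clear implicits.

(* Main.v *)
(** Integrating out [t] turns the left-hand side into one eighth of the integral of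
    [w(x) = (1 - |x|^2)^-2] over the cell [|x_l| <= 1/2, sum |x_l| <= 1], that is
    into [2 P], where [P] is the integral of [w] over the part [0 < x_l < 1/2,
    sum x_l < 1] of one orthant. Let [E] be the integral of [w] over the corner
    [0 < x2, x3, x4] and [x2 + x3 + x4 < x1 < 1/2], and [Q] the one over the cube
    [0 < x_l < 1/2].

    - The four corners [x_i > sum of the others] are disjoint parts of the domain
      of [P], and the Hadamard isometry maps the remaining part onto
      [|x2| + |x3| + |x4| < x1 < 1/2], so that [P = 12 E].
    - For [v = (1/2, 1/2, 1/2, 1/2)], [w (v - x) - w (x)] is the integral of
      [4 s^3] over an interval of values of [s]. In the coordinates [(q, s)],
      [q = s x], the measure becomes [4 dq ds / s], which is invariant under
      [s -> (1 + |q|^2) / s]; this gives [Q = 3 P + 4 E], whence [Q = 40 E].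
    - [Q] is [24] times the integral over [0 < x4 < x3 < x2 < x1 < 1/2], where three
      elementary integrations leave half of a double integral [J] of [kap 1].
      Deforming [kap 1] to [kap m] and exchanging the integrals in the derivative
      with respect to [m] expresses [J] by the iterated primitive [S] of
      [ln (2 sin x)] at [pi/2], [pi/3] and [pi/6]; the distribution relations of
      [S] give [J = - S(pi/2) / 36].
    - Summing Dirichlet kernels against [x (pi - x)] gives
      [zeta(3) = - 16/7 S(pi/2)]. *)

Require Import Defs.
From HB Require Import structures.
From mathcomp Require Import all_boot all_order all_algebra.
From mathcomp Require Import all_classical all_reals all_analysis.
From mathcomp Require Import measurable_realfun ring lra.

Import Order.TTheory GRing.Theory Num.Theory.
Import numFieldNormedType.Exports.

Local Open Scope classical_set_scope.
Local Open Scope ring_scope.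

(** The cell is the Voronoi cell, a regular 24-cell, of the lattice of Hurwitz integers; [v] and the
    unit vectors [e_i] are lattice points, and the weights met on the way are [(1 - |x - u|^2)^-2]
    for such points [u]. Facets such as [sum x_l = 1] cut obliquely through the cube, so the
    iterated integration is done on the whole cube, and linear relations carry its value to the
    cell. In the double integral, the deformation helps because the factor [1 / (1 - v^2)] of
    [kap m v] cancels on differentiating in [m], and the result has an elementary primitive in [v].
    The integral in [w] is then taken over the whole region [(1 + 2 m^2) w^2 < 1], which for [m < 1]
    reaches beyond [w = 1 / sqrt 3]. The surplus there is an integral of [kap M] with
    [(1 + 2 M^2) w^2 = 1], a curve on which it reduces to values of the primitive of [ln (2 sin x)].
    Integrands are nonnegative and integrals take values in the extended reals, so Tonelli's theorem
    applies without integrability; the finiteness of [E] comes only at the end, from the finite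
    value of [Q]. *)

(** * Sigma-finite products with Lebesgue measure *)

Section ProductWithLebesgue.
Context {R : realType} {d : measure_display} {T : measurableType d}.
Variable m : {sigma_finite_measure set T -> \bar R}.

(* A head constant of its own: [(m \x mu)%E] has no usable canonical structure
   of sigma-finite measure. *)
Definition xleb : set (T * measurableTypeR R) -> \bar R :=
  (m \x @lebesgue_measure R)%E.

HB.instance Definition _ := Measure.on xleb.

Let xleb_sigma_finite : sigma_finite setT xleb.
Proof.
have /sigma_finiteP[F [TF ndF Foo]] := sigma_finiteT m.
have /sigma_finiteP[G [TG ndG Goo]] := sigma_finiteT (@lebesgue_measure R).
exists (fun n => F n `*` G n).
  rewrite -setXTT TF TG; apply/seteqP; split; last first.
    by move=> p [n _ [Fp Gp]]; split; exists n.
  move=> p [[i _ Fp] [j _ Gp]]; exists (maxn i j) => //; split.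
  - by apply: subsetPset (ndF _ _ (leq_maxl i j)) _ Fp.
  - by apply: subsetPset (ndG _ _ (leq_maxr i j)) _ Gp.
move=> n; have [mF Fn] := Foo n; have [mG Gn] := Goo n; split.
  exact: measurableX.
by rewrite /xleb product_measure1E// lte_mul_pinfty// ge0_fin_numE.
Qed.

HB.instance Definition _ :=
  Measure_isSigmaFinite.Build _ _ _ xleb xleb_sigma_finite.

End ProductWithLebesgue.

(** * Changes of variables as identities between integrals *)

Section ChangeOfVariables.
Context {R : realType}.
Local Notation mu := (@lebesgue_measure R).
Local Notation MR := (measurableTypeR R).

(** The change of variables [y = f x] with Jacobian [j] in absolute value, in weak form: it is
    tested on nonnegative functions and asks neither injectivity nor smoothness of [f]. In this form
    it composes and passes to products by Tonelli. *)
Definition chvar d (T : measurableType d) (m : {measure set T -> \bar R})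
    (f : T -> T) (j : T -> R) :=
  [/\ measurable_fun setT f, measurable_fun setT j, forall x, 0 <= j x &
   forall F : T -> \bar R, measurable_fun setT F -> (forall x, 0 <= F x)%E ->
   (\int[m]_x ((j x)%:E * F (f x)) = \int[m]_x F x)%E].

Arguments chvar {d T} m f j.

Definition affine (a b : R) (x : MR) : MR := a * x + b.

Lemma measurable_affine (a b : R) : measurable_fun setT (affine a b).
Proof.
by apply: measurable_funD => //; apply: measurable_funM.
Qed.

Lemma affine_preimage_itv (a b x y : R) : a != 0 -> x < y ->
  mu (affine a b @^-1` `]x, y]) = (`|a|^-1 * (y - x))%:E.
Proof.
move=> a0 xy; have [a_gt0|a_lt0|/eqP] := ltgtP a 0; last by rewrite (negbTE a0).
- have -> : affine a b @^-1` `]x, y] = `[(y - b) / a, (x - b) / a[%classic.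
    apply/seteqP; split => z /=; rewrite !in_itv/= /affine.
      by rewrite ler_ndivrMr// ltr_ndivlMr// => /andP[h1 h2]; lra.
    by rewrite ler_ndivrMr// ltr_ndivlMr// => /andP[h1 h2]; lra.
  rewrite lebesgue_measure_itv/= lte_fin ltr_ndivlMr// divfK// ltrD2r xy.
  by rewrite ltr0_norm// -EFinD; congr (_%:E); field.
- have -> : affine a b @^-1` `]x, y] = `](x - b) / a, (y - b) / a]%classic.
    apply/seteqP; split => z /=; rewrite !in_itv/= /affine.
      by rewrite ltr_pdivrMr// ler_pdivlMr// => /andP[h1 h2]; lra.
    by rewrite ltr_pdivrMr// ler_pdivlMr// => /andP[h1 h2]; lra.
  rewrite lebesgue_measure_itv/= lte_fin ltr_pdivrMr// divfK// ltrD2r xy.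
  by rewrite gtr0_norm// -EFinD; congr (_%:E); field.
Qed.

(** The push-forward of Lebesgue measure, rescaled by [|a|], agrees with it on half-open intervals,
    hence everywhere by uniqueness. *)
Lemma chvar_affine (a b : R) : a != 0 -> chvar mu (affine a b) (fun=> `|a|).
Proof.
move=> a0; split => // [|F mF F0]; first exact: measurable_affine.
have a_ge0 : 0 <= `|a| by [].
have unif (A : set MR) : measurable A ->
    mu A = mscale (NngNum a_ge0) (pushforward mu (affine a b)) A.
  apply: lebesgue_measure_unique => _ [[x y] /= _ <-].
  rewrite /mscale/= /pushforward.
  have [xy|yx] := ltP x y.
    rewrite affine_preimage_itv// lebesgue_measure_itv/= lte_fin xy -EFinD -EFinM.
    by congr (_%:E); field; rewrite normr_eq0.
  by rewrite set_itv_ge -?leNgt//= preimage_set0 !measure0 mule0.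
have mf := measurable_affine a b.
rewrite [RHS](eq_measure_integral
  (mscale (NngNum a_ge0) (pushforward mu (affine a b))))//; last first.
  by move=> A mA _; exact: unif.
rewrite ge0_integral_mscale// ge0_integral_pushforward//.
rewrite preimage_setT ge0_integralZl//.
exact: measurableT_comp.
Qed.

Lemma chvar_comp d (T : measurableType d) (m : {measure set T -> \bar R})
    (f g : T -> T) (j k : T -> R) :
  chvar m f j -> chvar m g k ->
  chvar m (fun x => g (f x)) (fun x => j x * k (f x)).
Proof.
move=> [mf mj j0 fE] [mg mk k0 gE]; split.
- exact: measurableT_comp.
- by apply: measurable_funM => //; exact: measurableT_comp.
- by move=> x; rewrite mulr_ge0.
move=> F mF F0; rewrite -[RHS]gE//.
have mG : measurable_fun setT (fun x => (k x)%:E * F (g x))%E.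
  apply: emeasurable_funM; first exact/measurable_EFinP.
  exact: measurableT_comp.
rewrite -[RHS]fE//; last by move=> x; rewrite mule_ge0 ?lee_fin.
by apply: eq_integral => x _; rewrite EFinM muleA.
Qed.

Context d (T : measurableType d) (m : {sigma_finite_measure set T -> \bar R}).

Lemma chvar_lift (f : T -> T) (j : T -> R) : chvar m f j ->
  chvar (xleb m) (fun p => (f p.1, p.2)) (fun p => j p.1).
Proof.
move=> [mf mj j0 fE].
have mf' : measurable_fun setT (fun p : T * MR => (f p.1, p.2)).
  by apply: measurable_fun_pair => //; exact: measurableT_comp.
have mj' : measurable_fun setT (fun p : T * MR => j p.1).
  exact: measurableT_comp.
split => // F mF F0.
rewrite fubini_tonelli2; first last.
- by move=> x; rewrite mule_ge0 ?lee_fin.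
- apply: emeasurable_funM; first exact/measurable_EFinP.
  exact: measurableT_comp.
rewrite [RHS](fubini_tonelli2 _ mF F0); apply: eq_integral => y _.
by rewrite /fubini_G/= (fE (fun x => F (x, y)))//; exact: measurableT_comp.
Qed.

(** Scale and shift may depend on the other coordinates. This triangular map, with coordinate swaps
    and lifts to products, generates the maps of several variables used later. *)
Lemma chvar_affine_last (a b : T -> R) :
  measurable_fun setT a -> measurable_fun setT b -> (forall x, a x != 0) ->
  chvar (xleb m) (fun p => (p.1, affine (a p.1) (b p.1) p.2))
    (fun p => `|a p.1|).
Proof.
move=> ma mb a0.
have mf' : measurable_fun setT
    (fun p : T * MR => (p.1, affine (a p.1) (b p.1) p.2)).
  apply: measurable_fun_pair => //; apply: measurable_funD.
    by apply: measurable_funM => //; exact: measurableT_comp.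
  exact: measurableT_comp.
have mj' : measurable_fun setT (fun p : T * MR => `|a p.1|).
  by apply: measurableT_comp => //; exact: measurableT_comp.
split => // F mF F0.
rewrite fubini_tonelli1; first last.
- by move=> x; rewrite mule_ge0 ?lee_fin.
- apply: emeasurable_funM; first exact/measurable_EFinP.
  exact: measurableT_comp.
rewrite [RHS](fubini_tonelli1 _ mF F0); apply: eq_integral => x _.
have [_ _ _ H] := chvar_affine (a x) (b x) (a0 x).
by rewrite /fubini_F/= (H (fun y => F (x, y)))//; exact: measurableT_comp.
Qed.

Lemma fubini_tonelli3 (F : T * MR * MR -> \bar R) : measurable_fun setT F ->
  (forall x, 0 <= F x)%E ->
  (\int[xleb (xleb m)]_p F p =
   \int[m]_x \int[mu]_y \int[mu]_z F (x, y, z))%E.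
Proof.
move=> mF F0; transitivity (\int[xleb m]_p fubini_F mu F p)%E.
  exact: fubini_tonelli1.
transitivity (\int[m]_p fubini_F mu (fubini_F mu F) p)%E => //.
apply: fubini_tonelli1; first exact: measurable_fun_fubini_tonelli_F.
by move=> x; exact: integral_ge0.
Qed.

Lemma chvar_swap :
  chvar (xleb (xleb m)) (fun p => ((p.1.1, p.2), p.1.2)) (fun=> 1).
Proof.
have mf : measurable_fun setT
    (fun p : T * MR * MR => ((p.1.1, p.2), p.1.2)).
  apply: measurable_fun_pair; last exact: measurableT_comp.
  by apply: measurable_fun_pair => //; exact: measurableT_comp.
split => // F mF F0.
pose G := fun p : T * MR * MR => F ((p.1.1, p.2), p.1.2).
have mG : measurable_fun setT G := measurableT_comp mF mf.
have -> : (\int[xleb (xleb m)]_p (1 * F ((p.1.1, p.2), p.1.2)) =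
          \int[xleb (xleb m)]_p G p)%E.
  by apply: eq_integral => p _; rewrite mul1e.
rewrite (fubini_tonelli3 _ mF F0) (fubini_tonelli3 _ mG (fun=> F0 _)).
apply: eq_integral => x _; rewrite /G/=.
have mH : measurable_fun setT (fun p : MR * MR => F (x, p.2, p.1)).
  apply: measurableT_comp => //.
  by apply: measurable_fun_pair => //; apply: measurable_fun_pair.
by rewrite (fubini_tonelli _ mH).
Qed.

End ChangeOfVariables.
Arguments chvar {R d T} m f j.

Lemma chvar_swap2 (R : realType) :
  chvar (xleb (@lebesgue_measure R))
    (fun p => (p.2, p.1)) (fun=> 1).
Proof.
have mf : measurable_fun setT
    (fun p : measurableTypeR R * measurableTypeR R => (p.2, p.1)).
  exact: measurable_fun_pair.
split => // F mF F0; under eq_integral do rewrite mul1e.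
have mFf := measurableT_comp mF mf.
by rewrite (fubini_tonelli1 _ mFf (fun=> F0 _)) (fubini_tonelli2 _ mF F0).
Qed.

(** * Measurability of explicit functions *)

Section Measurability.
Context {R : realType}.

Lemma measurable_inv : measurable_fun setT (fun x : R => x^-1).
Proof.
have mD : measurable (~` [set (0 : R)]) by exact: measurableC.
rewrite -(setvU [set (0 : R)]); apply/measurable_funU => //; split.
  apply: open_continuous_measurable_fun.
    by apply: closed_openC; exact: closed_eq.
  by move=> x; rewrite inE => /= /eqP x0; exact: inv_continuous.
apply: (eq_measurable_fun (cst (0 : R))); last exact: measurable_cst.
by move=> x; rewrite inE => /= ->; rewrite invr0.
Qed.

Context {d : measure_display} {T : measurableType d}.
Implicit Types f g : T -> R.

Lemma measurable_funV f : measurable_fun setT f ->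
  measurable_fun setT (fun x => (f x)^-1).
Proof. by move=> mf; apply: (measurableT_comp measurable_inv). Qed.

Lemma measurable_fun_sqrt f : measurable_fun setT f ->
  measurable_fun setT (fun x => Num.sqrt (f x)).
Proof.
move=> mf; apply: measurableT_comp => //.
by apply: continuous_measurable_fun; exact: sqrt_continuous.
Qed.

Lemma measurable_fun_ln f : measurable_fun setT f ->
  measurable_fun setT (fun x => ln (f x)).
Proof. by move=> mf; apply: measurableT_comp => //; exact: measurable_ln. Qed.

Lemma measurable_fun_normr f : measurable_fun setT f ->
  measurable_fun setT (fun x => `|f x|).
Proof. by move=> mf; apply: measurableT_comp. Qed.

End Measurability.

Lemma measurable_fun_fst d d1 d2 (T : measurableType d)
    (T1 : measurableType d1) (T2 : measurableType d2) (f : T -> T1 * T2) :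
  measurable_fun setT f -> measurable_fun setT (fun x => (f x).1).
Proof. by move=> mf; exact: measurableT_comp. Qed.

Lemma measurable_fun_snd d d1 d2 (T : measurableType d)
    (T1 : measurableType d1) (T2 : measurableType d2) (f : T -> T1 * T2) :
  measurable_fun setT f -> measurable_fun setT (fun x => (f x).2).
Proof. by move=> mf; exact: measurableT_comp. Qed.

Ltac meas1 :=
  lazymatch goal with
  | |- measurable_fun _ (fun _ => ?c) => exact: measurable_cst
  | |- measurable_fun _ (fun x => x) => exact: measurable_id
  | |- measurable_fun _ (fun x => andb _ _) => apply: measurable_and
  | |- measurable_fun _ (fun x => (@Order.lt _ _ _ _)) => apply: measurable_fun_ltr
  | |- measurable_fun _ (fun x => (@Order.le _ _ _ _)) => apply: measurable_fun_ler
  | |- measurable_fun _ (fun x => (@GRing.add _ _ _)) => apply: measurable_funD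
  | |- measurable_fun _ (fun x => (@GRing.opp _ _)) => apply: measurable_funN
  | |- measurable_fun _ (fun x => (@GRing.mul _ _ _)) => apply: measurable_funM
  | |- measurable_fun _ (fun x => (@GRing.exp _ _ _)) => apply: measurable_funX
  | |- measurable_fun _ (fun x => (@GRing.inv _ _)) => apply: measurable_funV
  | |- measurable_fun _ (fun x => Num.sqrt _) => apply: measurable_fun_sqrt
  | |- measurable_fun _ (fun x => ln _) => apply: measurable_fun_ln
  | |- measurable_fun _ (fun x => @Num.norm _ _ _) => apply: measurable_fun_normr
  | |- measurable_fun _ (fun x => if _ then _ else _) => apply: measurable_fun_ifT
  | |- measurable_fun _ (fun x => (_, _)) => apply: measurable_fun_pair
  | |- measurable_fun _ (fun x => _.1) => apply: measurable_fun_fst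
  | |- measurable_fun _ (fun x => _.2) => apply: measurable_fun_snd
  | |- measurable_fun _ (@Order.lt _ _ ?c) =>
      apply: (@measurable_fun_ltr _ _ _ _ (fun=> c) (fun x => x))
  | |- measurable_fun _ (@Order.le _ _ ?c) =>
      apply: (@measurable_fun_ler _ _ _ _ (fun=> c) (fun x => x))
  | |- measurable_fun _ (@GRing.add _ ?c) =>
      apply: (@measurable_funD _ _ _ _ (fun=> c) (fun x => x))
  | |- measurable_fun _ (@GRing.mul _ ?c) =>
      apply: (@measurable_funM _ _ _ _ (fun=> c) (fun x => x))
  | |- measurable_fun _ fst => exact: measurable_fst
  | |- measurable_fun _ snd => exact: measurable_snd
  | |- measurable_fun _ _ => assumption
  end.
Ltac meas := repeat meas1.

(** * Integrals cut off by a Boolean predicate *)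

Section IndicatorIntegral.
Context {R : realType} {d : measure_display} {T : measurableType d}.
Implicit Types (m : {measure set T -> \bar R}) (b : T -> bool) (g l : T -> R).

Definition ind b g (x : T) : \bar R := (if b x then (g x)%:E else 0)%E.

Definition bint m b g : \bar R := (\int[m]_x ind b g x)%E.

(** The sign is asked only where [b] holds: formulas with roots, logarithms and quotients take
    meaningless values outside their region. *)
Definition admissible b g :=
  [/\ measurable_fun setT b, measurable_fun setT g & forall x, b x -> 0 <= g x].

Lemma measurable_ind b g : admissible b g -> measurable_fun setT (ind b g).
Proof.
move=> [mb mg _]; apply: measurable_fun_ifT => //.
by apply: measurableT_comp => //; exact: EFin_measurable.
Qed.

Lemma ind_ge0 b g x : admissible b g -> (0 <= ind b g x)%E.
Proof. by move=> [_ _ g0]; rewrite /ind; case: ifPn => // /g0; rewrite lee_fin. Qed.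

Lemma bint_ge0 m b g : admissible b g -> (0 <= bint m b g)%E.
Proof. by move=> bg; apply: integral_ge0 => x _; exact: ind_ge0. Qed.

Lemma bint_eq m b b' g g' : b =1 b' -> (forall x, b x -> g x = g' x) ->
  bint m b g = bint m b' g'.
Proof.
move=> bb' gg'; apply: eq_integral => x _; rewrite /ind -bb'.
by case: ifPn => // /gg' ->.
Qed.

Lemma bint_chvar {m f j} b g : chvar m f j -> admissible b g ->
  bint m (fun x => b (f x)) (fun x => j x * g (f x)) = bint m b g.
Proof.
move=> [_ _ _ fE] bg; rewrite /bint -[RHS]fE//.
- apply: eq_integral => x _; rewrite /ind.
  by case: ifPn => //; rewrite mule0.
- exact: measurable_ind.
- by move=> x; exact: ind_ge0.
Qed.

Lemma bintD m b g g' : admissible b g -> admissible b g' ->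
  bint m b (fun x => g x + g' x) = (bint m b g + bint m b g')%E.
Proof.
move=> bg bg'; rewrite /bint -ge0_integralD//.
- by apply: eq_integral => x _; rewrite /ind; case: ifPn => //; rewrite adde0.
- by move=> x _; exact: ind_ge0.
- exact: measurable_ind.
- by move=> x _; exact: ind_ge0.
- exact: measurable_ind.
Qed.

Lemma bintZ m (c : R) b g : 0 <= c -> admissible b g ->
  bint m b (fun x => c * g x) = (c%:E * bint m b g)%E.
Proof.
move=> c0 bg; rewrite /bint -ge0_integralZl//.
- by apply: eq_integral => x _; rewrite /ind; case: ifPn => //; rewrite mule0.
- exact: measurable_ind.
- by move=> x _; exact: ind_ge0.
Qed.

Lemma admissible_and b b' g : admissible b g -> measurable_fun setT b' ->
  admissible (fun x => b x && b' x) g.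
Proof.
by move=> [mb mg g0] mb'; split => // [|x /andP[/g0//]]; exact: measurable_and.
Qed.

(** The hypersurface [l = 0] is negligible, so a region can be cut along it into two pieces given by
    strict inequalities. *)
Lemma bint_split {m l} b g : measurable_fun setT l -> m [set x | l x = 0] = 0%E ->
  admissible b g ->
  bint m b g = (bint m (fun x => b x && (0 < l x)%R) g +
                bint m (fun x => b x && (l x < 0)%R) g)%E.
Proof.
move=> ml l0 bg.
have mp : measurable_fun setT (fun x => 0 < l x) by meas.
have mn : measurable_fun setT (fun x => l x < 0) by meas.
rewrite /bint -ge0_integralD//; last 4 first.
- by move=> x _; apply: ind_ge0; exact: admissible_and.
- by apply: measurable_ind; exact: admissible_and.
- by move=> x _; apply: ind_ge0; exact: admissible_and.
- by apply: measurable_ind; exact: admissible_and.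
apply: ge0_ae_eq_integral => //.
- exact: measurable_ind.
- by apply: emeasurable_funD; apply: measurable_ind; exact: admissible_and.
- by move=> x _; exact: ind_ge0.
- by move=> x _; apply: adde_ge0; apply: ind_ge0; exact: admissible_and.
exists [set x | l x = 0]; split => //.
  rewrite -[X in measurable X]setTI; apply: (ml _ [set 0]) => //.
move=> x /=; apply: contra_notP => /eqP lx _; rewrite /ind.
case: (b x) => /=; last by rewrite adde0.
by case: ltgtP lx => // _ _; rewrite ?adde0 ?add0e.
Qed.

(** The symmetry [f] exchanges the two sides of [l = 0]. *)
Lemma bint_double {m f l} b g : chvar m f (fun=> 1) ->
  measurable_fun setT l -> m [set x | l x = 0] = 0%E -> admissible b g ->
  (forall x, b (f x) = b x) -> (forall x, b x -> g (f x) = g x) ->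
  (forall x, l (f x) = - l x) ->
  bint m b g = (2%:E * bint m (fun x => b x && (0 < l x)%R) g)%E.
Proof.
move=> mf ml l0 bg bf gf lf; rewrite (bint_split b g ml l0)//.
have mn : measurable_fun setT (fun x => l x < 0) by meas.
have -> : bint m (fun x => b x && (l x < 0)) g =
    bint m (fun x => b x && (0 < l x)) g.
  rewrite -(bint_chvar _ _ mf)//; last exact: admissible_and.
  apply: bint_eq => [x|x /andP[]]; rewrite bf.
    by rewrite lf oppr_lt0.
  by move=> bx _; rewrite mul1r gf.
by rewrite mule_natl mule2n.
Qed.

End IndicatorIntegral.

(** * Null sets in products *)

Section NullSets.
Context {R : realType} {d : measure_display} {T : measurableType d}.
Variable m : {sigma_finite_measure set T -> \bar R}.
Local Notation mu := (@lebesgue_measure R).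
Local Notation MR := (measurableTypeR R).

(** Each line in the direction of the last coordinate meets the set in at most one point. *)
Lemma null_graph (l : T * MR -> R) : measurable_fun setT l ->
  (forall x y y', l (x, y) = 0 -> l (x, y') = 0 -> y = y') ->
  xleb m [set p | l p = 0] = 0%E.
Proof.
move=> ml l_inj; rewrite /xleb /= /product_measure1 /=.
apply: integral0_eq => x _ /=.
have [->|/set0P[y ly]] := eqVneq (xsection [set p | l p = 0] x) set0.
  by rewrite measure0.
suff -> : xsection [set p | l p = 0] x = [set y] by rewrite lebesgue_measure_set1.
apply/seteqP; split => z /=; last by move=> ->.
move: ly; rewrite /xsection /= !inE /= => ly lz; exact: l_inj lz ly.
Qed.

Lemma null_lift (l : T -> R) : measurable_fun setT l ->
  m [set x | l x = 0] = 0%E -> xleb m [set p | l p.1 = 0] = 0%E.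
Proof.
move=> ml l0.
have -> : [set p : T * MR | l p.1 = 0] = [set x | l x = 0] `*` setT.
  by apply/seteqP; split => [p|p []]/=.
have mN : measurable [set x | l x = 0].
  by rewrite -[X in measurable X]setTI; exact: (ml _ [set 0]).
by rewrite /xleb /= product_measure1E// [X in (X * _)%E](_ : _ = 0%E) ?mul0e.
Qed.

End NullSets.

Lemma bint_fubini {R : realType} {d} {T : measurableType d}
    (m : {sigma_finite_measure set T -> \bar R})
    (b : T * measurableTypeR R -> bool) (g : T * measurableTypeR R -> R)
    (b' : T -> bool) (g' : T -> R) : admissible b g ->
  (forall x, (\int[@lebesgue_measure R]_y ind b g (x, y))%E = ind b' g' x) ->
  bint (xleb m) b g = bint m b' g'.
Proof.
move=> bg H; rewrite /bint /xleb fubini_tonelli1//.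
- by apply: eq_integral => x _; rewrite -H.
- exact: measurable_ind.
- by move=> x; exact: ind_ge0.
Qed.

(** * The fundamental theorem of calculus for nonnegative integrands *)

Section FTC.
Context {R : realType}.
Local Notation mu := (@lebesgue_measure R).
Implicit Types (f F : R -> R) (x y a b : R).

Lemma is_derive_continuous f x (df : R) : is_derive x 1 f df -> {for x, continuous f}.
Proof.
move=> fdf; apply: differentiable_continuous.
by apply/derivable1_diffP; exact: ex_derive.
Qed.

Lemma ge0_FTC_cc f F a b : a < b ->
  (forall x, a <= x <= b -> is_derive x 1 F (f x)) ->
  (forall x, a <= x <= b -> {for x, continuous f}) ->
  (\int[mu]_(x in `[a, b]) (f x)%:E = (F b - F a)%:E)%E.
Proof.
move=> ab dF cf; rewrite (@continuous_FTC2 _ f F)//.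
- apply: continuous_in_subspaceT => x; rewrite inE/= in_itv/=; exact: cf.
- split.
  + move=> x; rewrite in_itv/= => /andP[ax xb].
    by have := dF x; rewrite !ltW// => /(_ isT) ?; exact: ex_derive.
  + apply: cvg_at_right_filter; apply: is_derive_continuous (dF a _).
    by rewrite lexx ltW.
  + apply: cvg_at_left_filter; apply: is_derive_continuous (dF b _).
    by rewrite lexx ltW.
- move=> x; rewrite in_itv/= => /andP[ax xb].
  have dFx : is_derive x 1 F (f x) by apply: dF; rewrite !ltW.
  by rewrite derive1E; exact: derive_val.
Qed.

(** The integrand may blow up at the endpoints, where only the primitive is assumed continuous.
    Nonnegativity allows monotone convergence from closed subintervals to the open interval. *)
Lemma ge0_FTC f F a b : a <= b ->
  (forall x, a < x < b -> is_derive x 1 F (f x)) ->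
  (forall x, a < x < b -> {for x, continuous f}) ->
  (forall x, a < x < b -> 0 <= f x) ->
  {for a, continuous F} -> {for b, continuous F} ->
  (\int[mu]_(x in `]a, b[) (f x)%:E = (F b - F a)%:E)%E.
Proof.
rewrite le_eqVlt => /predU1P[<- _ _ _ _ _|ab dF cf f0 Fa Fb].
  by rewrite set_itvoo0 integral_set0 subrr.
(* The factor [1 / 4] makes [[a + c n, b - c n]] nondegenerate already for [n = 0]. *)
pose c n : R := (b - a) / 4 * n.+1%:R^-1.
have c_gt0 n : 0 < c n by rewrite mulr_gt0 ?invr_gt0// divr_gt0 ?subr_gt0.
have c_lt n : c n <= (b - a) / 4.
  by rewrite ler_piMr ?invf_le1 ?ler1n// divr_ge0// subr_ge0 ltW.
have c_cvg : c n @[n --> \oo] --> (0 : R).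
  rewrite -(mulr0 ((b - a) / 4)); apply: cvgMr; exact: cvg_harmonic.
have c_dec n m : (n <= m)%N -> c m <= c n.
  move=> nm; rewrite ler_wpM2l ?lef_pV2 ?posrE ?ler_nat//.
  by rewrite divr_ge0// subr_ge0 ltW.
pose A n := `[a + c n, b - c n]%classic.
have AE : \bigcup_n A n = `]a, b[%classic.
  apply/seteqP; split => [x [n _]|x]; rewrite /A/= !in_itv/=.
    by have := c_gt0 n => ? /andP[? ?]; lra.
  move=> /andP[ax xb].
  have : \forall n \near \oo, c n < Num.min (x - a) (b - x).
    apply: (cvgr_lt (0 : R)) => //.
    by rewrite lt_min !subr_gt0 ax.
  move=> [N _ /(_ N)/(_ (leqnn N))]/=; rewrite lt_min => /andP[h1 h2].
  by exists N => //; rewrite /A/= in_itv/=; lra.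
have mf : measurable_fun `]a, b[ f.
  apply: open_continuous_measurable_fun => // x.
  by rewrite inE/= in_itv/=; exact: cf.
have cvg1 : (\int[mu]_(x in A n) (f x)%:E)%E @[n --> \oo] -->
    (\int[mu]_(x in `]a, b[) (f x)%:E)%E.
  rewrite -AE; apply: ge0_nondecreasing_set_cvg_integral.
  - move=> n m nm; apply/subsetPset => x; rewrite /A/= !in_itv/=.
    by have := c_dec _ _ nm => ? /andP[? ?]; lra.
  - by move=> n; exact: measurable_itv.
  - move=> n; apply/measurable_EFinP.
    by apply: measurable_funS mf => //; rewrite -AE; exact: bigcup_sup.
  - move=> n x; rewrite /A/= in_itv/= => /andP[? ?]; rewrite lee_fin.
    by apply: f0; have := c_gt0 n; lra.
have cvg2 : (\int[mu]_(x in A n) (f x)%:E)%E @[n --> \oo] --> (F b - F a)%:E.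
  have -> : (fun n => \int[mu]_(x in A n) (f x)%:E)%E =
      (fun n => (F (b - c n) - F (a + c n))%:E).
    apply/funext => n; apply: ge0_FTC_cc => [|x /andP[? ?]|x /andP[? ?]].
    - by have := c_lt n; lra.
    - by apply: dF; have := c_gt0 n; lra.
    - by apply: cf; have := c_gt0 n; lra.
  apply: cvg_EFin; first exact: nearW.
  have cb : b - c n @[n --> \oo] --> b.
    by rewrite -[X in _ --> X]subr0; apply: cvgB => //; exact: cvg_cst.
  have ca : a + c n @[n --> \oo] --> a.
    by rewrite -[X in _ --> X]addr0; apply: cvgD => //; exact: cvg_cst.
  by apply: cvgB; [exact: cvg_comp cb Fb | exact: cvg_comp ca Fa].
by rewrite -(cvg_lim _ cvg1)// (cvg_lim _ cvg2).
Qed.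

Lemma ge0_FTC_ind (b : R -> bool) f F x y : x <= y -> b =1 (fun t => (x < t) && (t < y)) ->
  (forall t, x < t < y -> is_derive t 1 F (f t)) ->
  (forall t, x < t < y -> {for t, continuous f}) ->
  (forall t, x < t < y -> 0 <= f t) ->
  {for x, continuous F} -> {for y, continuous F} ->
  (\int[mu]_t ind b f t = (F y - F x)%:E)%E.
Proof.
move=> xy bE dF cf f0 Fx Fy; rewrite -(ge0_FTC f F x y)//.
rewrite [RHS]integral_mkcond; apply: eq_integral => t _.
by rewrite /ind bE patchE mem_setE in_itv.
Qed.

Lemma ind_set0 (b : R -> bool) f : b =1 xpred0 -> (\int[mu]_t ind b f t = 0)%E.
Proof. by move=> b0; apply: integral0_eq => t _; rewrite /ind b0. Qed.

End FTC.

(** * Rules for derivatives and continuity *)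

Section Calculus.
Context {R : realType}.
Implicit Types (f g : R -> R) (x a b : R).

Definition cont_at f x := f t @[t --> x] --> f x.

Lemma dv_cst c x : is_derive x 1 (fun=> c : R) 0.
Proof. exact: is_derive_cst. Qed.

Lemma dv_id x : is_derive x 1 (fun t : R => t) 1.
Proof. exact: is_derive_id. Qed.

Lemma dvD f g x a b : is_derive x 1 f a -> is_derive x 1 g b ->
  is_derive x 1 (fun t => f t + g t) (a + b).
Proof. by move=> fa gb; exact: is_deriveD. Qed.

Lemma dvN f x a : is_derive x 1 f a -> is_derive x 1 (fun t => - f t) (- a).
Proof. by move=> fa; exact: is_deriveN. Qed.

Lemma dvM f g x a b : is_derive x 1 f a -> is_derive x 1 g b ->
  is_derive x 1 (fun t => f t * g t) (a * g x + f x * b).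
Proof.
move=> fa gb; apply: (is_derive_eq (is_deriveM fa gb)).
by rewrite /GRing.scale/=; ring.
Qed.

Lemma dv_comp f g x a b : is_derive (g x) 1 f b -> is_derive x 1 g a ->
  is_derive x 1 (fun t => f (g t)) (b * a).
Proof. by move=> fb ga; exact: is_derive1_comp fb ga. Qed.

Lemma dvX f n x a : is_derive x 1 f a ->
  is_derive x 1 (fun t => f t ^+ n) (n%:R * f x ^+ n.-1 * a).
Proof.
move=> fa; have H := derivableP (@exprn_derivable R n (f x) 1).
rewrite -derive1E exp_derive1 in H.
exact: (dv_comp (fun y => y ^+ n) f _ _ _ H fa).
Qed.

Lemma dvV f x a : f x != 0 -> is_derive x 1 f a ->
  is_derive x 1 (fun t => (f t)^-1) (- (a / f x ^+ 2)).
Proof.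
move=> f0 fa; apply: (is_derive_eq (is_deriveV f0 fa)).
by rewrite /GRing.scale/= mulNr mulrC.
Qed.

Lemma dv_sqrt f x a : 0 < f x -> is_derive x 1 f a ->
  is_derive x 1 (fun t => Num.sqrt (f t)) (a / (2 * Num.sqrt (f x))).
Proof.
move=> f0 fa; apply: is_derive_eq; last exact: mulrC.
by apply: dv_comp fa; exact: is_derive1_sqrt.
Qed.

Lemma dv_ln f x a : 0 < f x -> is_derive x 1 f a ->
  is_derive x 1 (fun t => ln (f t)) (a / f x).
Proof.
move=> f0 fa; apply: is_derive_eq; last exact: mulrC.
by apply: dv_comp fa; exact: is_derive1_ln.
Qed.

Lemma dv_atan f x a : is_derive x 1 f a ->
  is_derive x 1 (fun t => atan (f t)) (a / (1 + f x ^+ 2)).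
Proof.
move=> fa; rewrite mulrC.
exact: (dv_comp atan f _ _ _ (is_derive1_atan (f x)) fa).
Qed.

Lemma dv_sin f x a : is_derive x 1 f a ->
  is_derive x 1 (fun t => sin (f t)) (a * cos (f x)).
Proof.
move=> fa; rewrite mulrC.
exact: (dv_comp sin f _ _ _ (is_derive_sin (f x)) fa).
Qed.

Lemma dv_cos f x a : is_derive x 1 f a ->
  is_derive x 1 (fun t => cos (f t)) (- (a * sin (f x))).
Proof.
move=> fa; rewrite mulrC -mulNr.
exact: (dv_comp cos f _ _ _ (is_derive_cos (f x)) fa).
Qed.

Lemma ct_cst c x : cont_at (fun=> c) x.
Proof. exact: cst_continuous. Qed.

Lemma ct_id x : cont_at (fun t => t) x.
Proof. by apply: cvg_id. Qed.

Lemma ctD f g x : cont_at f x -> cont_at g x -> cont_at (fun t => f t + g t) x.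
Proof. by move=> cf cg; exact: cvgD. Qed.

Lemma ctN f x : cont_at f x -> cont_at (fun t => - f t) x.
Proof. by move=> cf; exact: cvgN. Qed.

Lemma ctM f g x : cont_at f x -> cont_at g x -> cont_at (fun t => f t * g t) x.
Proof. by move=> cf cg; exact: cvgM. Qed.

Lemma ctX f n x : cont_at f x -> cont_at (fun t => f t ^+ n) x.
Proof.
by move=> cf; apply: (@continuous_comp _ _ _ f (fun y => y ^+ n)) => //; exact: exprn_continuous.
Qed.

Lemma ctV f x : f x != 0 -> cont_at f x -> cont_at (fun t => (f t)^-1) x.
Proof. by move=> f0 cf; exact: cvgV. Qed.

Lemma ct_comp f g x : cont_at f (g x) -> cont_at g x ->
  cont_at (fun t => f (g t)) x.
Proof. by move=> cf cg; exact: (@continuous_comp _ _ _ g f). Qed.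

Lemma ct_sqrt f x : cont_at f x -> cont_at (fun t => Num.sqrt (f t)) x.
Proof. by apply: ct_comp; exact: sqrt_continuous. Qed.

Lemma ct_ln f x : 0 < f x -> cont_at f x -> cont_at (fun t => ln (f t)) x.
Proof. by move=> f0; apply: ct_comp; exact: continuous_ln. Qed.

Lemma ct_atan f x : cont_at f x -> cont_at (fun t => atan (f t)) x.
Proof. by apply: ct_comp; exact: continuous_atan. Qed.

Lemma ct_sin f x : cont_at f x -> cont_at (fun t => sin (f t)) x.
Proof. by apply: ct_comp; exact: continuous_sin. Qed.

Lemma ct_cos f x : cont_at f x -> cont_at (fun t => cos (f t)) x.
Proof. by apply: ct_comp; exact: continuous_cos. Qed.

Lemma ct_norm f x : cont_at f x -> cont_at (fun t => `|f t|) x.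
Proof. by apply: ct_comp; exact: norm_continuous. Qed.

End Calculus.

Ltac derive1_extra := fail.
Ltac derive1 :=
  lazymatch goal with
  | |- is_derive _ _ (fun _ => ?c) _ => eapply dv_cst
  | |- is_derive _ _ (fun t => t) _ => eapply dv_id
  | |- is_derive _ _ (fun t => @GRing.add _ _ _) _ => eapply dvD
  | |- is_derive _ _ (fun t => @GRing.opp _ _) _ => eapply dvN
  | |- is_derive _ _ (fun t => @GRing.mul _ _ _) _ => eapply dvM
  | |- is_derive _ _ (fun t => @GRing.exp _ _ _) _ => eapply dvX
  | |- is_derive _ _ (fun t => @GRing.inv _ _) _ => eapply dvV
  | |- is_derive _ _ (fun t => Num.sqrt _) _ => eapply dv_sqrt
  | |- is_derive _ _ (fun t => ln _) _ => eapply dv_ln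
  | |- is_derive _ _ (fun t => atan _) _ => eapply dv_atan
  | |- is_derive _ _ (fun t => sin _) _ => eapply dv_sin
  | |- is_derive _ _ (fun t => cos _) _ => eapply dv_cos
  | |- is_derive _ _ (@GRing.add _ ?c) _ => eapply (dvD (fun=> c) (fun t => t))
  | |- is_derive _ _ (@GRing.mul _ ?c) _ => eapply (dvM (fun=> c) (fun t => t))
  | |- is_derive _ _ (@GRing.opp _) _ => eapply (dvN (fun t => t))
  | |- is_derive _ _ (@GRing.inv _) _ => eapply (dvV (fun t => t))
  | |- is_derive _ _ Num.sqrt _ => eapply (dv_sqrt (fun t => t))
  | |- is_derive _ _ (@ln _) _ => eapply (dv_ln (fun t => t))
  | |- is_derive _ _ (@atan _) _ => eapply (dv_atan (fun t => t))
  | |- is_derive _ _ (@sin _) _ => eapply (dv_sin (fun t => t))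
  | |- is_derive _ _ (@cos _) _ => eapply (dv_cos (fun t => t))
  | |- is_derive _ _ _ _ => derive1_extra
  end.
Ltac derive := eapply is_derive_eq; [repeat derive1 | idtac]; cbv beta.

Ltac cont1_extra := fail.
Ltac cont1 :=
  lazymatch goal with
  | |- cont_at (fun _ => ?c) _ => apply: ct_cst
  | |- cont_at (fun t => t) _ => apply: ct_id
  | |- cont_at (fun t => @GRing.add _ _ _) _ => apply: ctD
  | |- cont_at (fun t => @GRing.opp _ _) _ => apply: ctN
  | |- cont_at (fun t => @GRing.mul _ _ _) _ => apply: ctM
  | |- cont_at (fun t => @GRing.exp _ _ _) _ => apply: ctX
  | |- cont_at (fun t => @GRing.inv _ _) _ => apply: ctV
  | |- cont_at (fun t => Num.sqrt _) _ => apply: ct_sqrt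
  | |- cont_at (fun t => ln _) _ => apply: ct_ln
  | |- cont_at (fun t => atan _) _ => apply: ct_atan
  | |- cont_at (fun t => sin _) _ => apply: ct_sin
  | |- cont_at (fun t => cos _) _ => apply: ct_cos
  | |- cont_at (fun t => @Num.norm _ _ _) _ => apply: ct_norm
  | |- cont_at (@GRing.add _ ?c) _ => apply: (ctD (fun=> c) (fun t => t))
  | |- cont_at (@GRing.mul _ ?c) _ => apply: (ctM (fun=> c) (fun t => t))
  | |- cont_at (@GRing.opp _) _ => apply: (ctN (fun t => t))
  | |- cont_at (@GRing.inv _) _ => apply: (ctV (fun t => t))
  | |- cont_at Num.sqrt _ => apply: (ct_sqrt (fun t => t))
  | |- cont_at (@ln _) _ => apply: (ct_ln (fun t => t))
  | |- cont_at (@atan _) _ => apply: (ct_atan (fun t => t))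
  | |- cont_at (@sin _) _ => apply: (ct_sin (fun t => t))
  | |- cont_at (@cos _) _ => apply: (ct_cos (fun t => t))
  | |- cont_at (@Num.norm _ _) _ => apply: (ct_norm (fun t => t))
  | |- cont_at _ _ => cont1_extra
  end.
Ltac cont := repeat cont1; cbv beta.

Ltac side :=
  lazymatch goal with
  | |- is_true (_ < _) => try lra
  | |- is_true (_ <= _) => try lra
  | |- is_true (_ < _ < _) => try lra
  | |- _ => idtac
  end.

(** * The iterated primitives of [ln (2 sin x)] *)

Section Primitive.
Context {R : realType}.
Local Notation mu := (@lebesgue_measure R).
Implicit Types (f : R -> R) (x a b : R).

(** The base point [a] is meant to be negative: the primitive then vanishes at [0] and is
    differentiable on both sides of it. *)
Definition prim a f x : R :=
  \int[mu]_(t in `[a, x]) f t - \int[mu]_(t in `[a, 0]) f t.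

Lemma prim0 a f : prim a f 0 = 0.
Proof. exact: subrr. Qed.

Lemma is_derive_prim a b f x : (forall t, a <= t <= b -> cont_at f t) ->
  a < x < b -> is_derive x 1 (prim a f) (f x).
Proof.
move=> cf /andP[ax xb].
have intf : mu.-integrable `[a, b] (EFin \o f).
  apply: continuous_compact_integrable; first exact: segment_compact.
  by apply: continuous_in_subspaceT => t; rewrite inE/= in_itv/=; exact: cf.
have cfx : cont_at f x by apply: cf; rewrite !ltW.
have [dF F'] := @continuous_FTC1_closed R f a x b xb intf ax cfx.
rewrite -[f x]addr0.
apply: (dvD _ (fun=> - \int[mu]_(t in `[a, 0]) f t)).
by rewrite -F' derive1E; exact: derivableP.
Qed.

End Primitive.

Section Clausen.
Context {R : realType}.
Implicit Types (x y t : R).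

Lemma cont_at_near (f g : R -> R) x : (\forall t \near x, f t = g t) ->
  cont_at f x -> cont_at g x.
Proof.
move=> fg; rewrite /cont_at -(nbhs_singleton fg).
by apply: cvg_trans; apply: near_eq_cvg; apply: filterS fg => t ->.
Qed.

Lemma sin_neq0 x : - pi < x < pi -> x != 0 -> sin x != 0.
Proof.
move=> /andP[x1 x2]; rewrite neq_lt => /orP[x0|x0].
  by rewrite -oppr_eq0 -sinN gt_eqF// sin_gt0_pi//; lra.
by rewrite gt_eqF// sin_gt0_pi//; lra.
Qed.

Lemma cvg_sinc : (sin t / t : R) @[t --> (0 : R)^'] --> (1 : R).
Proof.
have H := @derivable_sin R 0.
have : h^-1 *: (sin (h *: (1 : R) + 0) - sin 0) @[h --> (0 : R)^'] --> 'D_1 sin (0 : R).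
  exact: H.
rewrite derive_val cos0; apply: cvg_trans.
apply: near_eq_cvg; near=> t.
by rewrite /GRing.scale/= mulr1 addr0 sin0 subr0 mulrC.
Unshelve. all: by end_near.
Qed.

(** The function [x cot x] with its removable singularity at [0] filled. *)
Definition tcot x : R := if x == 0 then 1 else x * cos x / sin x.

Lemma tcot_continuous x : - pi < x < pi -> cont_at tcot x.
Proof.
move=> xpi; have [->|x0] := eqVneq x 0.
  apply/continuous_withinNx; rewrite /tcot eqxx.
  have : (sin t / t)^-1 * cos t @[t --> (0 : R)^'] --> (1^-1 * cos 0 : R).
    apply: cvgM; first by apply: cvgV => //; exact: cvg_sinc.
    by apply: cvg_trans (@continuous_cos R 0); apply: cvg_app; exact: nbhs_dnbhs.
  rewrite invr1 cos0 mul1r; apply: cvg_trans; apply: near_eq_cvg; near=> t.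
  have t0 : t != 0 by near: t; exact: nbhs_dnbhs_neq.
  by rewrite (negbTE t0) invf_div mulrAC.
apply: (cont_at_near (fun t => t * cos t / sin t)).
  have : \forall t \near x, t != 0.
    by apply: (cvgr_neq0 (F := nbhs x) x) => //; exact: cvg_id.
  by apply: filterS => t /negbTE t0; rewrite /tcot t0.
by cont; exact: sin_neq0.
Unshelve. all: by end_near.
Qed.

Lemma near_oo (a b x : R) : a < x < b -> \forall t \near x, a < t < b.
Proof.
move=> /andP[ax xb].
have : x \in `]a, b[ by rewrite in_itv/= ax.
by move=> /near_in_itvoo; apply: filterS => t; rewrite in_itv.
Qed.

(** From [ln z < z] at [z = 1 / sqrt y], since [ln y = - 2 ln z]. *)
Lemma xln_bound y : 0 < y -> y <= 1 -> `|y * ln y| <= 2 * Num.sqrt y.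
Proof.
move=> y0 y1; set s := Num.sqrt y.
have s0 : 0 < s by rewrite sqrtr_gt0.
have yE : y = s ^+ 2 by rewrite sqr_sqrtr// ltW.
have lny : ln y <= 0 by exact: ln_le0.
rewrite normrM gtr0_norm// ler0_norm// yE lnXn// mulr2n.
have : ln s^-1 < s^-1 by apply: ln_sublinear; rewrite invr_gt0.
rewrite lnV ?posrE// => h.
have -> : 2 * s = s ^+ 2 * (s^-1 + s^-1) by field; rewrite gt_eqF.
by rewrite ler_wpM2l ?sqr_ge0//; lra.
Qed.

Definition xln2sin x : R := x * ln (2 * `|sin x|).

(** Near [0] one has [|t| <= 2 |sin t| <= 1], so the logarithm of [2 |sin t|] is at most that of
    [|t|] in absolute value, and [xln_bound] applies to [|t|]. *)
Lemma xln2sin_near0 : \forall t \near (0 : R), `|xln2sin t| <= 2 * Num.sqrt `|t|.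
Proof.
have h1 : \forall t \near (0 : R)^', 1 / 2 < sin t / t.
  by apply: (cvgr_gt (1 : R)); [exact: cvg_sinc|lra].
have h2 : \forall t \near (0 : R), `|sin t| < 1 / 2.
  apply: (@cvgr_lt _ _ (nbhs (0 : R)) _ (fun t => `|sin t|) `|sin 0|); last by rewrite sin0 normr0; lra.
  by apply: (ct_norm (fun t => sin t)); exact: continuous_sin.
near=> t.
have [->|t0] := eqVneq t 0.
  by rewrite /xln2sin mul0r normr0 mulr_ge0// sqrtr_ge0.
have st : 1 / 2 < sin t / t.
  by move: t0; near: t; move: h1; rewrite near_withinE.
have stn : `|sin t / t| = sin t / t by rewrite gtr0_norm//; lra.
have h : `|t| <= 2 * `|sin t|.
  have : 1 / 2 * `|t| < `|sin t|.
    by rewrite -ltr_pdivlMr ?normr_gt0// -normf_div stn.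
  lra.
have s1 : 2 * `|sin t| <= 1.
  suff : `|sin t| < 1 / 2 by lra.
  by near: t.
have tp : 0 < `|t| by rewrite normr_gt0.
apply: le_trans (xln_bound `|t| tp (le_trans h s1)).
rewrite /xln2sin !normrM normr_id ler_wpM2l//.
rewrite (ler0_norm (ln_le0 s1)) (ler0_norm (ln_le0 (le_trans h s1))).
by rewrite lerN2 ler_ln ?posrE//; exact: lt_le_trans h.
Unshelve. all: by end_near.
Qed.

Lemma xln2sin_continuous x : - pi < x < pi -> cont_at xln2sin x.
Proof.
move=> xpi; have [->|x0] := eqVneq x 0.
  rewrite /cont_at {2}/xln2sin mul0r; apply/norm_cvg0P.
  apply: (@squeeze_cvgr _ _ _ _ (fun=> 0) (fun t => 2 * Num.sqrt `|t|)).
  - near=> t; rewrite normr_ge0/=; near: t; exact: xln2sin_near0.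
  - exact: cvg_cst.
  - have : cont_at (fun t : R => 2 * Num.sqrt `|t|) 0 by cont.
    by rewrite /cont_at normr0 sqrtr0 mulr0.
rewrite /xln2sin; cont.
by rewrite mulr_gt0// normr_gt0; exact: sin_neq0.
Unshelve. all: by end_near.
Qed.

Lemma is_derive_xln2sin x : 0 < x < pi ->
  is_derive x 1 xln2sin (ln (2 * sin x) + x * cos x / sin x).
Proof.
move=> xpi; apply: (@near_eq_is_derive _ _ _ (fun t => t * ln (2 * sin t))).
  have := near_oo _ _ _ xpi; apply: filterS => t tpi.
  by rewrite /xln2sin gtr0_norm//; exact: sin_gt0_pi.
have s0 : 0 < sin x by exact: sin_gt0_pi.
derive; first by rewrite mulr_gt0.
by field; rewrite gt_eqF.
Qed.

(** Each integration gives up a margin: [tcot] is continuous within [pi], its primitive is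
    differentiated within [5/6 pi] and that of [lob] within [3/4 pi], which still contains the
    argument [2/3 pi] where [slob] is needed. *)
Definition tcot_prim := prim (- (5 / 6 * pi)) tcot.

Lemma is_derive_tcot_prim x : - (5 / 6 * pi) < x < 5 / 6 * pi ->
  is_derive x 1 tcot_prim (tcot x).
Proof.
apply: is_derive_prim => t /andP[? ?]; have := @pi_gt0 R.
by move=> ?; apply: tcot_continuous; lra.
Qed.

(* The primitive of [ln (2 sin x)] vanishing at [0] (minus the Lobachevsky
   function), written so that the singularity at [0] is explicit. *)
Definition lob x : R := xln2sin x - tcot_prim x.

Lemma lob0 : lob 0 = 0.
Proof. by rewrite /lob /xln2sin mul0r /tcot_prim prim0 subrr. Qed.

Lemma lob_continuous x : - (5 / 6 * pi) < x < 5 / 6 * pi -> cont_at lob x.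
Proof.
move=> xpi; have pi0 := @pi_gt0 R; apply: ctD.
  by apply: xln2sin_continuous; lra.
by apply: ctN; exact: is_derive_continuous (is_derive_tcot_prim _ xpi).
Qed.

Lemma is_derive_lob x : 0 < x < 5 / 6 * pi -> is_derive x 1 lob (ln (2 * sin x)).
Proof.
move=> xpi; have pi0 := @pi_gt0 R; rewrite /lob.
apply: is_derive_eq.
  apply: (dvD xln2sin); first by apply: is_derive_xln2sin; lra.
  by apply: dvN; apply: is_derive_tcot_prim; lra.
by rewrite /tcot gt_eqF ?addrK//; lra.
Qed.

Definition slob := prim (- (3 / 4 * pi)) lob.

Lemma slob0 : slob 0 = 0.
Proof. exact: prim0. Qed.

Lemma is_derive_slob x : - (3 / 4 * pi) < x < 3 / 4 * pi ->
  is_derive x 1 slob (lob x).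
Proof.
apply: is_derive_prim => t /andP[? ?]; have := @pi_gt0 R.
by move=> ?; apply: lob_continuous; lra.
Qed.

Lemma slob_continuous x : - (3 / 4 * pi) < x < 3 / 4 * pi -> cont_at slob x.
Proof. by move=> /is_derive_slob; exact: is_derive_continuous. Qed.

End Clausen.

(** * Reflection and distribution relations *)

Section Distribution.
Context {R : realType}.
Implicit Types (f : R -> R) (x a b : R).

Lemma dv_lob f x a : 0 < f x < 5 / 6 * pi -> is_derive x 1 f a ->
  is_derive x 1 (fun t => lob (f t)) (a * ln (2 * sin (f x))).
Proof.
move=> fx fa; rewrite mulrC.
exact: (dv_comp lob f _ _ _ (is_derive_lob _ fx) fa).
Qed.

Lemma dv_slob f x a : - (3 / 4 * pi) < f x < 3 / 4 * pi -> is_derive x 1 f a ->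
  is_derive x 1 (fun t => slob (f t)) (a * lob (f x)).
Proof.
move=> fx fa; rewrite mulrC.
exact: (dv_comp slob f _ _ _ (is_derive_slob _ fx) fa).
Qed.

Lemma ct_lob f x : - (5 / 6 * pi) < f x < 5 / 6 * pi -> cont_at f x ->
  cont_at (fun t => lob (f t)) x.
Proof. by move=> fx; apply: ct_comp; exact: lob_continuous. Qed.

Lemma ct_slob f x : - (3 / 4 * pi) < f x < 3 / 4 * pi -> cont_at f x ->
  cont_at (fun t => slob (f t)) x.
Proof. by move=> fx; apply: ct_comp; exact: slob_continuous. Qed.

End Distribution.

Ltac derive1_extra ::=
  lazymatch goal with
  | |- is_derive _ _ (fun t => lob _) _ => eapply dv_lob
  | |- is_derive _ _ (fun t => slob _) _ => eapply dv_slob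
  | |- is_derive _ _ lob _ => eapply (dv_lob (fun t => t))
  | |- is_derive _ _ slob _ => eapply (dv_slob (fun t => t))
  end.
Ltac cont1_extra ::=
  lazymatch goal with
  | |- cont_at (fun t => lob _) _ => apply: ct_lob
  | |- cont_at (fun t => slob _) _ => apply: ct_slob
  | |- cont_at lob _ => apply: (ct_lob (fun t => t))
  | |- cont_at slob _ => apply: (ct_slob (fun t => t))
  end.

Section Relations.
Context {R : realType}.
Implicit Types (F : R -> R) (x a b : R).

(** The source of every functional equation of [lob] and [slob] below: the derivative vanishes on
    the open interval by an identity one level lower, and continuity takes care of [0], where
    [ln (2 sin x)] is singular. *)
Lemma derive0_const F a b : a < b ->
  (forall x, a < x < b -> is_derive x 1 F 0) ->
  (forall x, a <= x <= b -> cont_at F x) -> F b = F a.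
Proof.
move=> ab dF cF; apply/eqP; rewrite -subr_eq0.
have dF' x : x \in `]a, b[ -> is_derive x 1 F 0 by rewrite in_itv/=; exact: dF.
have [|c _ ->] := MVT ab dF'; last by rewrite mul0r.
by apply: continuous_in_subspaceT => x; rewrite inE/= in_itv/=; exact: cF.
Qed.

Lemma cos_pi3 : cos (pi / 3) = 1 / 2 :> R.
Proof.
have pi0 := @pi_gt0 R.
set c := cos (pi / 3).
have c0 : 0 < c by apply: cos_gt0_pihalf; lra.
have : cos (pi / 3 + (pi / 3) *+ 2) = -1 :> R.
  by rewrite -[RHS]cospi; congr cos; field.
rewrite cosD cos_mulr2n sin_mulr2n -/c.
have := @sin2cos2 R (pi / 3); rewrite -/c => ss h.
have css := congr1 (fun y => c * y) ss.
(* The product is [4 c^3 - 3 c + 1], which the triple angle formula at [pi / 3] makes zero. *)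
have : (c + 1) * (2 * c - 1) ^+ 2 == 0 by apply/eqP; nra.
by rewrite mulf_eq0 sqrf_eq0 => /orP[|] /eqP; lra.
Qed.

Lemma sin_pi6 : sin (pi / 6) = 1 / 2 :> R.
Proof.
have pi0 := @pi_gt0 R.
by rewrite -cos_pi3 -[in RHS](_ : pi / 2 - pi / 6 = pi / 3) ?cosB ?cos_pihalf ?sin_pihalf; lra.
Qed.

Lemma cos_pi6 : cos (pi / 6) = Num.sqrt 3 / 2 :> R.
Proof.
have pi0 := @pi_gt0 R.
have c0 : 0 < cos (pi / 6) :> R by apply: cos_gt0_pihalf; lra.
have cc : cos (pi / 6) ^+ 2 = 3 / 4 :> R by rewrite cos2sin2 sin_pi6; field.
apply/eqP; rewrite -(eqrXn2 (n := 2))// ?(ltW c0) ?divr_ge0 ?sqrtr_ge0// cc.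
by rewrite exprMn sqr_sqrtr//; apply/eqP; field.
Qed.

Lemma sin_pi3 : sin (pi / 3) = Num.sqrt 3 / 2 :> R.
Proof.
have pi0 := @pi_gt0 R.
rewrite -cos_pi6 -[in RHS](_ : pi / 2 - pi / 3 = pi / 6); last by field.
by rewrite cosB cos_pihalf sin_pihalf; ring.
Qed.

Lemma sin_pihalfB x : sin (pi / 2 - x) = cos x.
Proof. by rewrite sinB cos_pihalf sin_pihalf; ring. Qed.

Lemma sin_pihalfD x : sin (pi / 2 + x) = cos x.
Proof. by rewrite sinD cos_pihalf sin_pihalf; ring. Qed.

Lemma atan_sqrt3V : atan (Num.sqrt 3)^-1 = pi / 6 :> R.
Proof.
have pi0 := @pi_gt0 R.
rewrite -[RHS]tanK; last by rewrite in_itv/=; lra.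
by rewrite /tan sin_pi6 cos_pi6; congr atan; field; rewrite sqrtr_eq0 -ltNge; lra.
Qed.

(** By [sin 2x = 2 sin x cos x] the function [g] is constant; its value at [0] is [lob (pi / 2)],
    its value at [pi / 4] half of that. *)
Lemma lob_pihalf : lob (pi / 2) = 0 :> R.
Proof.
have pi0 := @pi_gt0 R.
pose g (x : R) := lob (2 * x) / 2 - lob x + lob (pi / 2 - x).
suff : g (pi / 4) = g 0.
  rewrite /g mulr0 lob0 !subr0 (_ : 2 * (pi / 4) = pi / 2); last by field.
  by rewrite (_ : pi / 2 - pi / 4 = pi / 4); [lra|field].
apply: derive0_const => [|x xpi|x xpi]; first lra; last by rewrite /g; cont; lra.
rewrite /g; derive; [lra..|].
have sx : 0 < sin x by apply: sin_gt0_pi; lra.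
have cx : 0 < cos x by apply: cos_gt0_pihalf; lra.
rewrite sin_pihalfB [2 * x]mulr_natl sin_mulr2n.
have -> : 2 * ((cos x * sin x) *+ 2) = (2 * sin x) * (2 * cos x) by ring.
by rewrite lnM ?posrE ?mulr_gt0//; field.
Qed.

Lemma lob_reflect x : 0 <= x < pi / 3 -> lob (pi / 2 + x) = - lob (pi / 2 - x).
Proof.
have pi0 := @pi_gt0 R.
move=> /andP[]; rewrite le_eqVlt => /predU1P[<- _|x0 xpi].
  by rewrite addr0 subr0 lob_pihalf oppr0.
pose g (x : R) := lob (pi / 2 + x) + lob (pi / 2 - x).
suff : g x = g 0 by rewrite /g addr0 subr0 lob_pihalf; lra.
apply: derive0_const => [//|y ypi|y ypi]; last by rewrite /g; cont; lra.
rewrite /g; derive; [lra..|].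
by rewrite sin_pihalfB sin_pihalfD; ring.
Qed.

Lemma slob_reflect : slob (2 / 3 * pi) = slob (pi / 3) :> R.
Proof.
have pi0 := @pi_gt0 R.
pose g (x : R) := slob (pi / 2 + x) - slob (pi / 2 - x).
suff : g (pi / 6) = g 0.
  rewrite /g addr0 subr0 subrr (_ : pi / 2 + pi / 6 = 2 / 3 * pi); last by field.
  by rewrite (_ : pi / 2 - pi / 6 = pi / 3); [lra|field].
apply: derive0_const => [|x xpi|x xpi]; first lra; last by rewrite /g; cont; lra.
rewrite /g; derive; [lra..|].
by rewrite lob_reflect; [ring|lra].
Qed.

Lemma lob_double x : 0 < x <= pi / 4 -> lob (2 * x) / 2 - lob x + lob (pi / 2 - x) = 0.
Proof.
have pi0 := @pi_gt0 R.
move=> /andP[x0 xpi].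
pose g (x : R) := lob (2 * x) / 2 - lob x + lob (pi / 2 - x).
suff : g x = g 0 by rewrite /g mulr0 lob0 !subr0 lob_pihalf; lra.
apply: derive0_const => [//|y ypi|y ypi]; last by rewrite /g; cont; lra.
rewrite /g; derive; [lra..|].
have sx : 0 < sin y by apply: sin_gt0_pi; lra.
have cx : 0 < cos y by apply: cos_gt0_pihalf; lra.
rewrite sin_pihalfB [2 * y]mulr_natl sin_mulr2n.
have -> : 2 * ((cos y * sin y) *+ 2) = (2 * sin y) * (2 * cos y) by ring.
by rewrite lnM ?posrE ?mulr_gt0//; field.
Qed.

(** The duplication formula, integrated once more and taken at [pi / 6], where [2 x] and
    [pi / 2 - x] are both [pi / 3]. *)
Lemma slob_double :
  slob (pi / 3) / 4 - slob (pi / 6) - slob (pi / 3) = - slob (pi / 2) :> R.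
Proof.
have pi0 := @pi_gt0 R.
pose g (x : R) := slob (2 * x) / 4 - slob x - slob (pi / 2 - x).
suff : g (pi / 6) = g 0.
  rewrite /g mulr0 slob0 !subr0 (_ : 2 * (pi / 6) = pi / 3); last by field.
  by rewrite (_ : pi / 2 - pi / 6 = pi / 3); [lra|field].
apply: derive0_const => [|x xpi|x xpi]; first lra; last by rewrite /g; cont; lra.
rewrite /g; derive; [lra..|].
by have := @lob_double x; lra.
Qed.

Lemma sin_triple x :
  sin (3 * x) = 4 * sin x * sin (pi / 3 + x) * sin (pi / 3 - x).
Proof.
have pi0 := @pi_gt0 R.
have -> : 3 * x = x + x *+ 2 by rewrite -[x *+ 2]mulr_natl; ring.
rewrite sinD sin_mulr2n cos_mulr2n (sinD (pi / 3)) (sinB (pi / 3)) cos_pi3 sin_pi3.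
have -> : 4 * sin x * (Num.sqrt 3 / 2 * cos x + 1 / 2 * sin x) *
    (Num.sqrt 3 / 2 * cos x - 1 / 2 * sin x) =
  sin x * (Num.sqrt 3 ^+ 2 * cos x ^+ 2 - sin x ^+ 2) by field.
by rewrite sqr_sqrtr// sin2cos2; ring.
Qed.

(** The distribution relation of order three: [sin_triple] integrated twice and taken at [pi / 6].
    Together with [slob_double] it determines [slob (pi / 3)] and [slob (pi / 6)] as multiples of
    [slob (pi / 2)]. *)
Lemma slob_triple :
  2 * slob (pi / 6) = 2 * slob (pi / 3) - 8 / 9 * slob (pi / 2) :> R.
Proof.
have pi0 := @pi_gt0 R.
pose h (x : R) := lob (3 * x) / 3 - lob x - lob (pi / 3 + x) + lob (pi / 3 - x).
have h0 x : 0 < x < pi / 6 -> h x = 0.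
  move=> /andP[x0 xpi].
  suff : h x = h 0 by rewrite /h mulr0 lob0 !subr0 !addr0; lra.
  apply: derive0_const => [//|y ypi|y ypi]; last by rewrite /h; cont; lra.
  rewrite /h; derive; [lra..|].
  have s1 : 0 < sin y by apply: sin_gt0_pi; lra.
  have s2 : 0 < sin (pi / 3 + y) by apply: sin_gt0_pi; lra.
  have s3 : 0 < sin (pi / 3 - y) by apply: sin_gt0_pi; lra.
  rewrite sin_triple.
  have -> : 2 * (4 * sin y * sin (pi / 3 + y) * sin (pi / 3 - y)) =
    (2 * sin y) * (2 * sin (pi / 3 + y)) * (2 * sin (pi / 3 - y)) by ring.
  by rewrite !lnM ?posrE ?mulr_gt0//; field.
pose g (x : R) := slob (3 * x) / 9 - slob x - slob (pi / 3 + x) - slob (pi / 3 - x).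
have : g (pi / 6) = g 0.
  apply: derive0_const => [|x xpi|x xpi]; first lra; last by rewrite /g; cont; lra.
  rewrite /g; derive; [lra..|].
  by have := h0 x xpi; rewrite /h; lra.
rewrite /g mulr0 slob0 !subr0 !addr0 (_ : 3 * (pi / 6) = pi / 2); last by field.
rewrite (_ : pi / 3 + pi / 6 = pi / 2); last by field.
by rewrite (_ : pi / 3 - pi / 6 = pi / 6); [lra|field].
Qed.

End Relations.

(** * The sum of the inverse odd cubes and zeta(3) *)

Section OddCubes.
Context {R : realType}.
Implicit Types (x y a b : R) (n k : nat).

Lemma mvt_bound (F f : R -> R) a b M : a < b ->
  (forall x, a < x < b -> is_derive x 1 F (f x)) ->
  (forall x, a <= x <= b -> cont_at F x) ->
  (forall x, a < x < b -> `|f x| <= M) -> `|F b - F a| <= M * (b - a).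
Proof.
move=> ab dF cF fM.
have dF' x : x \in `]a, b[ -> is_derive x 1 F (f x).
  by rewrite in_itv/=; exact: dF.
have [|c] := MVT ab dF'.
  by apply: continuous_in_subspaceT => x; rewrite inE/= in_itv/=; exact: cF.
rewrite in_itv/= => cab ->; rewrite normrM (gtr0_norm (_ : 0 < b - a)) ?subr_gt0//.
by rewrite ler_wpM2r ?fM// subr_ge0 ltW.
Qed.

Lemma dv_xln2sin (f : R -> R) x a : 0 < f x < pi -> is_derive x 1 f a ->
  is_derive x 1 (fun t => xln2sin (f t))
    (a * (ln (2 * sin (f x)) + f x * cos (f x) / sin (f x))).
Proof.
move=> fx fa; rewrite mulrC.
exact: (dv_comp xln2sin f _ _ _ (is_derive_xln2sin _ fx) fa).
Qed.

Lemma ct_xln2sin (f : R -> R) x : - pi < f x < pi -> cont_at f x ->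
  cont_at (fun t => xln2sin (f t)) x.
Proof. by move=> fx; apply: ct_comp; exact: xln2sin_continuous. Qed.

End OddCubes.

Ltac derive1_extra ::=
  lazymatch goal with
  | |- is_derive _ _ (fun t => lob _) _ => eapply dv_lob
  | |- is_derive _ _ (fun t => slob _) _ => eapply dv_slob
  | |- is_derive _ _ (fun t => xln2sin _) _ => eapply dv_xln2sin
  | |- is_derive _ _ lob _ => eapply (dv_lob (fun t => t))
  | |- is_derive _ _ slob _ => eapply (dv_slob (fun t => t))
  end.
Ltac cont1_extra ::=
  lazymatch goal with
  | |- cont_at (fun t => lob _) _ => apply: ct_lob
  | |- cont_at (fun t => slob _) _ => apply: ct_slob
  | |- cont_at (fun t => xln2sin _) _ => apply: ct_xln2sin
  | |- cont_at lob _ => apply: (ct_lob (fun t => t))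
  | |- cont_at slob _ => apply: (ct_slob (fun t => t))
  end.

Section OddCubes2.
Context {R : realType}.
Implicit Types (x y a b : R) (n k : nat).

(** A primitive of [x (pi - x) / sin x], by two integrations by parts from
    [d ln (tan (x / 2)) = dx / sin x]. The term [xln2sin] stands for [(x / 2) ln (2 sin (x / 2))]
    and is continuous at [0]. *)
Definition tan_log_prim x : R :=
  2 * (pi - x) * xln2sin (x / 2) - x * (pi - x) * ln (2 * cos (x / 2))
  - (pi - 2 * x) * (2 * (lob (x / 2) + lob (pi / 2 - x / 2)))
  - 8 * (slob (x / 2) - slob (pi / 2 - x / 2)).

Lemma tan_log_prim0 : tan_log_prim 0 = 8 * slob (pi / 2).
Proof.
rewrite /tan_log_prim !(mul0r, subr0) /xln2sin mul0r lob0 lob_pihalf slob0; ring.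
Qed.

Lemma tan_log_prim_pihalf : tan_log_prim (pi / 2) = 0.
Proof.
have pi0 := @pi_gt0 R.
have e : pi / 2 - pi / 2 / 2 = pi / 2 / 2 :> R by field.
have s0 : 0 < sin (pi / 2 / 2) :> R by apply: sin_gt0_pi; lra.
have cE : cos (pi / 2 / 2) = sin (pi / 2 / 2) :> R by rewrite -sin_pihalfB e.
by rewrite /tan_log_prim /xln2sin e cE gtr0_norm//; field.
Qed.

Lemma tan_log_prim_continuous x : 0 <= x <= pi / 2 -> cont_at tan_log_prim x.
Proof.
have pi0 := @pi_gt0 R; move=> xpi; rewrite /tan_log_prim.
have c0 : 0 < cos (x / 2) by apply: cos_gt0_pihalf; lra.
by cont; lra.
Qed.

Lemma is_derive_tan_log_prim x : 0 < x < pi / 2 ->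
  is_derive x 1 tan_log_prim (x * (pi - x) / sin x).
Proof.
have pi0 := @pi_gt0 R; move=> xpi; rewrite /tan_log_prim.
have c0 : 0 < cos (x / 2) by apply: cos_gt0_pihalf; lra.
have s0 : 0 < sin (x / 2) by apply: sin_gt0_pi; lra.
have cs := @cos2Dsin2 R (x / 2).
have e : (x / 2) *+ 2 = x by rewrite mulr2n; lra.
have sE : sin x = 2 * cos (x / 2) * sin (x / 2).
  by rewrite -[in LHS]e sin_mulr2n mulr2n; ring.
derive; side.
have -> : (sin x)^-1 = (cos (x / 2) / sin (x / 2) + sin (x / 2) / cos (x / 2)) / 2.
  transitivity ((cos (x / 2) ^+ 2 + sin (x / 2) ^+ 2) /
      (2 * cos (x / 2) * sin (x / 2))); first by rewrite cs sE mul1r.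
  by field; rewrite !gt_eqF.
rewrite sin_pihalfB /xln2sin gtr0_norm//.
set l1 := ln (2 * sin _); set l2 := ln (2 * cos _).
set l3 := lob (x / 2); set l4 := lob (pi / 2 - x / 2).
by field; rewrite !gt_eqF.
Qed.

(* A primitive of [2 x (pi - x) sin ((2 k + 1) x)]. *)
Definition odd_prim k x : R :=
  let N := (k.*2.+1)%:R in
  2 * ((pi - 2 * x) * sin (N * x) / N ^+ 2 - x * (pi - x) * cos (N * x) / N
       - 2 * cos (N * x) / N ^+ 3).

Lemma is_derive_odd_prim k x :
  is_derive x 1 (odd_prim k) (2 * sin ((k.*2.+1)%:R * x) * (x * (pi - x))).
Proof.
rewrite /odd_prim; set N := _%:R.
have N0 : N != 0 by rewrite pnatr_eq0.
derive.
by set s := sin _; set c := cos _; field.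
Qed.

Definition odd_sum_prim n x : R := \sum_(k < n) odd_prim k x.

Definition sin_sum n x : R := \sum_(k < n) 2 * sin ((k.*2.+1)%:R * x).

Definition cos_sum n x : R := \sum_(k < n) 2 * cos ((k.*2.+1)%:R * x).

Lemma is_derive_odd_sum_prim n x :
  is_derive x 1 (odd_sum_prim n) (sin_sum n x * (x * (pi - x))).
Proof.
elim: n => [|n IH].
  rewrite /odd_sum_prim /sin_sum big_ord0 mul0r.
  by under eq_fun do rewrite big_ord0; exact: dv_cst.
rewrite /odd_sum_prim /sin_sum big_ord_recr/= mulrDl.
under eq_fun do rewrite big_ord_recr/=.
by apply: (dvD (odd_sum_prim n)) => //; exact: is_derive_odd_prim.
Qed.

Lemma sin_sumE n x : sin_sum n x * sin x = 1 - cos ((n.*2)%:R * x).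
Proof.
elim: n => [|n IH]; first by rewrite /sin_sum big_ord0 !mul0r cos0 subrr.
rewrite /sin_sum big_ord_recr/= mulrDl -/(sin_sum n x) IH doubleS.
have -> : (n.*2.+2)%:R * x = (n.*2.+1)%:R * x + x by rewrite -[in LHS]natr1; ring.
have -> : (n.*2)%:R * x = (n.*2.+1)%:R * x - x by rewrite -[in RHS]natr1; ring.
by rewrite cosB cosD; ring.
Qed.

Lemma cos_sumE n x : cos_sum n x * sin x = sin ((n.*2)%:R * x).
Proof.
elim: n => [|n IH]; first by rewrite /cos_sum big_ord0 !mul0r sin0.
rewrite /cos_sum big_ord_recr/= mulrDl -/(cos_sum n x) IH doubleS.
have -> : (n.*2.+2)%:R * x = (n.*2.+1)%:R * x + x by rewrite -[in LHS]natr1; ring.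
have -> : (n.*2)%:R * x = (n.*2.+1)%:R * x - x by rewrite -[in RHS]natr1; ring.
by rewrite sinB sinD; ring.
Qed.

Lemma cos_odd_pihalf k : cos ((k.*2.+1)%:R * (pi / 2)) = 0 :> R.
Proof.
elim: k => [|k IH]; first by rewrite mul1r cos_pihalf.
have -> : (k.+1.*2.+1)%:R * (pi / 2) = (k.*2.+1)%:R * (pi / 2) + pi :> R.
  by rewrite doubleS -!natr1; field.
by rewrite cosDpi IH oppr0.
Qed.

Definition odd_cubes n : R := \sum_(k < n) ((k.*2.+1)%:R ^+ 3)^-1.

Lemma odd_sum_prim_diff n :
  odd_sum_prim n (pi / 2) - odd_sum_prim n 0 = 4 * odd_cubes n.
Proof.
rewrite /odd_sum_prim /odd_cubes -sumrB mulr_sumr; apply: eq_bigr => k _.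
rewrite /odd_prim cos_odd_pihalf !mulr0 sin0 cos0.
set N := _%:R; have N0 : N != 0 by rewrite pnatr_eq0.
by field.
Qed.

Lemma continuous_cos_sum n x : cont_at (cos_sum n) x.
Proof.
elim: n => [|n IH]; rewrite /cos_sum.
  by under eq_fun do rewrite big_ord0; exact: ct_cst.
under eq_fun do rewrite big_ord_recr/=.
by apply: (ctD (cos_sum n)) => //; cont.
Qed.

Lemma mvt (F f : R -> R) a b : a < b ->
  (forall x, a <= x <= b -> is_derive x 1 F (f x)) ->
  exists c, a < c < b /\ F b - F a = f c * (b - a).
Proof.
move=> ab dF.
have dF' x : x \in `]a, b[ -> is_derive x 1 F (f x).
  by rewrite in_itv/= => /andP[? ?]; apply: dF; lra.
have [|c] := MVT ab dF'; last by rewrite in_itv/= => cab Fab; exists c.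
apply: continuous_in_subspaceT => x; rewrite inE/= in_itv/= => xab.
exact: is_derive_continuous (dF x xab).
Qed.

(** Up to [pi / 3] the mean value theorem with [cos >= 1/2] is enough; beyond,
    [sin x > 1/2 > x / 4]. *)
Lemma sin_lower x : 0 < x < pi / 2 -> x / 4 <= sin x.
Proof.
have pi0 := @pi_gt0 R; have pi2 := @pihalf_lt2 R; move=> /andP[x0 xpi].
have [xle|xge] := leP x (pi / 3); last first.
  have : 1 / 2 < sin x by rewrite -sin_pi6 ltr_sin ?in_itv//=; lra.
  lra.
have [c [cx]] := @mvt sin cos 0 x x0 (fun y _ => is_derive_sin y).
rewrite sin0 !subr0 => ->; have : 1 / 2 <= cos c; last nra.
by rewrite -cos_pi3 leNgt ltr_cos ?in_itv//=; lra.
Qed.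

Lemma sin_subM_cos_bound x : 0 < x < pi / 2 -> 0 <= sin x - x * cos x <= x ^+ 2.
Proof.
have pi0 := @pi_gt0 R; move=> /andP[x0 xpi].
have dF y : is_derive y 1 (fun t => sin t - t * cos t) (y * sin y).
  by derive; ring.
have [c [cx]] := mvt _ _ _ _ x0 (fun y _ => dF y).
rewrite sin0 mul0r !subr0 => ->.
have s0 : 0 < sin c by apply: sin_gt0_pi; lra.
have s1 := @sin_le1 R c.
have h1 : 0 <= c * sin c by rewrite mulr_ge0; lra.
have h2 : c * sin c <= x by rewrite (@le_trans _ _ c)// ?ler_piMr; lra.
by rewrite mulr_ge0 ?(ltW x0)//= expr2 ler_wpM2r// ltW.
Qed.

(** [df] is the derivative of [x (pi - x) / sin x]. It stays bounded at [0] because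
    [sin x - x cos x] is at most [x^2]; with [sin x >= x / 4] its two terms are bounded by [16 pi]
    and [4]. *)
Lemma remainder_bound x :
  let df := ((pi - 2 * x) * sin x - x * (pi - x) * cos x) / sin x ^+ 2 in
  0 < x < pi / 2 -> `|df| <= 16 * pi + 4.
Proof.
have pi0 := @pi_gt0 R; move=> df xpi.
have s0 : 0 < sin x by apply: sin_gt0_pi; lra.
have sl := sin_lower _ xpi; have /andP[d0 d1] := sin_subM_cos_bound _ xpi.
have -> : df = (pi - x) * ((sin x - x * cos x) / sin x ^+ 2) - x / sin x.
  by rewrite /df; field; rewrite gt_eqF.
have h1 : 0 <= x / sin x <= 4.
  apply/andP; split; first by apply: divr_ge0; lra.
  by rewrite ler_pdivrMr//; lra.
have h2 : 0 <= (sin x - x * cos x) / sin x ^+ 2 <= 16.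
  apply/andP; split; first by rewrite divr_ge0 ?sqr_ge0.
  rewrite ler_pdivrMr ?exprn_gt0//; nra.
have h3 : 0 <= (pi - x) * ((sin x - x * cos x) / sin x ^+ 2) <= 16 * pi.
  move: h2 => /andP[h2 h2']; apply/andP; split.
    by apply: mulr_ge0; lra.
  by rewrite mulrC ler_pM//; lra.
by rewrite ler_norml; lra.
Qed.

(** By [sin_sumE] the quantity is, up to sign, the integral of [cos (2 n x) x (pi - x) / sin x] over
    [0 < x < pi / 2]; one integration by parts gains the factor [1 / (2 n)]. *)
Lemma odd_cubes_bound n : (0 < n)%N ->
  `|8 * slob (pi / 2) + 4 * odd_cubes n| <= (16 * pi + 4) * (pi / 2) / (n.*2)%:R.
Proof.
have pi0 := @pi_gt0 R; move=> n0; set N := (n.*2)%:R.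
have N0 : 0 < N :> R by rewrite ltr0n double_gt0.
(* The last term is the boundary term [x (pi - x) sin (N x) / (N sin x)], written with [cos_sum] so
   that [H] is continuous at [0]. *)
pose H x := tan_log_prim x - odd_sum_prim n x - x * (pi - x) * cos_sum n x / N.
pose df x := ((pi - 2 * x) * sin x - x * (pi - x) * cos x) / sin x ^+ 2.
have dH x : 0 < x < pi / 2 -> is_derive x 1 H (- (df x * sin (N * x) / N)).
  move=> xpi; have s0 : 0 < sin x by apply: sin_gt0_pi; lra.
  have d1 := is_derive_tan_log_prim x xpi.
  have d2 := dvN _ _ _ (is_derive_odd_sum_prim n x).
  have [d3 [d3t d3E]] : exists d3, is_derive x 1
      (fun t => t * (pi - t) * (sin (N * t) / sin t) / N) d3 /\
      d3 = (df x * sin (N * x) / N) + x * (pi - x) * cos (N * x) / sin x.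
    eexists; split; first by repeat derive1; rewrite gt_eqF.
    by cbv beta; rewrite /df; field; rewrite !gt_eqF.
  have d4 : is_derive x 1 (fun t => t * (pi - t) * cos_sum n t / N) d3.
    apply: near_eq_is_derive d3t.
    have : \forall t \near x, 0 < t < pi / 2 by exact: near_oo.
    apply: filterS => t tpi.
    have st : 0 < sin t by apply: sin_gt0_pi; lra.
    by rewrite -cos_sumE mulfK ?gt_eqF.
  apply: (is_derive_eq (dvD _ _ _ _ _ (dvD _ _ _ _ _ d1 d2) (dvN _ _ _ d4))).
  rewrite d3E.
  have -> : sin_sum n x = (1 - cos (N * x)) / sin x.
    by rewrite -sin_sumE mulfK ?gt_eqF.
  by rewrite /df; field; rewrite !gt_eqF.
have cH x : 0 <= x <= pi / 2 -> cont_at H x.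
  move=> xpi; apply: (ctD (fun t => tan_log_prim t - odd_sum_prim n t)).
    apply: (ctD tan_log_prim); first exact: tan_log_prim_continuous.
    by apply: ctN; exact: is_derive_continuous (is_derive_odd_sum_prim n x).
  by cont; exact: continuous_cos_sum.
have -> : 8 * slob (pi / 2) + 4 * odd_cubes n = - (H (pi / 2) - H 0).
  rewrite /H mul0r tan_log_prim0 tan_log_prim_pihalf -odd_sum_prim_diff.
  have -> : cos_sum n (pi / 2) = 0.
    by apply: big1 => k _; rewrite cos_odd_pihalf mulr0.
  by field; rewrite gt_eqF.
rewrite normrN; have -> : (16 * pi + 4) * (pi / 2) / N =
    (16 * pi + 4) / N * (pi / 2 - 0) by field; rewrite gt_eqF.
apply: mvt_bound dH cH _ => [|x xpi]; first lra.
rewrite normrN normrM (normrM (df x)) (normfV N) (gtr0_norm N0).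
rewrite ler_wpM2r ?invr_ge0 ?(ltW N0)//.
rewrite -[leRHS]mulr1 ler_pM//; [exact: (remainder_bound x)|exact: sin_max].
Qed.

Lemma cvg_odd_cubes : odd_cubes n @[n --> \oo] --> - 2 * slob (pi / 2).
Proof.
(* The constant of [odd_cubes_bound], divided by [4] for the coefficient of [odd_cubes] and by [2]
   for [n.*2]. *)
pose C : R := (16 * pi + 4) * (pi / 2) / 8.
have H : (fun n => C * n.+1%:R^-1) @ \oo --> (0 : R).
  rewrite -(mulr0 C); apply: cvgMr; exact: cvg_harmonic.
rewrite -(cvg_shiftn 1); apply/subr_cvg0/norm_cvg0P.
apply: (@squeeze_cvgr _ _ _ _ (fun=> 0) (fun n => C * n.+1%:R^-1)) => //.
  apply: nearW => n; rewrite normr_ge0/= addn1.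
  have -> : odd_cubes n.+1 - (- 2) * slob (pi / 2) =
    (8 * slob (pi / 2) + 4 * odd_cubes n.+1) / 4 by field.
  rewrite normrM (@ger0_norm _ (4^-1)) ?invr_ge0// ler_pdivrMr//.
  apply: le_trans (odd_cubes_bound n.+1 _) _ => //.
  rewrite -mul2n natrM /C.
  have n0 : n.+1%:R != 0 :> R by rewrite pnatr_eq0.
  by rewrite le_eqVlt; apply/orP; left; apply/eqP; field.
exact: cvg_cst.
Qed.

Definition cubes n : R := \sum_(k < n) (k.+1%:R ^+ 3)^-1.

Lemma cubes_double n : cubes n.*2 = odd_cubes n + cubes n / 8.
Proof.
elim: n => [|n IH]; first by rewrite /cubes /odd_cubes !big_ord0 mul0r addr0.
rewrite /cubes /odd_cubes doubleS !big_ord_recr/= -/(cubes n.*2) IH.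
rewrite -/(odd_cubes n) -/(cubes n).
have -> : (n.*2.+2)%:R = 2 * n.+1%:R :> R by rewrite -natrM mul2n.
have -> : ((2 * n.+1%:R : R) ^+ 3)^-1 = (n.+1%:R ^+ 3)^-1 / 8.
  have : n.+1%:R != 0 :> R by rewrite pnatr_eq0.
  by move: (n.+1%:R : R) => b b0; field.
by move: (((n.*2.+1)%:R : R) ^+ 3)^-1 => a; ring.
Qed.

Lemma cubes_homo : {homo cubes : n m / (n <= m)%N >-> n <= m}.
Proof.
apply/nondecreasing_seqP => n; rewrite /cubes big_ord_recr/= lerDl.
by rewrite invr_ge0 exprn_ge0.
Qed.

(** The even terms make up one eighth of the series, so its limit [L] satisfies
    [L = - 2 slob (pi / 2) + L / 8]. *)
Lemma riemann_zeta3 : riemann_zeta (3 : R) = - (16 / 7) * slob (pi / 2).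
Proof.
have seriesE : series (fun n : nat => n.+1%:R `^ (- 3) : R) = cubes.
  apply/funext => n; rewrite /series/= big_mkord; apply: eq_bigr => k _.
  by rewrite powRN -powR_mulrn.
rewrite /riemann_zeta seriesE.
have oc := cvg_odd_cubes.
have ocl n : odd_cubes n <= - 2 * slob (pi / 2).
  rewrite -(cvg_lim _ oc)//; apply: nondecreasing_cvgn_le; last by apply/cvg_ex; eexists; exact: oc.
  apply/nondecreasing_seqP => m; rewrite /odd_cubes big_ord_recr/= lerDl.
  by rewrite invr_ge0 exprn_ge0.
(* The bound comes from the same recursion: [cubes n <= cubes (2 n) <= - 2 slob (pi / 2) + cubes n /
   8]. *)
have ccvg : cvgn cubes.
  apply: nondecreasing_is_cvgn; first exact: cubes_homo.
  exists (- (16 / 7) * slob (pi / 2)) => _ [n _ <-].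
  have h1 : cubes n <= cubes n.*2 by apply: cubes_homo; rewrite -addnn leq_addr.
  by have := ocl n; rewrite cubes_double in h1; lra.
have dbl : cubes n.*2 @[n --> \oo] --> limn cubes.
  apply: (cvg_comp (fun n => n.*2) cubes); last exact: ccvg.
  apply/cvgnyPge => A; exists A => // n /= An.
  by rewrite (leq_trans An)// -addnn leq_addr.
have dbl' : cubes n.*2 @[n --> \oo] --> - 2 * slob (pi / 2) + limn cubes / 8.
  under eq_fun do rewrite cubes_double.
  by apply: cvgD => //; apply: cvgMl; exact: ccvg.
have : (limn cubes : R) = - 2 * slob (pi / 2) + limn cubes / 8.
  exact: (cvg_unique (@Rhausdorff R) dbl dbl').
lra.
Qed.
End OddCubes2.

(** * The function [kap] and its deformation in [m] *)

Section Artanh.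
Context {R : realType}.
Implicit Types (x m v w z : R).

Definition artanh z : R := (ln (1 + z) - ln (1 - z)) / 2.

Lemma artanh0 : artanh 0 = 0.
Proof. by rewrite /artanh addr0 subr0 subrr mul0r. Qed.

Lemma artanh_ge0 z : 0 <= z < 1 -> 0 <= artanh z.
Proof.
move=> /andP[z0 z1]; rewrite /artanh divr_ge0// subr_ge0 ler_ln ?posrE; lra.
Qed.

Lemma dv_artanh (f : R -> R) x a : -1 < f x < 1 -> is_derive x 1 f a ->
  is_derive x 1 (fun t => artanh (f t)) (a / (1 - f x ^+ 2)).
Proof.
move=> fx fa; have h1 : 1 + f x != 0 by rewrite gt_eqF//; lra.
have h2 : 1 - f x != 0 by rewrite gt_eqF//; lra.
have -> : a / (1 - f x ^+ 2) =
    ((0 + a) / (1 + f x) + - ((0 - a) / (1 - f x))) / 2.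
  have -> : 1 - f x ^+ 2 = (1 - f x) * (1 + f x) by ring.
  by field; rewrite h1 h2.
rewrite /artanh; derive; [lra|exact: fa|lra|exact: fa|].
by field; rewrite h1 h2.
Qed.

Lemma ct_artanh (f : R -> R) x : -1 < f x < 1 -> cont_at f x ->
  cont_at (fun t => artanh (f t)) x.
Proof.
move=> fx cf; rewrite /artanh; apply: ctM; last exact: ct_cst.
apply: ctD; first by apply: ct_ln; [lra|apply: ctD => //; exact: ct_cst].
by apply: ctN; apply: ct_ln; [lra|apply: ctD; [exact: ct_cst|exact: ctN]].
Qed.

Definition sroot m v : R := Num.sqrt (1 - (1 + m ^+ 2) * v ^+ 2).

(* The integral of [m v^2 / ((1 - v^2) (1 - (1 + m^2 + q^2) v^2))] over [0 < q < m]. *)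
Definition kap m v : R :=
  m * v / sroot m v * artanh (m * v / sroot m v) / (1 - v ^+ 2).

(** The derivative of [kap m v] in [m]. As [m / sroot m v] has derivative
    [(1 - v^2) / sroot m v ^ 3], the factor [1 - v^2] disappears. *)
Definition dkap m v : R :=
  v / sroot m v ^+ 3 * artanh (m * v / sroot m v)
  + m * v ^+ 2 / (sroot m v ^+ 2 * (1 - (1 + 2 * m ^+ 2) * v ^+ 2)).

Definition uroot m : R := Num.sqrt (1 + 2 * m ^+ 2).

(** The primitive of [dkap m] that vanishes at [0], found by parts from [d (1 / sroot m w) = (1 +
    m^2) w dw / sroot m w ^ 3]. *)
Definition kapint m w : R :=
  (artanh (m * w / sroot m w) / sroot m w - m / uroot m * artanh (uroot m * w))
  / (1 + m ^+ 2).

Lemma sroot_sqr m v : (1 + 2 * m ^+ 2) * v ^+ 2 <= 1 ->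
  sroot m v ^+ 2 = 1 - (1 + m ^+ 2) * v ^+ 2.
Proof.
move=> h; rewrite sqr_sqrtr//.
have := sqr_ge0 m; have := sqr_ge0 v; have : 0 <= m ^+ 2 * v ^+ 2.
  by rewrite mulr_ge0 ?sqr_ge0.
lra.
Qed.

Lemma sroot_gt0 m v : (1 + 2 * m ^+ 2) * v ^+ 2 < 1 -> 0 < sroot m v.
Proof.
move=> h; rewrite sqrtr_gt0.
have : 0 <= m ^+ 2 * v ^+ 2 by rewrite mulr_ge0 ?sqr_ge0.
lra.
Qed.

(** The condition [(1 + 2 m^2) v^2 < 1] amounts to [m v < sroot m v], so it is what keeps the artanh
    of [kap] finite. *)
Lemma sroot_ratio m v : 0 <= m -> 0 <= v -> (1 + 2 * m ^+ 2) * v ^+ 2 < 1 ->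
  0 <= m * v / sroot m v < 1.
Proof.
move=> m0 v0 h; have s0 := sroot_gt0 _ _ h.
rewrite divr_ge0 ?mulr_ge0 ?(ltW s0)//= ltr_pdivrMr// mul1r.
rewrite -(ltr_pXn2r (n := 2))// ?nnegrE ?mulr_ge0 ?(ltW s0)//.
rewrite sroot_sqr ?ltW// exprMn.
lra.
Qed.

Lemma uroot_sqr m : uroot m ^+ 2 = 1 + 2 * m ^+ 2.
Proof. by rewrite sqr_sqrtr// addr_ge0// mulr_ge0// sqr_ge0. Qed.

Lemma uroot_gt0 m : 0 < uroot m.
Proof.
by rewrite sqrtr_gt0 (lt_le_trans ltr01)// lerDl mulr_ge0// sqr_ge0.
Qed.

Lemma uroot_ratio m v : 0 <= v -> (1 + 2 * m ^+ 2) * v ^+ 2 < 1 ->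
  0 <= uroot m * v < 1.
Proof.
move=> v0 h; have u0 := uroot_gt0 m.
rewrite mulr_ge0 ?(ltW u0)//=.
rewrite -(ltr_pXn2r (n := 2))// ?nnegrE ?mulr_ge0 ?(ltW u0)//.
by rewrite exprMn uroot_sqr expr1n.
Qed.

End Artanh.

Ltac derive1_extra ::=
  lazymatch goal with
  | |- is_derive _ _ (fun t => artanh _) _ => eapply dv_artanh
  | |- is_derive _ _ (fun t => lob _) _ => eapply dv_lob
  | |- is_derive _ _ (fun t => slob _) _ => eapply dv_slob
  | |- is_derive _ _ lob _ => eapply (dv_lob (fun t => t))
  | |- is_derive _ _ slob _ => eapply (dv_slob (fun t => t))
  end.
Ltac cont1_extra ::=
  lazymatch goal with
  | |- cont_at (fun t => artanh _) _ => apply: ct_artanh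
  | |- cont_at (fun t => lob _) _ => apply: ct_lob
  | |- cont_at (fun t => slob _) _ => apply: ct_slob
  | |- cont_at lob _ => apply: (ct_lob (fun t => t))
  | |- cont_at slob _ => apply: (ct_slob (fun t => t))
  end.

Section KapDerivatives.
Context {R : realType}.
Implicit Types (m v w : R).

Lemma is_derive_kap m v : 0 <= m -> 0 < v -> (1 + 2 * m ^+ 2) * v ^+ 2 < 1 ->
  is_derive m 1 (kap ^~ v) (dkap m v).
Proof.
move=> m0 v0 h; have s0 := sroot_gt0 _ _ h.
have s2 := sroot_sqr _ _ (ltW h); have z1 := sroot_ratio _ _ m0 (ltW v0) h.
have v1 : v ^+ 2 < 1.
  by have := mulr_ge0 (sqr_ge0 m) (sqr_ge0 v); lra.
have mv : 0 <= m * v by rewrite mulr_ge0 // ltW.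
have h' : 0 < (1 - (1 + m ^+ 2) * v ^+ 2) by rewrite -s2 exprn_gt0.
rewrite /kap /sroot; derive => //; rewrite -/(sroot m v) ?gt_eqF//; first lra.
rewrite /dkap; set s := sroot m v in s0 s2 z1 *; set A := artanh _.
have q0 : 0 < s ^+ 2 - (m * v) ^+ 2 by rewrite s2 exprMn; lra.
by field: s2; rewrite !gt_eqF// subr_gt0.
Qed.

Lemma is_derive_kapint m w : 0 <= m -> 0 < w -> (1 + 2 * m ^+ 2) * w ^+ 2 < 1 ->
  is_derive w 1 (kapint m) (dkap m w).
Proof.
move=> m0 v0 h; have s0 := sroot_gt0 _ _ h.
have s2 := sroot_sqr _ _ (ltW h); have z1 := sroot_ratio _ _ m0 (ltW v0) h.
have u1 := uroot_ratio _ _ (ltW v0) h.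
have u0 := uroot_gt0 m; have u2 := uroot_sqr m.
have h' : 0 < (1 - (1 + m ^+ 2) * w ^+ 2) by rewrite -s2 exprn_gt0.
have m1 : 0 < 1 + m ^+ 2 by rewrite ltr_wpDr ?sqr_ge0.
rewrite /kapint /sroot; derive => //; rewrite -/(sroot m w) ?gt_eqF//; [lra..|].
rewrite /dkap; set s := sroot m w in s0 s2 z1 *; set A := artanh _.
set B := artanh _; set u := uroot m in u0 u1 u2 *.
have q0 : 0 < s ^+ 2 - (m * w) ^+ 2 by rewrite s2 exprMn; lra.
have q1 : 0 < 1 - (u * w) ^+ 2 by rewrite exprMn u2; lra.
have q2 : 0 < 1 - (1 + 2 * m ^+ 2) * w ^+ 2 by rewrite subr_gt0.
by field: s2 u2; rewrite !gt_eqF.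
Qed.

Lemma dkap_ge0 m v : 0 <= m -> 0 <= v -> (1 + 2 * m ^+ 2) * v ^+ 2 < 1 ->
  0 <= dkap m v.
Proof.
move=> m0 v0 h; have s0 := sroot_gt0 _ _ h.
have z1 := sroot_ratio _ _ m0 v0 h.
rewrite /dkap addr_ge0//.
  by rewrite mulr_ge0 ?artanh_ge0// divr_ge0 ?exprn_ge0 ?(ltW s0).
have h1 : 0 <= 1 - (1 + 2 * m ^+ 2) * v ^+ 2 by rewrite subr_ge0 ltW.
by apply: divr_ge0; apply: mulr_ge0 => //; exact: sqr_ge0.
Qed.

Lemma kap_ge0 m v : 0 <= m -> 0 <= v -> (1 + 2 * m ^+ 2) * v ^+ 2 < 1 ->
  0 <= kap m v.
Proof.
move=> m0 v0 h; have s0 := sroot_gt0 _ _ h.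
have z1 := sroot_ratio _ _ m0 v0 h; have /andP[z0 _] := z1.
have h1 : 0 <= 1 - v ^+ 2.
  by have := mulr_ge0 (sqr_ge0 m) (sqr_ge0 v); lra.
by rewrite /kap; apply: divr_ge0 => //; apply: mulr_ge0 => //; exact: artanh_ge0.
Qed.

Lemma ct_dkap m v : 0 <= m -> 0 < v -> (1 + 2 * m ^+ 2) * v ^+ 2 < 1 ->
  cont_at (dkap ^~ v) m /\ cont_at (dkap m) v.
Proof.
move=> m0 v0 h; have s0 := sroot_gt0 _ _ h.
have z1 := sroot_ratio _ _ m0 (ltW v0) h.
have s3 : sroot m v ^+ 3 != 0 by rewrite expf_neq0 ?gt_eqF.
have s4 : sroot m v ^+ 2 * (1 - (1 + 2 * m ^+ 2) * v ^+ 2) != 0.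
  by rewrite mulf_neq0 ?expf_neq0 ?gt_eqF ?subr_gt0.
have s5 : sroot m v != 0 by rewrite gt_eqF.
split; rewrite /dkap /sroot; cont; rewrite -?/(sroot _ _)//; lra.
Qed.

Lemma ct_kap m v : 0 <= m -> 0 <= v -> (1 + 2 * m ^+ 2) * v ^+ 2 < 1 ->
  cont_at (kap ^~ v) m /\ cont_at (kap m) v.
Proof.
move=> m0 v0 h; have s0 := sroot_gt0 _ _ h.
have z1 := sroot_ratio _ _ m0 v0 h.
have s5 : sroot m v != 0 by rewrite gt_eqF.
have s6 : 1 - v ^+ 2 != 0.
  by rewrite gt_eqF// subr_gt0; have := mulr_ge0 (sqr_ge0 m) (sqr_ge0 v); lra.
split; rewrite /kap /sroot; cont; rewrite -?/(sroot _ _)//; lra.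
Qed.

Lemma ct_kapint m w : 0 <= m -> 0 <= w -> (1 + 2 * m ^+ 2) * w ^+ 2 < 1 ->
  cont_at (kapint m) w.
Proof.
move=> m0 v0 h; have s0 := sroot_gt0 _ _ h.
have z1 := sroot_ratio _ _ m0 v0 h.
have u1 := uroot_ratio _ _ v0 h.
have s5 : sroot m w != 0 by rewrite gt_eqF.
have s6 : 1 + m ^+ 2 != 0 by rewrite gt_eqF// ltr_wpDr ?sqr_ge0.
have s7 : uroot m != 0 by rewrite gt_eqF ?uroot_gt0.
rewrite /kapint /sroot; cont; rewrite -?/(sroot _ _)//; lra.
Qed.

Lemma kap0l v : kap 0 v = 0.
Proof. by rewrite /kap !mul0r. Qed.

Lemma kapint0r m : kapint m 0 = 0.
Proof. by rewrite /kapint !mulr0 !mul0r artanh0 mul0r mulr0 subrr mul0r. Qed.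

Let mu := @lebesgue_measure R.

(* Not a type class, unlike [is_derive], on which [apply] runs a costly
   instance search. *)
Definition derives (F : R -> R) (x a : R) := is_derive x 1 F a.

Lemma ge0_FTC_val (b : R -> bool) f F x y c : x <= y ->
  b =1 (fun t => (x < t) && (t < y)) ->
  (forall t, x < t < y -> derives F t (f t)) ->
  (forall t, x < t < y -> cont_at f t) ->
  (forall t, x < t < y -> 0 <= f t) ->
  cont_at F x -> cont_at F y -> F y - F x = c ->
  (\int[mu]_t ind b f t = c%:E)%E.
Proof. by move=> xy bE dF cf f0 Fx Fy <-; exact: ge0_FTC_ind. Qed.

Lemma integral_dkap_m M v : 0 <= M -> 0 < v -> (1 + 2 * M ^+ 2) * v ^+ 2 < 1 ->
  (\int[mu]_m ind (fun m => (0 < m < M)%R) (dkap ^~ v) m = (kap M v)%:E)%E.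
Proof.
move=> M0 v0 h.
have hm m : 0 <= m -> m <= M -> (1 + 2 * m ^+ 2) * v ^+ 2 < 1.
  move=> m0 mM; apply: le_lt_trans h.
  have : m ^+ 2 <= M ^+ 2 by rewrite ler_pXn2r// nnegrE.
  by have := sqr_ge0 v; nra.
apply: (ge0_FTC_val _ _ (kap ^~ v) 0 M) => [//|//|t|t|t|||]; last by rewrite kap0l subr0.
- move=> /andP[t0 tM]; apply: is_derive_kap => //; [exact: ltW|].
  by apply: hm; exact: ltW.
- move=> /andP[t0 tM]; apply: (ct_dkap _ _ _ _ _).1 => //; [exact: ltW|].
  by apply: hm; exact: ltW.
- move=> /andP[t0 tM]; apply: dkap_ge0; [exact: ltW..|].
  by apply: hm; exact: ltW.
- by apply: (ct_kap _ _ _ _ _).1 => //; [exact: ltW|exact: hm].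
- by apply: (ct_kap _ _ _ _ _).1 => //; exact: ltW.
Qed.

Lemma integral_dkap_v m w : 0 <= m -> 0 <= w -> (1 + 2 * m ^+ 2) * w ^+ 2 < 1 ->
  (\int[mu]_v ind (fun v => (0 < v < w)%R) (dkap m) v = (kapint m w)%:E)%E.
Proof.
move=> m0 w0 h.
have hm v : 0 <= v -> v <= w -> (1 + 2 * m ^+ 2) * v ^+ 2 < 1.
  move=> v0 vw; apply: le_lt_trans h.
  have : v ^+ 2 <= w ^+ 2 by rewrite ler_pXn2r// nnegrE.
  by have := sqr_ge0 m; nra.
apply: (ge0_FTC_val _ _ (kapint m) 0 w) => [//|//|t|t|t|||]; last by rewrite kapint0r subr0.
- move=> /andP[t0 tM]; apply: is_derive_kapint => //.
  by apply: hm; exact: ltW.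
- move=> /andP[t0 tM]; apply: (ct_dkap _ _ _ _ _).2 => //.
  by apply: hm; exact: ltW.
- move=> /andP[t0 tM]; apply: dkap_ge0; [by []|exact: ltW|].
  by apply: hm; exact: ltW.
- by apply: ct_kapint => //; exact: hm.
- by apply: ct_kapint.
Qed.

(** The closed form is a difference; its sign is read off from the integral of [dkap]. *)
Lemma kapint_ge0 m w : 0 <= m -> 0 <= w -> (1 + 2 * m ^+ 2) * w ^+ 2 < 1 ->
  0 <= kapint m w.
Proof.
move=> m0 w0 h; rewrite -lee_fin -integral_dkap_v//.
apply: integral_ge0 => v _; rewrite /ind; case: ifP => // /andP[v0 vw].
rewrite lee_fin dkap_ge0// ?ltW//; apply: le_lt_trans h.
have : v ^+ 2 <= w ^+ 2 by rewrite ler_pXn2r// ?nnegrE ltW.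
by have := sqr_ge0 m; nra.
Qed.

Lemma measurable_dkap : measurable_fun setT (fun p : R * R => dkap p.1 p.2).
Proof. rewrite /dkap /sroot /artanh; meas. Qed.

(* Both sides are the double integral of [dkap]. *)
Lemma integral_kap M w : 0 < M -> 0 < w -> (1 + 2 * M ^+ 2) * w ^+ 2 <= 1 ->
  (\int[mu]_v ind (fun v => (0 < v < w)%R) (kap M) v =
   \int[mu]_m ind (fun m => (0 < m < M)%R) (kapint ^~ w) m)%E.
Proof.
move=> M0 w0 h.
pose B (p : measurableTypeR R * measurableTypeR R) : bool :=
  (0 < p.1 < M) && (0 < p.2 < w).
pose F := ind B (fun p => dkap p.1 p.2).
have hm m v : 0 < m < M -> 0 < v < w ->
    (1 + 2 * m ^+ 2) * v ^+ 2 < 1.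
  move=> /andP[m0 mM] /andP[v0 vw]; apply: lt_le_trans h.
  have : v ^+ 2 < w ^+ 2 by rewrite ltr_pXn2r// ?nnegrE ltW.
  have : m ^+ 2 < M ^+ 2 by rewrite ltr_pXn2r// ?nnegrE ltW.
  by have := exprn_gt0 2 v0; have := exprn_gt0 2 m0; nra.
have aF : admissible B (fun p => dkap p.1 p.2).
  split; [by rewrite /B; meas|exact: measurable_dkap|].
  move=> [m v]/= /andP[/[dup] m01 /andP[? ?] /[dup] v01 /andP[? ?]].
  by apply: dkap_ge0; [exact: ltW..|exact: hm].
have F0 p : (0 <= F p)%E by exact: ind_ge0.
transitivity (\int[mu]_v \int[mu]_m F (m, v))%E.
  apply: eq_integral => v _; rewrite /ind/=; case: ifPn => vw; last first.
    by rewrite integral0_eq// => m _; rewrite /F /ind /B/= (negbTE vw) andbF.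
  have [v0 v1] := andP vw.
  rewrite -integral_dkap_m//; last 2 first.
  - exact: ltW.
  - apply: lt_le_trans h; rewrite ltr_pM2l; first by rewrite ltr_pXn2r// ?nnegrE ltW.
    by rewrite ltr_wpDr// mulr_ge0// sqr_ge0.
  by apply: eq_integral => m _; rewrite /F /ind /B/= vw andbT.
rewrite -(fubini_tonelli (m1 := mu) (m2 := mu) F)//; last exact: measurable_ind.
apply: eq_integral => m _; rewrite /ind/=; case: ifPn => mM; last first.
  by rewrite integral0_eq// => v _; rewrite /F /ind /B/= (negbTE mM).
have [m0 m1] := andP mM.
rewrite -integral_dkap_v//; last 3 first.
- exact: ltW.
- exact: ltW.
- apply: lt_le_trans h; rewrite ltr_pM2r ?exprn_gt0//.
  by rewrite ltrD2l ltr_pM2l// ltr_pXn2r// ?nnegrE ltW.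
by apply: eq_integral => v _; rewrite /F /ind /B/= mM.
Qed.

End KapDerivatives.

(** * Logarithms of sines and cosines of sums of arctangents *)

Section LnSinAtan.
Context {R : realType}.
Implicit Types (x y : R).

Lemma atan_bounds x : - (pi / 2) < atan x < pi / 2.
Proof. by rewrite atan_gtNpi2 atan_ltpi2. Qed.

Lemma ltr_atan : {mono (@atan R) : x y / x < y}.
Proof. by apply: leW_mono; apply: le_mono; exact: lt_atan. Qed.

Lemma atan_gt0 x : 0 < x -> 0 < atan x < pi / 2.
Proof. by move=> x0; rewrite -[X in X < _]atan0 ltr_atan x0 atan_ltpi2. Qed.

Lemma atan_lt_pi4 x : x < 1 -> atan x < pi / 4.
Proof. by move=> x1; rewrite -atan1 ltr_atan. Qed.

Lemma atanV x : 0 < x -> atan x^-1 = pi / 2 - atan x.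
Proof.
move=> x0; have := atan_gt0 _ x0 => /andP[a0 a1].
rewrite -[RHS]tanK; last by rewrite in_itv/=; lra.
rewrite /tan sin_pihalfB [in RHS]cosB cos_pihalf sin_pihalf mul0r mul1r add0r.
congr atan; rewrite -[x in LHS]atanK /tan invf_div//.
Qed.

Lemma cos_atan_gt0 x : 0 < cos (atan x).
Proof. by apply: cos_gt0_pihalf; exact: atan_bounds. Qed.

Lemma sin_atan_cos x : sin (atan x) = x * cos (atan x).
Proof. by rewrite -{2}[x]atanK /tan divfK// gt_eqF// cos_atan_gt0. Qed.

Lemma ln_cos_atan x : ln (cos (atan x)) = - (ln (1 + x ^+ 2) / 2).
Proof.
have x0 : 0 < 1 + x ^+ 2 by rewrite ltr_pwDl// sqr_ge0.
rewrite cos_atan lnV ?posrE ?sqrtr_gt0//; congr (- _).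
rewrite -[in RHS](sqr_sqrtr (ltW x0)) lnXn ?sqrtr_gt0//.
by rewrite mulr2n; field.
Qed.

(** Such formulas turn the derivatives of [lob] at sums of arctangents into logarithms of algebraic
    functions, which can be compared with the artanh terms of [kap] and [kapint]. *)
Lemma ln_cos_atanB x y : 0 < 1 + x * y ->
  ln (2 * cos (atan x - atan y)) =
  ln 2 + ln (1 + x * y) - ln (1 + x ^+ 2) / 2 - ln (1 + y ^+ 2) / 2.
Proof.
move=> xy; rewrite cosB !sin_atan_cos.
have cx := cos_atan_gt0 x; have cy := cos_atan_gt0 y.
have -> : 2 * (cos (atan x) * cos (atan y) +
    x * cos (atan x) * (y * cos (atan y))) =
  2 * (1 + x * y) * cos (atan x) * cos (atan y) by ring.
by rewrite !lnM ?posrE ?mulr_gt0// !ln_cos_atan; lra.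
Qed.

Lemma ln_sin_atanD x y : 0 < x + y ->
  ln (2 * sin (atan x + atan y)) =
  ln 2 + ln (x + y) - ln (1 + x ^+ 2) / 2 - ln (1 + y ^+ 2) / 2.
Proof.
move=> xy; rewrite sinD !sin_atan_cos.
have cx := cos_atan_gt0 x; have cy := cos_atan_gt0 y.
have -> : 2 * (x * cos (atan x) * cos (atan y) +
    cos (atan x) * (y * cos (atan y))) =
  2 * (x + y) * cos (atan x) * cos (atan y) by ring.
by rewrite !lnM ?posrE ?mulr_gt0// !ln_cos_atan; lra.
Qed.

Lemma ln_cos_atan2 x : ln (2 * cos (atan x)) = ln 2 - ln (1 + x ^+ 2) / 2.
Proof. by rewrite lnM ?posrE ?cos_atan_gt0// ln_cos_atan. Qed.

Lemma ln_cos_atanD x y : 0 < 1 - x * y ->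
  ln (2 * cos (atan x + atan y)) =
  ln 2 + ln (1 - x * y) - ln (1 + x ^+ 2) / 2 - ln (1 + y ^+ 2) / 2.
Proof.
by move=> xy; have := ln_cos_atanB x (- y); rewrite atanN sqrrN opprK mulrN; apply.
Qed.

Lemma ln_sin_atanB x y : 0 < x - y ->
  ln (2 * sin (atan x - atan y)) =
  ln 2 + ln (x - y) - ln (1 + x ^+ 2) / 2 - ln (1 + y ^+ 2) / 2.
Proof. by move=> xy; rewrite -atanN ln_sin_atanD// sqrrN. Qed.

End LnSinAtan.

(** * The integral of [kap] on the critical curve *)

Section KapIntegrals.
Context {R : realType}.
Implicit Types (m v w M : R).
Let mu := @lebesgue_measure R.

(** With [psi = atan (sroot M v / M)], the logarithms that multiply [d psi] combine to
    [- artanh (M v / sroot M v)], and [d psi = - M v dv / (sroot M v (1 - v^2))]: this produces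
    [kap M v]. The terms without [psi] are chosen to cancel the logarithms that multiply
    [d (atan v)]. *)
Definition kap_prim M w v : R :=
  (lob (atan (sroot M v / M) - atan v) - lob (atan (sroot M v / M) + atan v)
   - 2 * lob (pi / 2 - atan v) + lob (atan w + atan v) - lob (atan w - atan v)
   + lob (pi / 2 - 2 * atan v) / 2) / 2.

Lemma is_derive_kap_prim M w v : 0 < M -> 0 < w < 1 -> (1 + 2 * M ^+ 2) * w ^+ 2 = 1 ->
  0 < v < w -> is_derive v 1 (kap_prim M w) (kap M v).
Proof.
move=> M0 /andP[w0 w1] Mw /andP[v0 vw].
have v2 : v ^+ 2 < w ^+ 2 by rewrite ltr_pXn2r// ?nnegrE ltW.
have h : (1 + 2 * M ^+ 2) * v ^+ 2 < 1.
  by rewrite -[ltRHS]Mw ltr_pM2l// ltr_pwDl// mulr_ge0// sqr_ge0.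
have s0 := sroot_gt0 _ _ h.
have s2 := sroot_sqr _ _ (ltW h); have z1 := sroot_ratio _ _ (ltW M0) (ltW v0) h.
have pi0 := @pi_gt0 R.
have e1 : 0 < atan v < atan w by rewrite -[X in X < _]atan0 !ltr_atan v0.
have w4 := atan_lt_pi4 _ w1.
have p0 : 0 < sroot M v / M by rewrite divr_gt0.
have pv : v < sroot M v / M.
  by move: z1 => /andP[_]; rewrite ltr_pdivrMr// mul1r mulrC ltr_pdivlMr.
have q1 := atan_gt0 _ p0.
have q2 : atan v < atan (sroot M v / M) by rewrite ltr_atan.
have h' : 0 < (1 - (1 + M ^+ 2) * v ^+ 2) by rewrite -s2 exprn_gt0.
rewrite /kap_prim /sroot; derive; rewrite -/(sroot M v).
all: try (by rewrite gt_eqF); try lra.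
set s := sroot M v in s0 s2 z1 p0 pv q1 q2 *.
have z2 : 0 < 1 - M * v / s by rewrite subr_gt0; case/andP: z1.
have z3 : 0 < 1 + M * v / s by rewrite ltr_wpDr//; case/andP: z1.
have v3 : 0 < 1 - v * v by rewrite -expr2; nra.
have p2 : 0 < 1 + (s / M) ^+ 2 by rewrite ltr_wpDr// sqr_ge0.
have w2 : 0 < 1 + w ^+ 2 by rewrite ltr_wpDr// sqr_ge0.
(* This says that the coefficient of [d (atan v)] vanishes, that is, [2 (1 + (s/M)^2) (w^2 - v^2) =
   ((s/M)^2 - v^2) (1 + w^2) (1 - v^2)]; the criticality hypothesis [Mw] enters here. *)
have key : ln 2 + ln (1 + (s / M) ^+ 2) + ln (w + v) + ln (w - v) =
    ln (s / M) + ln (s / M) + ln (1 + M * v / s) + ln (1 - M * v / s)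
    + ln (1 + w ^+ 2) + ln (1 - v * v).
  have [ww1 ww2] : 0 < w + v /\ 0 < w - v by lra.
  rewrite -!lnM ?posrE ?mulr_gt0 ?invr_gt0//; congr ln.
  have Mw' : M ^+ 2 * w ^+ 2 = (1 - w ^+ 2) / 2 by lra.
  transitivity (2 * (1 + M ^+ 2) * (w ^+ 2 - v ^+ 2) * (1 - v * v) / M ^+ 2).
    by field: s2; rewrite !gt_eqF.
  have -> : 2 * (1 + M ^+ 2) * (w ^+ 2 - v ^+ 2) =
    (1 - (1 + 2 * M ^+ 2) * v ^+ 2) * (1 + w ^+ 2) 
    by have := congr1 (fun x => x * v ^+ 2) Mw'; lra.
  by field: s2; rewrite !gt_eqF.
have e2 : 2 * atan v = atan v + atan v by lra.
rewrite sin_pihalfB sin_pihalfB ln_cos_atan2 e2.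
rewrite ln_cos_atanD// !ln_sin_atanD ?ln_sin_atanB ?subr_gt0 ?addr_gt0//.
have -> : s / M + v = s / M * (1 + M * v / s) by field; rewrite !gt_eqF.
have -> : s / M - v = s / M * (1 - M * v / s) by field; rewrite !gt_eqF.
rewrite ![ln (s / M * _)]lnM ?posrE// /kap -/s /artanh.
have {}key : ln (w - v) = ln (s / M) + ln (s / M) + ln (1 + M * v / s)
  + ln (1 - M * v / s) + ln (1 + w ^+ 2) + ln (1 - v * v)
  - (ln 2 + ln (1 + (s / M) ^+ 2) + ln (w + v)) by lra.
rewrite key.
set L1 := ln (1 + M * v / s). set L2 := ln (1 - M * v / s).
set L3 := ln (1 + (_ / _) ^+ 2). set L4 := ln (s / M). set L5 := ln (w + v).
set L6 := ln (1 + v ^+ 2). set L7 := ln (1 + w ^+ 2). set L8 := ln (1 - v * v).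
have -> : (1 + (s / M) ^+ 2) = (1 + M ^+ 2) * (1 - v * v) / M ^+ 2.
  by field: s2; rewrite gt_eqF.
have v4 : 0 < 1 + v ^+ 2 by rewrite ltr_wpDr// sqr_ge0.
have M2 : 0 < 1 + M ^+ 2 by rewrite ltr_wpDr// sqr_ge0.
have v5 : 0 < 1 - v ^+ 2 by rewrite expr2.
by field; rewrite !gt_eqF.
Qed.

(* On the curve [(1 + 2 M^2) w^2 = 1] the square root [sroot M w] equals [M w], and
   the artanh terms combine into logarithms of sines. *)
Lemma integral_kap_critical M w : 0 < M -> 0 < w < 1 ->
  (1 + 2 * M ^+ 2) * w ^+ 2 = 1 ->
  (\int[mu]_v ind (fun v => (0 < v < w)%R) (kap M) v =
   (lob (pi / 2 - 2 * atan w) / 4 - lob (pi / 2 - atan w))%:E)%E.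
Proof.
move=> M0 /[dup] w01 /andP[w0 w1] Mw.
have pi0 := @pi_gt0 R.
have w4 := atan_lt_pi4 _ w1; have /andP[w5 _] := atan_gt0 _ w0.
have hv v : 0 < v < w -> (1 + 2 * M ^+ 2) * v ^+ 2 < 1.
  move=> /andP[v0 vw]; have v2 : v ^+ 2 < w ^+ 2 by rewrite ltr_pXn2r// ?nnegrE ltW.
  by rewrite -[ltRHS]Mw ltr_pM2l// ltr_pwDl// mulr_ge0// sqr_ge0.
have sw : sroot M w = M * w.
  rewrite /sroot; have -> : 1 - (1 + M ^+ 2) * w ^+ 2 = (M * w) ^+ 2.
    by rewrite exprMn; lra.
  by rewrite sqrtr_sqr ger0_norm// mulr_ge0// ltW.
have cG v : 0 <= v <= w -> cont_at (kap_prim M w) v.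
{ move=> /andP[v0 vw]; rewrite /kap_prim /sroot; cont; rewrite -/(sroot M v).
  all: try (by rewrite gt_eqF).
  all: have /andP[? ?] := atan_bounds (sroot M v / M).
  all: have : atan v <= atan w by exact: le_atan.
  all: have : atan 0 <= atan v by exact: le_atan.
  all: rewrite atan0 => ? ?; lra. }
apply: (ge0_FTC_val _ _ (kap_prim M w) 0 w) => [|//|t t0|t t0|t t0|||].
- exact: ltW.
- exact: is_derive_kap_prim.
- apply: (ct_kap _ _ _ _ _).2; [exact: ltW|by case/andP: t0 => /ltW|exact: hv].
- by apply: kap_ge0; [exact: ltW|case/andP: t0 => /ltW|exact: hv].
- by apply: cG; rewrite lexx ltW.
- by apply: cG; rewrite lexx ltW.
rewrite /kap_prim sw [M * w]mulrC mulfK ?gt_eqF// atan0 !subr0 !addr0 !subrr mulr0 subr0.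
rewrite lob_pihalf lob0 (_ : 2 * atan w = atan w + atan w); last by lra.
by field.
Qed.

End KapIntegrals.

(** * The integral of [kapint] in [w] *)

Section InnerIntegral.
Context {R : realType}.
Implicit Types (m w : R).
Let mu := @lebesgue_measure R.

Definition kroot m : R := Num.sqrt (2 + m ^+ 2).

Lemma kroot_sqr m : kroot m ^+ 2 = 2 + m ^+ 2.
Proof. by rewrite sqr_sqrtr// addr_ge0// sqr_ge0. Qed.

Lemma kroot_gt0 m : 0 < kroot m.
Proof. by rewrite sqrtr_gt0 ltr_pwDl// sqr_ge0. Qed.

(** Put [y = atan (w kroot m / sroot m w)]; then [dy = kroot m dw / (sroot m w (1 + w^2))]. With
    [x = atan (m / kroot m)] the two tangents have product [m w / sroot m w], so the first artanh of
    [kapint] is half of [ln (cos (y - x) / cos (y + x))]. With [e = atan (1 / uroot m)] and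
    [phi = atan w], the second is half of [ln (sin (e + phi) / sin (e - phi))]. *)
Definition kapint_prim m w : R :=
  ((lob (pi / 2 - (atan (w * kroot m / sroot m w) + atan (m / kroot m)))
    - lob (pi / 2 - (atan (w * kroot m / sroot m w) - atan (m / kroot m))))
    / (2 * kroot m)
   - m / (2 * uroot m) *
     (lob (atan (uroot m)^-1 + atan w) + lob (atan (uroot m)^-1 - atan w)))
  / (1 + m ^+ 2).

Lemma atan_ratio_bounds m : 0 < m -> 0 < atan (m / kroot m) < pi / 4 /\
  0 < atan (uroot m)^-1 < pi / 4.
Proof.
move=> m0; have k0 := kroot_gt0 m; have u0 := uroot_gt0 m.
have k2 := kroot_sqr m; have u2 := uroot_sqr m; have m2 := exprn_gt0 2 m0.
have /andP[h1 _] := atan_gt0 (m / kroot m) (divr_gt0 m0 k0).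
have uV : 0 < (uroot m)^-1 by rewrite invr_gt0.
have /andP[h2 _] := atan_gt0 _ uV.
rewrite h1 h2; split; apply: atan_lt_pi4.
  rewrite ltr_pdivrMr// mul1r -(ltr_pXn2r (n := 2))// ?nnegrE ?ltW// k2; lra.
rewrite invf_lt1// -(ltr_pXn2r (n := 2))// ?nnegrE ?ltW// u2; lra.
Qed.

Lemma is_derive_kapint_prim m w : 0 < m -> 0 < w -> (1 + 2 * m ^+ 2) * w ^+ 2 < 1 ->
  is_derive w 1 (kapint_prim m) (kapint m w / (1 + w ^+ 2)).
Proof.
move=> m0 w0 h.
have s0 := sroot_gt0 _ _ h.
have s2 := sroot_sqr _ _ (ltW h); have z1 := sroot_ratio _ _ (ltW m0) (ltW w0) h.
have pi0 := @pi_gt0 R.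
have k0 := kroot_gt0 m; have u0 := uroot_gt0 m.
have k2 := kroot_sqr m; have u2 := uroot_sqr m.
have [ax ae] := atan_ratio_bounds _ m0.
have h' : 0 < (1 - (1 + m ^+ 2) * w ^+ 2) by rewrite -s2 exprn_gt0.
have /andP[u3 u4] := uroot_ratio _ _ (ltW w0) h.
have /andP[w3 w4] := atan_gt0 _ w0.
have aw : atan w < atan (uroot m)^-1.
  by rewrite ltr_atan -[(uroot m)^-1]mul1r ltr_pdivlMr// mulrC.
have x0 : 0 < w * kroot m / sroot m w by rewrite divr_gt0// mulr_gt0.
have /andP[x3 x4] := atan_gt0 _ x0.
have xk : atan (w * kroot m / sroot m w) < pi / 2 - atan (m / kroot m).
  rewrite -atanV ?divr_gt0// ltr_atan invf_div ltr_pdivrMr//.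
  rewrite mulrAC -mulrA [w * _]mulrC ltr_pM2l// ltr_pdivlMr//.
  by case/andP: z1 => _; rewrite ltr_pdivrMr// mul1r mulrC.
rewrite /kapint_prim /sroot; derive; rewrite -/(sroot m w).
all: try (by rewrite gt_eqF); try lra.
set s := sroot m w in s0 s2 z1 x0 x3 x4 xk *.
set k := kroot m in k0 k2 ax x0 x3 x4 xk *.
set u := uroot m in u0 u2 u3 u4 ae aw *.
have z2 : 0 < 1 - m * w / s by rewrite subr_gt0; case/andP: z1.
have z3 : 0 < 1 + m * w / s by rewrite ltr_wpDr//; case/andP: z1.
have zu : 0 < 1 - u * w by rewrite subr_gt0.
have zu' : 0 < 1 + u * w by rewrite ltr_wpDr.
have uV : 0 < u^-1 by rewrite invr_gt0.
have xy : w * k / s * (m / k) = m * w / s by field; rewrite !gt_eqF.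
have e1 : u^-1 + w = u^-1 * (1 + u * w) by field; rewrite !gt_eqF.
have e2 : u^-1 - w = u^-1 * (1 - u * w) by field; rewrite !gt_eqF.
rewrite !sin_pihalfB ln_cos_atanD ?xy// ln_cos_atanB ?xy// ln_sin_atanD ?e1 ?mulr_gt0//.
rewrite ln_sin_atanB ?e2 ?mulr_gt0// ![ln (u^-1 * _)]lnM ?posrE//.
rewrite /kapint /artanh -/s -/u.
set L1 := ln (1 + m * w / s). set L2 := ln (1 - m * w / s).
set L3 := ln (1 + u * w). set L4 := ln (1 - u * w).
set L5 := ln (1 + (_ / s) ^+ 2).
have w2 : 0 < 1 + w ^+ 2 by rewrite ltr_wpDr// sqr_ge0.
have m2 : 0 < 1 + m ^+ 2 by rewrite ltr_wpDr// sqr_ge0.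
have -> : 1 + (w * k / s) ^+ 2 = (1 + w ^+ 2) / s ^+ 2.
  by field: s2 k2; rewrite gt_eqF.
by field: s2; rewrite !gt_eqF.
Qed.

Lemma ct_kapint_prim m w : 0 < m -> 0 <= w -> (1 + 2 * m ^+ 2) * w ^+ 2 <= 1 ->
  cont_at (kapint_prim m) w.
Proof.
move=> m0 w0 h.
have s0 : 0 < sroot m w.
  rewrite sqrtr_gt0; have : 0 < m ^+ 2 by rewrite exprn_gt0.
  by have := sqr_ge0 w; nra.
have pi0 := @pi_gt0 R.
have k0 := kroot_gt0 m; have u0 := uroot_gt0 m; have u2 := uroot_sqr m.
have [ax ae] := atan_ratio_bounds _ m0.
have m2 : 0 < 1 + m ^+ 2 by rewrite ltr_wpDr// sqr_ge0.
have w3 : 0 <= atan w by rewrite -atan0 le_atan.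
have aw : atan w <= atan (uroot m)^-1.
  apply: le_atan; rewrite -[(uroot m)^-1]mul1r ler_pdivlMr//.
  by rewrite -(ler_pXn2r (n := 2))// ?nnegrE ?mulr_ge0 ?(ltW u0)// expr1n exprMn u2 mulrC.
have x3 : 0 <= atan (w * kroot m / sroot m w).
  by rewrite -atan0 le_atan// divr_ge0 ?mulr_ge0// ltW.
have /andP[_ x4] := atan_bounds (w * kroot m / sroot m w).
have [d1 d2] : 2 * kroot m != 0 /\ 2 * uroot m != 0 by rewrite !gt_eqF// mulr_gt0.
rewrite /kapint_prim /sroot; cont; rewrite -?/(sroot m w) ?gt_eqF//; lra.
Qed.

Definition kapint_total m : R :=
  ((lob (pi / 2 + atan (m / kroot m)) - lob (pi / 2 - atan (m / kroot m))
    - lob (2 * atan (m / kroot m))) / (2 * kroot m)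
   - m / (2 * uroot m) * (lob (2 * atan (uroot m)^-1) - 2 * lob (atan (uroot m)^-1)))
  / (1 + m ^+ 2).

Lemma integral_kapint_w m : 0 < m ->
  (\int[mu]_w ind (fun w => (0 < w) && ((1 + 2 * m ^+ 2) * w ^+ 2 < 1))%R
     (fun w => kapint m w / (1 + w ^+ 2))%R w = (kapint_total m)%:E)%E.
Proof.
move=> m0; have m2 := exprn_gt0 2 m0.
have k0 := kroot_gt0 m; have u0 := uroot_gt0 m; have u2 := uroot_sqr m.
have uV : 0 < (uroot m)^-1 by rewrite invr_gt0.
have hw w : 0 < w -> ((1 + 2 * m ^+ 2) * w ^+ 2 < 1) = (w < (uroot m)^-1).
  move=> w0; rewrite -u2 -exprMn -[in LHS](expr1n _ 2) ltr_pXn2r ?nnegrE ?mulr_ge0 ?ltW//.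
  by rewrite -[(uroot m)^-1]mul1r ltr_pdivlMr// mulrC.
have hw1 : (1 + 2 * m ^+ 2) * (uroot m)^-1 ^+ 2 = 1.
  by rewrite -u2 exprVn divff// expf_neq0// gt_eqF.
have hw2 t : 0 < t < (uroot m)^-1 -> (1 + 2 * m ^+ 2) * t ^+ 2 < 1.
  by move=> /andP[t0 tu]; rewrite hw.
apply: (ge0_FTC_val _ _ (kapint_prim m) 0 (uroot m)^-1) => [|w|t t0|t t0|t t0|||].
- exact: ltW.
- by case: (ltrP 0 w) => //= w0; rewrite hw.
- by apply: is_derive_kapint_prim; [|case/andP: t0|exact: hw2].
- have c1 : cont_at (kapint m) t.
    by apply: ct_kapint; [exact: ltW|case/andP: t0 => /ltW|exact: hw2].
  have t2 : 1 + t ^+ 2 != 0 by rewrite gt_eqF// ltr_wpDr// sqr_ge0.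
  by apply: ctM => //; cont.
- apply: divr_ge0; last by rewrite addr_ge0// sqr_ge0.
  by apply: kapint_ge0; [exact: ltW|case/andP: t0 => /ltW|exact: hw2].
- by apply: ct_kapint_prim => //; rewrite expr0n mulr0.
- by apply: ct_kapint_prim; [|exact: ltW|rewrite hw1].
have s1 : sroot m (uroot m)^-1 = m / uroot m.
  rewrite /sroot; have -> : 1 - (1 + m ^+ 2) * (uroot m)^-1 ^+ 2 = (m / uroot m) ^+ 2.
    by rewrite exprMn; lra.
  by rewrite sqrtr_sqr ger0_norm// divr_ge0// ltW.
rewrite /kapint_prim /kapint_total s1.
(* At the endpoint [w = 1 / uroot m] the two arctangents of the first part become complementary
   angles. *)
have -> : (uroot m)^-1 * kroot m / (m / uroot m) = (m / kroot m)^-1.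
  by field; rewrite !gt_eqF.
rewrite (atanV (m / kroot m)) ?divr_gt0// !mul0r atan0.
set X := atan (m / kroot m); set e := atan _^-1.
have -> : pi / 2 - (pi / 2 - X + X) = 0 by lra.
have -> : pi / 2 - (pi / 2 - X - X) = 2 * X by lra.
have -> : pi / 2 - (0 + X) = pi / 2 - X by lra.
have -> : pi / 2 - (0 - X) = pi / 2 + X by lra.
have -> : e + e = 2 * e by lra.
rewrite addr0 subr0 subrr lob0.
by field; rewrite !gt_eqF// ltr_wpDr// sqr_ge0.
Qed.

End InnerIntegral.

(** * The integral in [m], and the integral along the critical curve *)

Section OuterIntegral.
Context {R : realType}.
Implicit Types (m w : R).
Let mu := @lebesgue_measure R.

(** The arctangents of [m / kroot m] and [1 / uroot m] have derivatives [1 / (kroot m (1 + m^2))]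
    and [- m / (uroot m (1 + m^2))], which are, up to constants, the coefficients in [kapint_total];
    the chain rule does the rest. *)
Definition kapint_total_prim m : R :=
  (slob (pi / 2 + atan (m / kroot m)) + slob (pi / 2 - atan (m / kroot m))
    - slob (2 * atan (m / kroot m)) / 2) / 2
  + slob (2 * atan (uroot m)^-1) / 4 - slob (atan (uroot m)^-1).

Lemma is_derive_kapint_total_prim m : 0 < m ->
  is_derive m 1 kapint_total_prim (kapint_total m).
Proof.
move=> m0; have pi0 := @pi_gt0 R.
have k0 := kroot_gt0 m; have u0 := uroot_gt0 m.
have k2 := kroot_sqr m; have u2 := uroot_sqr m.
have [ax ae] := atan_ratio_bounds _ m0.
have m2 : 0 < 1 + m ^+ 2 by rewrite ltr_wpDr// sqr_ge0.
have k2' : 0 < 2 + m ^+ 2 by rewrite ltr_wpDr// sqr_ge0.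
have u2' : 0 < 1 + 2 * m ^+ 2 by have := sqr_ge0 m; lra.
rewrite /kapint_total_prim /kroot /uroot; derive; rewrite -/(kroot m) -/(uroot m).
all: try (by rewrite gt_eqF); try lra.
rewrite /kapint_total; set u := uroot m in u0 u2 ae *; set k := kroot m in k0 k2 ax *.
have -> : 1 + (m / k) ^+ 2 = 2 * (1 + m ^+ 2) / k ^+ 2.
  by field: k2; rewrite gt_eqF.
have -> : 1 + u^-1 ^+ 2 = 2 * (1 + m ^+ 2) / u ^+ 2.
  by field: u2; rewrite gt_eqF.
by field: k2 u2; rewrite !gt_eqF.
Qed.

Lemma ct_kapint_total m : 0 < m -> cont_at kapint_total m.
Proof.
move=> m0; have pi0 := @pi_gt0 R.
have k0 := kroot_gt0 m; have u0 := uroot_gt0 m.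
have [ax ae] := atan_ratio_bounds _ m0.
have [d1 d2] : 2 * kroot m != 0 /\ 2 * uroot m != 0 by rewrite !gt_eqF// mulr_gt0.
have m2 : 0 < 1 + m ^+ 2 by rewrite ltr_wpDr// sqr_ge0.
rewrite /kapint_total /kroot /uroot; cont; rewrite -?/(kroot m) -?/(uroot m) ?gt_eqF//; lra.
Qed.

Lemma ct_kapint_total_prim m : 0 <= m -> cont_at kapint_total_prim m.
Proof.
move=> m0; have pi0 := @pi_gt0 R.
have k0 := kroot_gt0 m; have u0 := uroot_gt0 m.
have [ax ae] : 0 <= atan (m / kroot m) < pi / 4 /\ 0 <= atan (uroot m)^-1 <= pi / 4.
  move: m0; rewrite le_eqVlt => /predU1P[<-|m0].
    by rewrite mul0r atan0 /uroot expr0n mulr0 addr0 sqrtr1 invr1 atan1; lra.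
  by have := atan_ratio_bounds _ m0; lra.
rewrite /kapint_total_prim /kroot /uroot; cont; rewrite -?/(kroot m) -?/(uroot m) ?gt_eqF//; lra.
Qed.

Lemma kapint_total_ge0 m : 0 < m -> 0 <= kapint_total m.
Proof.
move=> m0; rewrite -lee_fin -integral_kapint_w//; apply: integral_ge0 => w _.
rewrite /ind; case: ifP => // /andP[w0 w1]; rewrite lee_fin.
apply: divr_ge0; last by rewrite addr_ge0// sqr_ge0.
by apply: kapint_ge0 => //; exact: ltW.
Qed.

Lemma integral_kapint_total :
  (\int[mu]_m ind (fun m => (0 < m < 1))%R kapint_total m =
   (slob (pi / 3) - slob (pi / 6) - 5 / 4 * slob (pi / 2) + slob (pi / 4))%:E)%E.
Proof.
have pi0 := @pi_gt0 R.
apply: (ge0_FTC_val _ _ kapint_total_prim 0 1) => [//|//|t t0|t t0|t t0|||].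
- by apply: is_derive_kapint_total_prim; case/andP: t0.
- by apply: ct_kapint_total; case/andP: t0.
- by apply: kapint_total_ge0; case/andP: t0.
- exact: ct_kapint_total_prim.
- exact: ct_kapint_total_prim.
(* Both arctangents are [pi / 6] at [m = 1]; at [m = 0] they are [0] and [pi / 4]. *)
have k1 : kroot 1 = Num.sqrt 3 :> R by rewrite /kroot expr1n; congr Num.sqrt; lra.
have u1 : uroot 1 = Num.sqrt 3 :> R by rewrite /uroot expr1n; congr Num.sqrt; lra.
have u0 : uroot 0 = 1 :> R by rewrite /uroot expr0n mulr0 addr0 sqrtr1.
rewrite /kapint_total_prim k1 u1 u0 invr1 atan1 mul0r mul1r atan0 atan_sqrt3V.
have -> : pi / 2 + pi / 6 = 2 / 3 * pi :> R by lra.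
have -> : pi / 2 - pi / 6 = pi / 3 :> R by lra.
have -> : 2 * (pi / 6) = pi / 3 :> R by lra.
have -> : 2 * (pi / 4) = pi / 2 :> R by lra.
by rewrite slob_reflect mulr0 addr0 subr0 slob0; lra.
Qed.

Lemma atan_sqrt3V_bounds w : (Num.sqrt 3)^-1 <= w -> w <= 1 ->
  pi / 6 <= atan w <= pi / 4.
Proof. by move=> w0 w1; rewrite -atan_sqrt3V -atan1 !le_atan. Qed.

Lemma sqrt3V_gt0 : 0 < (Num.sqrt 3)^-1 :> R.
Proof. by rewrite invr_gt0 sqrtr_gt0. Qed.

Lemma sqrt3V_sqr : (Num.sqrt 3)^-1 ^+ 2 = 3^-1 :> R.
Proof. by rewrite exprVn sqr_sqrtr. Qed.

Lemma sqrt3V_lt1 : (Num.sqrt 3)^-1 < 1 :> R.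
Proof.
by rewrite -(ltr_pXn2r (n := 2))// ?nnegrE ?ltW ?sqrt3V_gt0// sqrt3V_sqr expr1n; lra.
Qed.

(** By [integral_kap_critical] it is the integral of a nonnegative [kap M], for the [M] that makes
    [w] critical. *)
Lemma critical_ge0 w : 0 < w < 1 ->
  0 <= lob (pi / 2 - 2 * atan w) / 4 - lob (pi / 2 - atan w).
Proof.
move=> /[dup] w01 /andP[w0 w1].
pose M := Num.sqrt ((w ^- 2 - 1) / 2).
have w2 : 0 < w ^- 2 - 1.
  by rewrite subr_gt0 invf_gt1 ?exprn_gt0// expr_lt1// ltW.
have M0 : 0 < M by rewrite sqrtr_gt0 divr_gt0.
have M2 : (1 + 2 * M ^+ 2) * w ^+ 2 = 1.
  by rewrite sqr_sqrtr ?divr_ge0 ?ltW//; field; rewrite gt_eqF.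
rewrite -lee_fin -(integral_kap_critical M)//; apply: integral_ge0 => v _.
rewrite /ind; case: ifP => // /andP[v0 vw]; rewrite lee_fin.
apply: kap_ge0; [exact: ltW..|].
rewrite -[ltRHS]M2 ltr_pM2l ?ltr_pXn2r ?nnegrE ?ltW//.
by rewrite ltr_pwDl// mulr_ge0// sqr_ge0.
Qed.

Lemma integral_critical :
  (\int[mu]_w ind (fun w => ((Num.sqrt 3)^-1 < w < 1))%R
    (fun w => (lob (pi / 2 - 2 * atan w) / 4 - lob (pi / 2 - atan w)) / (1 + w ^+ 2))%R w =
   (slob (pi / 4) - slob (pi / 3) + slob (pi / 6) / 8)%:E)%E.
Proof.
have pi0 := @pi_gt0 R; have s0 := sqrt3V_gt0; have s1 := sqrt3V_lt1.
pose F w := slob (pi / 2 - atan w) - slob (pi / 2 - 2 * atan w) / 8 : R.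
have w2 w : 0 < 1 + w ^+ 2 by rewrite ltr_wpDr// sqr_ge0.
have cF w : (Num.sqrt 3)^-1 <= w -> w <= 1 -> cont_at F w.
  by move=> h1 h2; have ha := atan_sqrt3V_bounds _ h1 h2; rewrite /F; cont; lra.
apply: (ge0_FTC_val _ _ F (Num.sqrt 3)^-1 1) => [|//|t /andP[t0 t1]|t /andP[t0 t1]|t /andP[t0 t1]|||].
- exact: ltW.
- have ha := atan_sqrt3V_bounds _ (ltW t0) (ltW t1).
  rewrite /derives /F; derive; [lra|lra|].
  by field; rewrite gt_eqF.
- have ha := atan_sqrt3V_bounds _ (ltW t0) (ltW t1).
  by cont; rewrite ?gt_eqF//; lra.
- apply: divr_ge0; last by rewrite ltW.
  by apply: critical_ge0; lra.
- by apply: cF => //; exact: ltW.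
- by apply: cF => //; exact: ltW.
rewrite /F atan1 atan_sqrt3V.
have -> : pi / 2 - pi / 4 = pi / 4 :> R by lra.
have -> : pi / 2 - 2 * (pi / 4) = 0 :> R by lra.
have -> : pi / 2 - pi / 6 = pi / 3 :> R by lra.
have -> : pi / 2 - 2 * (pi / 6) = pi / 6 :> R by lra.
by rewrite slob0; lra.
Qed.

End OuterIntegral.

(** * The double integral [J] of [kap 1] *)

Section DoubleIntegral.
Context {R : realType}.
Implicit Types (m w : R).
Let mu := @lebesgue_measure R.
Let MR := measurableTypeR R.
Let V1 : R := slob (pi / 3) - slob (pi / 6) - 5 / 4 * slob (pi / 2) + slob (pi / 4).
Let V2 : R := slob (pi / 4) - slob (pi / 3) + slob (pi / 6) / 8.
Let c : R := (Num.sqrt 3)^-1.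

(** Here [p = (w, m)]. Integrating in [w] first gives [V1]; cutting at [w = c], where the curve
    [(1 + 2 m^2) w^2 = 1] meets [m = 1], gives [J] below and [V2] above. *)
Let bT (p : MR * MR) : bool :=
  [&& 0 < p.2 < 1, 0 < p.1 & (1 + 2 * p.2 ^+ 2) * p.1 ^+ 2 < 1].
Let gT (p : MR * MR) : R := kapint p.2 p.1 / (1 + p.1 ^+ 2).

Let oneDsqr_gt0 (x : R) : 0 < 1 + x ^+ 2.
Proof. by rewrite ltr_wpDr// sqr_ge0. Qed.

Let admT : admissible bT gT.
Proof.
split.
- rewrite /bT; meas.
- rewrite /gT /kapint /artanh /sroot /uroot; meas.
- move=> p /and3P[/andP[m0 _] w0 h]; apply: divr_ge0; last exact: ltW.
  by apply: kapint_ge0 => //; exact: ltW.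
Qed.

Let total : bint (xleb mu) bT gT = V1%:E.
Proof.
rewrite -(bint_chvar _ _ (chvar_swap2 R))//.
transitivity (bint mu (fun m => 0 < m < 1) kapint_total); last first.
  exact: integral_kapint_total.
apply: bint_fubini.
- have [mb mg g0] := admT.
  have mf := let: And4 h _ _ _ := chvar_swap2 R in h.
  split; first exact: measurableT_comp mb mf.
    by apply: measurable_funM => //; exact: measurableT_comp mg mf.
  by move=> p /g0; rewrite mul1r.
move=> m; rewrite /ind/= /bT/=; case: ifPn => [/[dup] m01 /andP[m0 _]|nm].
  rewrite -integral_kapint_w//; apply: eq_integral => w _.
  by rewrite /ind/= mul1r.
by rewrite integral0_eq.
Qed.

Lemma bint_kap_ratio (M w : R) : 0 < M -> 0 < w -> (1 + 2 * M ^+ 2) * w ^+ 2 <= 1 ->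
  bint mu (fun m => 0 < m < M) (fun m => kapint m w / (1 + w ^+ 2)) =
  bint mu (fun v => 0 < v < w) (fun v => kap M v / (1 + w ^+ 2)).
Proof.
move=> M0 w0 h.
have hm m v : 0 < m <= M -> 0 < v <= w -> (m < M) || (v < w) ->
    (1 + 2 * m ^+ 2) * v ^+ 2 < 1.
  move=> /andP[m0 mM] /andP[v0 vw] H; apply: lt_le_trans h.
  have v2 : v ^+ 2 <= w ^+ 2 by rewrite ler_pXn2r// nnegrE ltW.
  have m2 : m ^+ 2 <= M ^+ 2 by rewrite ler_pXn2r// nnegrE ltW.
  have v3 := exprn_gt0 2 v0; have m3 := exprn_gt0 2 m0.
  case/orP: H => H.
    have : m ^+ 2 < M ^+ 2 by rewrite ltr_pXn2r// ?nnegrE ltW.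
    by nra.
  have : v ^+ 2 < w ^+ 2 by rewrite ltr_pXn2r// ?nnegrE ltW.
  by nra.
have w2 := oneDsqr_gt0 w.
transitivity (bint mu (fun m => 0 < m < M) (fun m => (1 + w ^+ 2)^-1 * kapint m w)).
  by apply: bint_eq => // m _; rewrite mulrC.
rewrite bintZ; [|by rewrite invr_ge0 ltW|]; last first.
  split; [by meas|by rewrite /kapint /artanh /sroot /uroot; meas|move=> m /andP[m0 mM]].
  by apply: kapint_ge0; [exact: ltW|exact: ltW|apply: hm; rewrite ?m0 ?w0 ?lexx ?mM ?ltW].
rewrite /bint -integral_kap// -/(bint mu _ _) -bintZ; [|by rewrite invr_ge0 ltW|].
  by apply: bint_eq => // m _; rewrite mulrC.
split; [by meas|by rewrite /kap /artanh /sroot; meas|move=> v /andP[v0 vw]].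
by apply: kap_ge0; [exact: ltW|exact: ltW|apply: hm; rewrite ?v0 ?M0 ?lexx ?vw ?ltW// orbT].
Qed.

Let bJ (p : MR * MR) : bool := (0 < p.2 < p.1) && (p.1 < c).
Let gJ (p : MR * MR) : R := kap 1 p.2 / (1 + p.1 ^+ 2).

Let c0 : 0 < c. Proof. exact: sqrt3V_gt0. Qed.
Let c2 : c ^+ 2 = 3^-1. Proof. exact: sqrt3V_sqr. Qed.
Let lt_c2 w : 0 < w -> w < c -> w ^+ 2 < 3^-1.
Proof. by move=> w0 wc; rewrite -c2 ltr_pXn2r// ?nnegrE ltW. Qed.

Let admJ : admissible bJ gJ.
Proof.
split; [by rewrite /bJ; meas|by rewrite /gJ /kap /artanh /sroot; meas|].
move=> p /andP[/andP[v0 vw] wc]; apply: divr_ge0; last exact: ltW.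
apply: kap_ge0 => //; first exact: ltW.
have := lt_c2 _ (lt_trans v0 vw) wc.
have : p.2 ^+ 2 < p.1 ^+ 2 by rewrite ltr_pXn2r// ?nnegrE ltW// (lt_trans v0).
by rewrite expr1n; lra.
Qed.

Lemma bint_kap_admissible : admissible
  (fun p : MR * MR => (0 < p.2 < p.1) && (p.1 < (Num.sqrt 3)^-1))
  (fun p => kap 1 p.2 / (1 + p.1 ^+ 2)).
Proof. exact: admJ. Qed.

(** For [w < c] the variable [m] runs through the whole interval [0 < m < 1], and the deformation
    ends at [kap 1]. *)
Let below : bint (xleb mu) (fun p => bT p && (p.1 - c < 0)) gT =
  bint (xleb mu) bJ gJ.
Proof.
have ab : admissible (fun p : MR * MR => bT p && (p.1 - c < 0)) gT.
  by apply: admissible_and; [exact: admT|meas].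
rewrite /bint /xleb fubini_tonelli1; [|exact: measurable_ind|by move=> x; exact: ind_ge0].
rewrite [RHS]fubini_tonelli1; [|exact: measurable_ind|by move=> x; exact: ind_ge0].
apply: eq_integral => w _; rewrite /fubini_F.
have [/andP[w0 wc]|nw] := boolP (0 < w < c); last first.
  rewrite !integral0_eq// => v _; rewrite /ind /bT /bJ/=; case: ifP => // /andP[].
    by move=> /andP[v0 vw] wc; move: nw; rewrite (lt_trans v0 vw) wc.
  by move=> /and3P[_ w0 _]; rewrite subr_lt0 => wc; move: nw; rewrite w0 wc.
have w3 := lt_c2 _ w0 wc.
have -> : (\int[mu]_y ind bJ gJ (w, y) =
    bint mu (fun v => 0 < v < w)%R (fun v => kap 1 v / (1 + w ^+ 2))%R)%E.
  by apply: eq_integral => v _; rewrite /ind /bJ/= wc andbT.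
rewrite -bint_kap_ratio//; last by rewrite expr1n; lra.
apply: eq_integral => m _; rewrite /ind /bT /gT/= w0 subr_lt0 wc andbT/=.
case: (boolP (0 < m < 1)) => //= /andP[m0 m1].
have m2 : m ^+ 2 < 1 by rewrite expr_lt1// ltW.
by rewrite ifT//; have := exprn_gt0 2 w0; nra.
Qed.

(** For [w > c] the variable [m] stops at the critical value [M < 1] attached to [w], where the
    integral of [kap M] is known. *)
Let above : bint (xleb mu) (fun p => bT p && (0 < p.1 - c)) gT = V2%:E.
Proof.
have ab : admissible (fun p : MR * MR => bT p && (0 < p.1 - c)) gT.
  by apply: admissible_and; [exact: admT|meas].
transitivity (bint mu (fun w => c < w < 1)
    (fun w => (lob (pi / 2 - 2 * atan w) / 4 - lob (pi / 2 - atan w)) / (1 + w ^+ 2)));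
  last exact: integral_critical.
apply: bint_fubini => //.
move=> w; rewrite [RHS]/ind; case: ifPn => [/andP[cw w1]|nw]; last first.
  rewrite integral0_eq// => m _; rewrite /ind /bT/=; case: ifP => // /andP[].
  move=> /and3P[/andP[m0 _] w0 h]; rewrite subr_gt0 => cw.
  move: nw; rewrite cw/= -leNgt => w1.
  have : 1 <= w ^+ 2 by rewrite exprn_ege1.
  by have := exprn_gt0 2 m0 => ? ?; exfalso; nra.
have w0 := lt_trans c0 cw.
have w2 : w ^+ 2 < 1 by rewrite expr_lt1// ltW.
have w3 : 3^-1 < w ^+ 2 by rewrite -c2 ltr_pXn2r// ?nnegrE ltW.
have w4 : 0 < w ^+ 2 by rewrite exprn_gt0.
pose M := Num.sqrt ((w ^- 2 - 1) / 2).
have M1 : 0 < (w ^- 2 - 1) / 2 by rewrite divr_gt0// subr_gt0 invf_gt1.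
have M0 : 0 < M by rewrite sqrtr_gt0.
have M2 : (1 + 2 * M ^+ 2) * w ^+ 2 = 1.
  by rewrite sqr_sqrtr ?ltW//; field; rewrite gt_eqF.
have M3 : M < 1.
  by rewrite -(ltr_pXn2r (n := 2))// ?nnegrE ?(ltW M0)// expr1n; nra.
transitivity (bint mu (fun m => 0 < m < M) (fun m => kapint m w / (1 + w ^+ 2))).
  apply: eq_integral => m _; rewrite /ind /bT /gT/= w0 subr_gt0 cw andbT/=.
  congr (if _ then _ else _).
  case: (ltrP 0 m) => //= m0.
  have -> : ((1 + 2 * m ^+ 2) * w ^+ 2 < 1) = (m < M).
    rewrite -[X in _ < X]M2 ltr_pM2r// ltrD2l ltr_pM2l// ltr_pXn2r// nnegrE ltW//.
  by case: (ltrP m M) => mM; rewrite ?andbF// (lt_trans mM).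
rewrite bint_kap_ratio// ?M2//.
transitivity (bint mu (fun v => 0 < v < w) (fun v => (1 + w ^+ 2)^-1 * kap M v)).
  by apply: bint_eq => // v _; rewrite mulrC.
rewrite bintZ; [|by rewrite invr_ge0 ltW|].
  by rewrite [bint _ _ _]integral_kap_critical ?w0// -EFinM mulrC.
split; [by meas|by rewrite /kap /artanh /sroot; meas|move=> v /andP[v0 vw]].
apply: kap_ge0; [exact: ltW|exact: ltW|].
rewrite -[ltRHS]M2 ltr_pM2l ?ltr_pXn2r ?nnegrE ?ltW//.
by rewrite ltr_pwDl// mulr_ge0// sqr_ge0.
Qed.

(** The value is [V1 - V2]: the terms at [pi / 4] cancel, and the two distribution relations
    eliminate those at [pi / 3] and [pi / 6]. *)
Lemma bint_kap1 :
  bint (xleb mu) (fun p => (0 < p.2 < p.1) && (p.1 < (Num.sqrt 3)^-1))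
    (fun p => kap 1 p.2 / (1 + p.1 ^+ 2)) = (- (slob (pi / 2) / 36))%:E.
Proof.
have := bint_split bT gT (l := fun p : MR * MR => p.1 - c) (m := xleb mu).
rewrite total above below => H.
have {}H : (V1%:E = V2%:E + bint (xleb mu) bJ gJ)%E.
  apply: H; [meas| |exact: admT].
  apply: (null_lift mu (fun x => x - c)); first meas.
  rewrite (_ : [set x | _] = [set c]); first exact: lebesgue_measure_set1.
  by apply/seteqP; split => x /= h; lra.
have -> : (bint (xleb mu) bJ gJ = (V1 - V2)%:E)%E.
  by rewrite EFinB H addrAC subee ?add0e.
congr (_%:E); rewrite /V1 /V2.
have := @slob_double R; have := @slob_triple R; lra.
Qed.

End DoubleIntegral.

(** * The ordered part of the cube *)

Section OrderedCube.
Context {R : realType}.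
Let mu := @lebesgue_measure R.
Let MR := measurableTypeR R.
Let c : R := (Num.sqrt 3)^-1.

Let ordered (p : MR * MR * MR * MR) : bool :=
  [&& 0 < p.2, p.2 < p.1.2, p.1.2 < p.1.1.2, p.1.1.2 < p.1.1.1 & p.1.1.1 < 2^-1].
Definition weight (p : MR * MR * MR * MR) : R :=
  ((1 - (p.1.1.1 ^+ 2 + p.1.1.2 ^+ 2 + p.1.2 ^+ 2 + p.2 ^+ 2)) ^+ 2)^-1.

Lemma measurable_weight : measurable_fun setT weight.
Proof. rewrite /weight; meas. Qed.

Lemma weight_ge0 p : 0 <= weight p.
Proof. by rewrite invr_ge0 sqr_ge0. Qed.

Let b1 (p : MR * MR * MR * MR) : bool :=
  [&& 0 < p.2 < 1, 0 < p.1.2, p.1.2 < p.1.1.2, p.1.1.2 < p.1.1.1 & p.1.1.1 < 2^-1].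
Let g1 (p : MR * MR * MR * MR) : R :=
  p.1.2 * ((1 - (p.1.1.1 ^+ 2 + p.1.1.2 ^+ 2 + p.1.2 ^+ 2 * (1 + p.2 ^+ 2))) ^+ 2)^-1.

(** The substitution [x4 = q x3] has Jacobian [x3], and the integrand becomes [x3] times a function
    of [x3^2], elementary to integrate in [x3]. *)
Let step1 : bint (xleb (xleb (xleb mu))) ordered weight =
  bint (xleb (xleb (xleb mu))) b1 g1.
Proof.
(* The value [1] off the region keeps the scale nonzero everywhere, as [chvar_affine_last]
   demands. *)
pose a (p : MR * MR * MR) : R := if 0 < p.2 then p.2 else 1.
have ma : measurable_fun setT a by rewrite /a; meas.
have a0 p : a p != 0 by rewrite /a; case: ifPn => // /gt_eqF->.
have cv := chvar_affine_last _ _ (xleb (xleb mu)) a (fun=> 0) ma (measurable_cst _) a0.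
rewrite -(bint_chvar _ _ cv); last first.
  by split; [rewrite /ordered; meas|exact: measurable_weight|move=> ? _; exact: weight_ge0].
apply: bint_eq => [p|p].
  rewrite /ordered /b1 /a /affine/= addr0; case: ifPn => p0; last first.
    rewrite andbF mul1r; case: (ltrP 0 p.2) => //= p1; case: ltrP => //= p2.
    by move: p0; rewrite (lt_trans p1).
  by rewrite pmulr_rgt0// gtr_pMr//= andbA.
rewrite /ordered /a /affine/= => /and5P[]; case: ifPn => p0; last first.
  by rewrite mul1r addr0 => p1 p2; move: p0; rewrite (lt_trans p1).
move=> _ _ _ _ _; rewrite gtr0_norm// /g1 /weight/= addr0.
by congr (_ * (_ ^+ 2)^-1); ring.
Qed.

Let b2 (p : MR * MR * MR) : bool :=
  [&& 0 < p.2 < 1, 0 < p.1.2, p.1.2 < p.1.1 & p.1.1 < 2^-1].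
Let g2 (p : MR * MR * MR) : R :=
  p.1.2 ^+ 2 / (2 * (1 - (p.1.1 ^+ 2 + p.1.2 ^+ 2)) *
    (1 - (p.1.1 ^+ 2 + p.1.2 ^+ 2 * (2 + p.2 ^+ 2)))).

Let sqr_lt (x y : R) : 0 < x -> x < y -> x ^+ 2 < y ^+ 2.
Proof. by move=> x0 xy; rewrite ltr_pXn2r// ?nnegrE ltW// (lt_trans x0). Qed.

Let sqr_lt_quarter (x : R) : 0 < x -> x < 2^-1 -> 0 < x ^+ 2 < 4^-1.
Proof.
move=> x0 x1; rewrite exprn_gt0//=; have := sqr_lt _ _ x0 x1.
by rewrite (_ : 2^-1 ^+ 2 = 4^-1) //; field.
Qed.

Let step2 : bint (xleb (xleb (xleb mu))) b1 g1 = bint (xleb (xleb mu)) b2 g2.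
Proof.
have adm1 : admissible b1 g1.
  split; [by rewrite /b1; meas|by rewrite /g1; meas|move=> p /and5P[_ p0 _ _ _]].
  by rewrite mulr_ge0 ?invr_ge0 ?sqr_ge0// ltW.
have cv := chvar_swap _ _ (xleb mu).
rewrite -(bint_chvar _ _ cv)//; apply: bint_fubini.
  have [mb mg g0] := adm1; have [mf _ _ _] := cv.
  split; first exact: measurableT_comp mb mf.
    by apply: measurable_funM => //; exact: measurableT_comp mg mf.
  by move=> p /g0; rewrite mul1r.
move=> [[x y] q]; rewrite [RHS]/ind; case: ifPn => [|nb]; last first.
  rewrite integral0_eq// => z _; rewrite /ind ifF//.
  apply: contraNF nb; rewrite /b1 /b2/= => /and5P[-> z0 zy -> ->].
  by rewrite (lt_trans z0).
rewrite /b2/= => /and4P[/andP[q0 q1] y0 yx xh].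
have x0 := lt_trans y0 yx.
have /andP[_ x2] := sqr_lt_quarter _ x0 xh.
have y2 := sqr_lt _ _ y0 yx.
have q2 : 0 < q ^+ 2 < 1 by rewrite exprn_gt0// expr_lt1// ltW.
have pos z : 0 <= z <= y -> 0 < 1 - (x ^+ 2 + y ^+ 2) - z ^+ 2 * (1 + q ^+ 2).
  move=> /andP[z0 zy]; have z2 : z ^+ 2 <= y ^+ 2 by rewrite ler_pXn2r// ?nnegrE// ltW.
  by have := sqr_ge0 z; nra.
pose F z : R := (2 * (1 + q ^+ 2) * (1 - (x ^+ 2 + y ^+ 2) - z ^+ 2 * (1 + q ^+ 2)))^-1.
have q3 : 0 < 1 + q ^+ 2 by lra.
have den z : 0 <= z <= y ->
    2 * (1 + q ^+ 2) * (1 - (x ^+ 2 + y ^+ 2) - z ^+ 2 * (1 + q ^+ 2)) != 0.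
  by move=> /pos zy; rewrite gt_eqF// !mulr_gt0.
have gE z : g1 (x, y, z, q) =
    z * ((1 - (x ^+ 2 + y ^+ 2) - z ^+ 2 * (1 + q ^+ 2)) ^+ 2)^-1.
  by rewrite /g1/=; congr (_ * (_ ^+ 2)^-1); ring.
have cF z : 0 <= z <= y -> cont_at F z by move=> /den ?; rewrite /F; cont.
apply: (ge0_FTC_val _ _ F 0 y) => [|z|z /andP[z0 zy]|z /andP[z0 zy]|z /andP[z0 zy]|||].
- exact: ltW.
- by rewrite /b1/= q0 q1 yx xh/= !andbT.
- have zy' : 0 <= z <= y by rewrite !ltW.
  have pz := pos _ zy'.
  rewrite /derives mul1r gE /F; derive; first exact: den.
  by rewrite /=; field; rewrite !gt_eqF.
- have zy' : 0 <= z <= y by rewrite !ltW.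
  rewrite /g1/=; cont; rewrite expf_neq0//.
  rewrite (_ : 1 - (x ^+ 2 + y ^+ 2 + z ^+ 2 * (1 + q ^+ 2)) =
    1 - (x ^+ 2 + y ^+ 2) - z ^+ 2 * (1 + q ^+ 2)); last by ring.
  by rewrite gt_eqF// pos.
- by rewrite /= mul1r mulr_ge0 ?invr_ge0 ?sqr_ge0// ltW.
- by apply: cF; rewrite lexx ltW.
- by apply: cF; rewrite lexx ltW.
have p0 : 0 < 1 - (x ^+ 2 + y ^+ 2) by lra.
have := pos y; rewrite lexx ltW// => /(_ isT) py.
rewrite /F /g2/= (_ : 1 - (x ^+ 2 + y ^+ 2 * (2 + q ^+ 2)) =
  1 - (x ^+ 2 + y ^+ 2) - y ^+ 2 * (1 + q ^+ 2)); last by ring.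
by field; rewrite ?expr0n ?mul0r ?subr0 !gt_eqF.
Qed.

Let b3 (p : MR * MR) : bool := [&& 0 < p.2, p.2 < p.1 & p.1 < 2^-1].
Let g3 (p : MR * MR) : R :=
  p.2 / (2 * (1 - (p.1 ^+ 2 + p.2 ^+ 2)) * Num.sqrt (1 - (p.1 ^+ 2 + 2 * p.2 ^+ 2))) *
  artanh (p.2 / Num.sqrt (1 - (p.1 ^+ 2 + 2 * p.2 ^+ 2))).

Let step3 : bint (xleb (xleb mu)) b2 g2 = bint (xleb mu) b3 g3.
Proof.
have pos (p : MR * MR * MR) : b2 p -> 0 < 1 - (p.1.1 ^+ 2 + p.1.2 ^+ 2) /\
    0 < 1 - (p.1.1 ^+ 2 + p.1.2 ^+ 2 * (2 + p.2 ^+ 2)).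
  move=> /and4P[/andP[q0 q1] y0 yx xh]; have x0 := lt_trans y0 yx.
  have /andP[_ x2] := sqr_lt_quarter _ x0 xh; have y2 := sqr_lt _ _ y0 yx.
  have q2 : 0 < p.2 ^+ 2 < 1 by rewrite exprn_gt0// expr_lt1// ltW.
  by have := sqr_ge0 p.1.2; split; nra.
apply: bint_fubini.
  split; [by rewrite /b2; meas|by rewrite /g2; meas|move=> p /pos[p0 p1]].
  by rewrite divr_ge0 ?sqr_ge0// !mulr_ge0 ?ltW.
move=> [x y]; rewrite [RHS]/ind; case: ifPn => [|nb]; last first.
  rewrite integral0_eq// => z _; rewrite /ind ifF//.
  by apply: contraNF nb; rewrite /b2 /b3/= => /and4P[_ -> -> ->].
rewrite /b3/= => /and3P[y0 yx xh].
have x0 := lt_trans y0 yx.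
have /andP[_ x2] := sqr_lt_quarter _ x0 xh.
have y2 := sqr_lt _ _ y0 yx; have y3 := exprn_gt0 2 y0.
have p0 : 0 < 1 - (x ^+ 2 + y ^+ 2) by lra.
have p1 : 0 < 1 - (x ^+ 2 + 2 * y ^+ 2) by lra.
set s := Num.sqrt (1 - (x ^+ 2 + 2 * y ^+ 2)).
have s0 : 0 < s by rewrite sqrtr_gt0.
have s2 : s ^+ 2 = 1 - (x ^+ 2 + 2 * y ^+ 2) by rewrite sqr_sqrtr// ltW.
have ys : 0 < y / s < 1.
  rewrite divr_gt0// ltr_pdivrMr// mul1r -(ltr_pXn2r (n := 2))// ?nnegrE ?ltW// s2; lra.
have yq q : 0 <= q <= 1 -> -1 < y * q / s < 1.
  move=> /andP[q0 q1]; rewrite mulrAC.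
  have : 0 <= y / s * q by rewrite mulr_ge0// ltW//; case/andP: ys.
  have : y / s * q <= y / s by rewrite ler_piMr// ltW//; case/andP: ys.
  by move: ys => /andP[? ?] ? ?; lra.
pose F q : R := y / (2 * (1 - (x ^+ 2 + y ^+ 2)) * s) * artanh (y * q / s).
have cF z : 0 <= z <= 1 -> cont_at F z.
  by move=> h; rewrite /F; cont; rewrite ?gt_eqF ?mulr_gt0//; exact: yq.
apply: (ge0_FTC_val _ _ F 0 1) => [//|q|q /andP[q0 q1]|q /andP[q0 q1]|q /andP[q0 q1]|||].
- by rewrite /b2/= y0 yx xh !andbT.
- have q' : 0 <= q <= 1 by rewrite !ltW.
  rewrite /derives /F; derive; first exact: yq.
  have q2 : 0 < q ^+ 2 < 1 by rewrite exprn_gt0// expr_lt1// ltW.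
  have p2 : 0 < 1 - (x ^+ 2 + y ^+ 2 * (2 + q ^+ 2)) by nra.
  have p3 : 0 < s ^+ 2 - (y * q) ^+ 2 by rewrite s2 exprMn; lra.
  by rewrite /g2/=; field: s2; rewrite !gt_eqF.
- have [p2 p3] : 0 < 1 - (x ^+ 2 + y ^+ 2) /\
    0 < 1 - (x ^+ 2 + y ^+ 2 * (2 + q ^+ 2)).
    by apply: (pos (x, y, q)); rewrite /b2/= q0 q1 y0 yx xh.
  by rewrite /g2/=; cont; rewrite gt_eqF// !mulr_gt0.
- have [p2 p3] : 0 < 1 - (x ^+ 2 + y ^+ 2) /\
    0 < 1 - (x ^+ 2 + y ^+ 2 * (2 + q ^+ 2)).
    by apply: (pos (x, y, q)); rewrite /b2/= q0 q1 y0 yx xh.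
  by rewrite /g2/= divr_ge0 ?sqr_ge0// !mulr_ge0 ?ltW.
- by apply: cF; rewrite lexx ler01.
- by apply: cF; rewrite lexx ler01.
by rewrite /F mulr1 mulr0 mul0r artanh0 mulr0 subr0.
Qed.

Let A (x : R) : R := Num.sqrt (1 - x ^+ 2).
Let b4 (p : MR * MR) : bool := [&& 0 < p.2, A p.1 * p.2 < p.1 & p.1 < 2^-1].
Let g4 (p : MR * MR) : R := kap 1 p.2 / 2 / A p.1.

Let A_gt0 (x : R) : 0 < x -> x < 2^-1 -> 0 < A x /\ A x ^+ 2 = 1 - x ^+ 2.
Proof.
move=> x0 xh; have /andP[_ x2] := sqr_lt_quarter _ x0 xh.
have h : 0 < 1 - x ^+ 2 by lra.
by rewrite sqrtr_gt0 h sqr_sqrtr// ltW.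
Qed.

Let b4_pos (p : MR * MR) : b4 p -> 0 < p.1 /\ (1 + 2 * 1 ^+ 2) * p.2 ^+ 2 < 1.
Proof.
move=> /and3P[v0 vx xh].
have x0 : 0 < p.1.
  by apply: le_lt_trans vx; rewrite mulr_ge0 ?sqrtr_ge0// ltW.
split => //; have [a0 a2] := A_gt0 _ x0 xh.
have /andP[_ x2] := sqr_lt_quarter _ x0 xh.
have := sqr_lt _ _ (mulr_gt0 a0 v0) vx; rewrite exprMn a2 expr1n => h.
by have := sqr_ge0 p.2; nra.
Qed.

Let adm4 : admissible b4 g4.
Proof.
split; [by rewrite /b4 /A; meas|by rewrite /g4 /A /kap /artanh /sroot; meas|].
move=> p bp; have [x0 v2] := b4_pos _ bp; have /and3P[v0 _ xh] := bp.
rewrite divr_ge0 ?sqrtr_ge0// divr_ge0//.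
by apply: kap_ge0 => //; exact: ltW.
Qed.

(** The substitution [x2 = A x1 * v] separates the variables: [1 - x1^2 - 2 x2^2] and
    [1 - x1^2 - x2^2] become [A x1 ^ 2] times [1 - 2 v^2] and [1 - v^2]. *)
Let step4 : bint (xleb mu) b3 g3 = bint (xleb mu) b4 g4.
Proof.
pose a (x : MR) : R := if 0 < A x then A x else 1.
have ma : measurable_fun setT a by rewrite /a /A; meas.
have a0 x : a x != 0 by rewrite /a; case: ifPn => // /gt_eqF->.
have cv := chvar_affine_last _ _ mu a (fun=> 0) ma (measurable_cst _) a0.
rewrite -(bint_chvar _ _ cv); last first.
  split; [by rewrite /b3; meas|by rewrite /g3 /artanh; meas|].
  move=> p /and3P[y0 yx xh]; have x0 := lt_trans y0 yx.
  have /andP[_ x2] := sqr_lt_quarter _ x0 xh; have y2 := sqr_lt _ _ y0 yx.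
  have p0 : 0 < 1 - (p.1 ^+ 2 + p.2 ^+ 2) by lra.
  have p1 : 0 < 1 - (p.1 ^+ 2 + 2 * p.2 ^+ 2) by lra.
  rewrite mulr_ge0 ?artanh_ge0 ?divr_ge0 ?mulr_ge0 ?sqrtr_ge0 ?(ltW y0) ?(ltW p0)//=.
  rewrite ltr_pdivrMr ?sqrtr_gt0// mul1r -(ltr_pXn2r (n := 2))// ?nnegrE ?sqrtr_ge0 ?(ltW y0)//.
  by rewrite sqr_sqrtr ?(ltW p1)//; lra.
have bE (p : MR * MR) : b3 (p.1, affine (a p.1) 0 p.2) = b4 p.
  rewrite /b3 /b4 /affine/= addr0.
  have [x0|x0] := ltrP 0 p.1; last first.
    transitivity false; [apply/negbTE|apply/esym/negbTE]; apply/negP => /and3P[h1 h2 _].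
      by have := lt_trans h1 h2; rewrite ltNge x0.
    have : 0 <= A p.1 * p.2 by rewrite mulr_ge0 ?sqrtr_ge0// ltW.
    by move=> /le_lt_trans/(_ h2); rewrite ltNge x0.
  have [xh|] := ltrP p.1 2^-1; last by rewrite !andbF.
  by have [h _] := A_gt0 _ x0 xh; rewrite /a h pmulr_rgt0.
apply: bint_eq => [p|p]; first exact: bE.
rewrite bE => bp; have [x0 v2] := b4_pos _ bp; have /and3P[v0 _ xh] := bp.
have [h h2] := A_gt0 _ x0 xh.
rewrite /g3 /g4 /affine/= addr0 /a h gtr0_norm// /kap mul1r.
have s0 := sroot_gt0 _ _ v2; have s2 := sroot_sqr _ _ (ltW v2).
have -> : Num.sqrt (1 - (p.1 ^+ 2 + 2 * (A p.1 * p.2) ^+ 2)) = A p.1 * sroot 1 p.2.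
  rewrite /A /sroot -sqrtrM; last by rewrite -h2 sqr_ge0.
  congr Num.sqrt; rewrite exprMn -/(A p.1) h2; ring.
have -> : A p.1 * p.2 / (A p.1 * sroot 1 p.2) = p.2 / sroot 1 p.2.
  by field; rewrite !gt_eqF.
have -> : 1 - (p.1 ^+ 2 + (A p.1 * p.2) ^+ 2) = A p.1 ^+ 2 * (1 - p.2 ^+ 2).
  by rewrite exprMn h2; ring.
have v3 : 0 < 1 - p.2 ^+ 2 by move: v2; rewrite expr1n; have := sqr_ge0 p.2; lra.
by field; rewrite !gt_eqF.
Qed.

Let c0 : 0 < c. Proof. exact: sqrt3V_gt0. Qed.
Let c2 : c ^+ 2 = 3^-1. Proof. exact: sqrt3V_sqr. Qed.
Let lt_c2 (v : R) : 0 < v -> (v < c) = (v ^+ 2 < 3^-1).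
Proof. by move=> v0; rewrite -c2 ltr_pXn2r// ?nnegrE ltW. Qed.

Let b5 (v : R) : bool := 0 < v < c.
Let g5 (v : R) : R := kap 1 v * (pi / 6 - atan v).

Let b5_pos v : b5 v -> (1 + 2 * 1 ^+ 2) * v ^+ 2 < 1.
Proof. by move=> /andP[v0]; rewrite lt_c2// expr1n; lra. Qed.

Let adm_swap (b : MR * MR -> bool) (g : MR * MR -> R) : admissible b g ->
  admissible (fun p => b (p.2, p.1)) (fun p => 1 * g (p.2, p.1)).
Proof.
move=> [mb mg g0]; have [mf _ _ _] := chvar_swap2 R.
split; [exact: measurableT_comp mb mf| |by move=> p /g0; rewrite mul1r].
by apply: measurable_funM => //; exact: measurableT_comp mg mf.
Qed.

(** What is integrated is [1 / sqrt (1 - x^2)], with the arcsine written as [atan (x / A x)]. It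
    equals [pi / 6] at [x = 1/2] and [atan v] at the lower limit [v / sqrt (1 + v^2)]. *)
Let step5 : bint (xleb mu) b4 g4 = bint mu b5 (fun v => 2^-1 * g5 v).
Proof.
rewrite -(bint_chvar _ _ (chvar_swap2 R))//; apply: bint_fubini; first exact: (adm_swap _ _ adm4).
move=> v; rewrite [RHS]/ind.
have tE x : 0 < x -> x < 2^-1 -> 0 < v ->
    (A x * v < x) = (v / Num.sqrt (1 + v ^+ 2) < x).
  move=> x0 xh v0; have [a0 a2] := A_gt0 _ x0 xh.
  have r0 : 0 < 1 + v ^+ 2 by rewrite ltr_wpDr// sqr_ge0.
  rewrite -(ltr_pXn2r (n := 2))// ?nnegrE ?ltW// ?mulr_gt0//.
  rewrite -[RHS](ltr_pXn2r (n := 2))// ?nnegrE ?ltW// ?divr_gt0 ?sqrtr_gt0//.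
  rewrite exprMn a2 [in RHS]exprMn exprVn sqr_sqrtr ?(ltW r0)// ltr_pdivrMr//.
  by apply/idP/idP; lra.
pose t : R := v / Num.sqrt (1 + v ^+ 2).
have r0 : 0 < 1 + v ^+ 2 by rewrite ltr_wpDr// sqr_ge0.
have r1 : 0 < Num.sqrt (1 + v ^+ 2) by rewrite sqrtr_gt0.
have r2 : Num.sqrt (1 + v ^+ 2) ^+ 2 = 1 + v ^+ 2 by rewrite sqr_sqrtr// ltW.
case: ifPn => [|nb]; last first.
  rewrite integral0_eq// => x _; rewrite /ind ifF//; apply: contraNF nb => bx.
  have [/= x0 v2] := b4_pos _ bx; have /and3P[/= v0 _ _] := bx.
  by rewrite /b5 v0 lt_c2//=; move: v2; rewrite expr1n; lra.
move=> /[dup] bv /andP[v0 vc]; have v2 := b5_pos _ bv.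
have t0 : 0 < t by rewrite divr_gt0.
have t2 : t ^+ 2 = v ^+ 2 / (1 + v ^+ 2) by rewrite exprMn exprVn r2.
have th : t < 2^-1.
  rewrite -(ltr_pXn2r (n := 2))// ?nnegrE ?invr_ge0 ?ltW// t2 ltr_pdivrMr//.
  by move: v2; rewrite expr1n; lra.
pose F x : R := kap 1 v / 2 * atan (x / A x).
have k0 : 0 <= kap 1 v by apply: kap_ge0 => //; exact: ltW.
have hA x : t <= x <= 2^-1 -> 0 < A x /\ A x ^+ 2 = 1 - x ^+ 2.
  move=> /andP[tx xh]; have x0 := lt_le_trans t0 tx.
  have : x ^+ 2 <= 2^-1 ^+ 2 by rewrite ler_pXn2r// ?nnegrE ?invr_ge0// ltW.
  rewrite (_ : 2^-1 ^+ 2 = 4^-1); last by field.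
  move=> x2; have h : 0 < 1 - x ^+ 2 by lra.
  by rewrite sqrtr_gt0 h sqr_sqrtr// ltW.
have cF x : t <= x <= 2^-1 -> cont_at F x.
  by move=> /hA[a0 _]; rewrite /F /A; cont; rewrite -/(A x) gt_eqF.
apply: (ge0_FTC_val _ _ F t 2^-1) => [|x|x /andP[tx xh]|x /andP[tx xh]|x /andP[tx xh]|||].
- exact: ltW.
- rewrite /b4/= v0/=; have [xh|] := ltrP x 2^-1; last by rewrite !andbF.
  rewrite !andbT; have [x0|x0] := ltrP 0 x; first exact: tE.
  transitivity false; [apply/negbTE|apply/esym/negbTE]; rewrite -leNgt.
    by rewrite (le_trans x0)// mulr_ge0 ?sqrtr_ge0// ltW.
  by rewrite (le_trans x0)// ltW.
- have [a0 a2] := A_gt0 _ (lt_trans t0 tx) xh.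
  have h' : 0 < 1 - x ^+ 2 by rewrite -a2 exprn_gt0.
  rewrite /derives /F /A; derive; rewrite -/(A x) ?gt_eqF//.
  have -> : 1 + (x / A x) ^+ 2 = (A x ^+ 2)^-1 by field: a2; rewrite gt_eqF.
  by rewrite /g4/=; field: a2; rewrite gt_eqF.
- have [a0 a2] := A_gt0 _ (lt_trans t0 tx) xh.
  by rewrite /g4 /A/=; cont; rewrite -/(A x) gt_eqF.
- have [a0 a2] := A_gt0 _ (lt_trans t0 tx) xh.
  by rewrite mul1r; apply: divr_ge0; [exact: divr_ge0|exact: ltW].
- by apply: cF; rewrite lexx ltW.
- by apply: cF; rewrite lexx ltW.
have -> : F 2^-1 = kap 1 v / 2 * (pi / 6).
  rewrite /F /A -atan_sqrt3V; congr (_ * atan _).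
  have -> : 1 - 2^-1 ^+ 2 = 3 / 2 ^+ 2 :> R by field.
  rewrite sqrtrM// sqrtrV// sqrtr_sqr ger0_norm//.
  by field; rewrite sqrtr_eq0 -ltNge.
have -> : F t = kap 1 v / 2 * atan v.
  rewrite /F /A t2; congr (_ * atan _).
  have -> : 1 - v ^+ 2 / (1 + v ^+ 2) = (1 + v ^+ 2)^-1 by field; rewrite gt_eqF.
  by rewrite sqrtrV ?(ltW r0)// /t; field; rewrite gt_eqF.
by rewrite /g5; field.
Qed.

(** The factor [pi / 6 - atan v] is the integral of [1 / (1 + w^2)] over [v < w < c]; this is where
    the variable [w] of the double integral originates. *)
Let step6 : bint mu b5 g5 = (- (slob (pi / 2) / 36))%:E.
Proof.
rewrite -(@bint_kap1 R) -[RHS](bint_chvar _ _ (chvar_swap2 R)); last exact: bint_kap_admissible.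
apply/esym; apply: bint_fubini.
  exact: (adm_swap _ _ bint_kap_admissible).
move=> v; rewrite [RHS]/ind; case: ifPn => [|nb]; last first.
  rewrite integral0_eq// => w _; rewrite /ind ifF//; apply: contraNF nb => /=.
  by move=> /andP[/andP[v0 vw] wc]; rewrite /b5 v0 (lt_trans vw).
move=> /[dup] bv /andP[v0 vc]; have v2 := b5_pos _ bv.
have k0 : 0 <= kap 1 v by apply: kap_ge0 => //; exact: ltW.
have den w : 0 < 1 + w ^+ 2 :> R by rewrite ltr_wpDr// sqr_ge0.
apply: (ge0_FTC_val _ _ (fun w => kap 1 v * atan w) v c) => [|w|w _|w _|w _|||].
- exact: ltW.
- by rewrite /= v0.
- by rewrite /derives /=; derive; field; rewrite gt_eqF.
- by rewrite /=; cont; rewrite gt_eqF.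
- by rewrite /= mul1r divr_ge0// ltW.
- by cont.
- by cont.
by rewrite /c atan_sqrt3V /g5; ring.
Qed.

Lemma bint_ordered :
  bint (xleb (xleb (xleb mu)))
    (fun p => [&& 0 < p.2, p.2 < p.1.2, p.1.2 < p.1.1.2, p.1.1.2 < p.1.1.1 & p.1.1.1 < 2^-1])
    weight = (- (slob (pi / 2) / 72))%:E.
Proof.
rewrite step1 step2 step3 step4 step5 bintZ ?invr_ge0//.
  by rewrite step6 -EFinM; congr (_%:E); field.
split; [by rewrite /b5; meas| |].
  by rewrite /g5 /kap /artanh /sroot; meas; apply: continuous_measurable_fun; exact: continuous_atan.
move=> v bv; have v2 := b5_pos _ bv; have /andP[v0 vc] := bv.
rewrite mulr_ge0 ?kap_ge0//; first exact: ltW.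
by rewrite subr_ge0 -atan_sqrt3V le_atan// ltW.
Qed.

End OrderedCube.

(** * Symmetries of Lebesgue measure in dimension four *)

Section Transfer.
Context {R : realType} {d : measure_display} {T : measurableType d}.
Variable m : {measure set T -> \bar R}.
Implicit Types (b : T -> bool) (g l j : T -> R) (f : T -> T).

Lemma chvar_eq f f' j j' : f =1 f' -> j =1 j' -> chvar m f j -> chvar m f' j'.
Proof. by move=> /funext<- /funext<-. Qed.

Lemma bint_sym f b b' g : chvar m f (fun=> 1) -> admissible b g ->
  b' =1 (fun x => b (f x)) -> (forall x, g (f x) = g x) ->
  bint m b' g = bint m b g.
Proof.
move=> cv bg b'E gE; rewrite -[RHS](bint_chvar _ _ cv)//.
by apply: bint_eq => // x _; rewrite mul1r gE.
Qed.

Lemma bint_empty b g : b =1 xpred0 -> bint m b g = 0%E.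
Proof. by move=> b0; apply: integral0_eq => x _; rewrite /ind b0. Qed.

Lemma bint_restrict l b g : measurable_fun setT l -> m [set x | l x = 0] = 0%E ->
  admissible b g -> (forall x, b x -> 0 <= l x) ->
  bint m b g = bint m (fun x => b x && (0 < l x)) g.
Proof.
move=> ml l0 bg bl; rewrite (bint_split b g ml l0)//.
rewrite [X in (_ + X)%E]bint_empty ?adde0// => x.
by apply/negbTE/negP => /andP[/bl]; rewrite leNgt => /negbTE->.
Qed.

End Transfer.

Section LastCoordinates.
Context {R : realType} {d : measure_display} {T : measurableType d}.
Variable m : {sigma_finite_measure set T -> \bar R}.
Local Notation MR := (measurableTypeR R).

Lemma chvar_reflect_last (c : R) :
  chvar (xleb m) (fun p => (p.1, c - p.2)) (fun=> 1).
Proof.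
apply: (chvar_eq _ _ _ _ _ _ _ (chvar_affine_last _ _ m (fun=> -1) (fun=> c) _ _ _)).
- by move=> p; rewrite /affine mulN1r addrC.
- by move=> p; rewrite normrN1.
- meas.
- meas.
- by move=> x; rewrite oppr_eq0 oner_eq0.
Qed.

(** Two triangular maps, of determinants [k] and [2 k], with a swap between them. *)
Lemma chvar_butterfly (k : R) : 0 < k ->
  chvar (xleb (xleb m))
    (fun p => (p.1.1, k * (p.1.2 + p.2), k * (p.1.2 - p.2))) (fun=> 2 * k ^+ 2).
Proof.
move=> k0; have kN : k != 0 by rewrite gt_eqF.
have kN2 : 2 * k != 0 by rewrite mulf_neq0.
have c1 := chvar_affine_last _ _ (xleb m) (fun=> k) (fun p => k * p.2).
have c2 := chvar_affine_last _ _ (xleb m) (fun=> 2 * k) (fun p => - p.2).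
have {}c1 := c1 ltac:(meas) ltac:(meas) (fun=> kN).
have {}c2 := c2 ltac:(meas) ltac:(meas) (fun=> kN2).
apply: (chvar_eq _ _ _ _ _ _ _ (chvar_comp _ _ _ _ _ _ _ (chvar_comp _ _ _ _ _ _ _ c1
  (chvar_swap _ _ m)) c2)).
- move=> [[x y] z]; rewrite /affine/=; congr (_, _, _); ring.
- by move=> p /=; rewrite mulr1 !gtr0_norm ?mulr_gt0//; ring.
Qed.

End LastCoordinates.

Section Dimension4.
Context {R : realType}.
Let mu := @lebesgue_measure R.
Let MR := measurableTypeR R.
Let R4 := (MR * MR * MR * MR)%type.
Local Notation mu4 := (xleb (xleb (xleb mu))).

(** Trailing coordinates with zero coefficient are projected away until the set is a graph over the
    remaining ones. *)
Lemma null_affine (l : R4 -> R) (a1 a2 a3 a4 c : R) :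
  (forall p, l p = a1 * p.1.1.1 + a2 * p.1.1.2 + a3 * p.1.2 + a4 * p.2 + c) ->
  [|| a1 != 0, a2 != 0, a3 != 0 | a4 != 0] -> mu4 [set p | l p = 0] = 0%E.
Proof.
move=> /funext->.
have cancel (a x y z : R) : a != 0 -> x + a * y + c = 0 -> x + a * z + c = 0 -> y = z.
  by move=> a0 h1 h2; apply: (mulfI a0); lra.
have [->/=|a40 _] := eqVneq a4 0; last first.
  apply: null_graph; first meas.
  by move=> [[x y] z] t t' /=; exact: cancel.
rewrite orbF => h.
pose l3 (p : MR * MR * MR) : R := a1 * p.1.1 + a2 * p.1.2 + a3 * p.2 + c.
transitivity (mu4 [set p | l3 p.1 = 0]).
  by congr (mu4 _); apply/seteqP; split => p /=; rewrite /l3; lra.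
apply: null_lift; first by rewrite /l3; meas.
move: h; rewrite /l3; have [->/=|a30 _] := eqVneq a3 0; last first.
  apply: null_graph; first meas.
  by move=> [x y] t t' /=; exact: cancel.
rewrite orbF => h.
pose l2 (p : MR * MR) : R := a1 * p.1 + a2 * p.2 + c.
transitivity (xleb (xleb mu) [set p | l2 p.1 = 0]).
  by congr (xleb (xleb mu) _); apply/seteqP; split => p /=; rewrite /l2; lra.
apply: null_lift; first by rewrite /l2; meas.
move: h; rewrite /l2; have [->/=|a20 _] := eqVneq a2 0; last first.
  apply: null_graph; first meas.
  by move=> x t t' /=; exact: cancel.
rewrite orbF => h.
pose l1 (p : MR) : R := a1 * p + c.
transitivity (xleb mu [set p | l1 p.1 = 0]).
  by congr (xleb mu _); apply/seteqP; split => p /=; rewrite /l1; lra.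
apply: null_lift; first by rewrite /l1; meas.
rewrite (_ : [set x | _] = [set (- c / a1)]); first exact: lebesgue_measure_set1.
apply/seteqP; split => x /=; rewrite /l1 => hx.
  by apply: (mulfI h); rewrite [RHS]mulrC divfK//; lra.
by rewrite hx; field.
Qed.

Definition swap12 (p : R4) : R4 := (p.1.1.2, p.1.1.1, p.1.2, p.2).
Definition swap23 (p : R4) : R4 := (p.1.1.1, p.1.2, p.1.1.2, p.2).
Definition swap34 (p : R4) : R4 := (p.1.1.1, p.1.1.2, p.2, p.1.2).

Lemma chvar_swap12 : chvar mu4 swap12 (fun=> 1).
Proof. exact: (chvar_lift _ _ _ _ _ (chvar_lift _ _ _ _ _ (chvar_swap2 R))). Qed.

Lemma chvar_swap23 : chvar mu4 swap23 (fun=> 1).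
Proof. exact: (chvar_lift _ _ _ _ _ (chvar_swap _ _ mu)). Qed.

Lemma chvar_swap34 : chvar mu4 swap34 (fun=> 1).
Proof.
apply: chvar_eq (chvar_swap _ _ (xleb mu)) => // -[[[x y] z] t] //.
Qed.

Definition reflect1 (c : R) (p : R4) : R4 := (c - p.1.1.1, p.1.1.2, p.1.2, p.2).
Definition reflect2 (c : R) (p : R4) : R4 := (p.1.1.1, c - p.1.1.2, p.1.2, p.2).
Definition reflect3 (c : R) (p : R4) : R4 := (p.1.1.1, p.1.1.2, c - p.1.2, p.2).
Definition reflect4 (c : R) (p : R4) : R4 := (p.1.1.1, p.1.1.2, p.1.2, c - p.2).

Lemma chvar_reflect4 c : chvar mu4 (reflect4 c) (fun=> 1).
Proof. by apply: chvar_eq (chvar_reflect_last _ c) => // -[[[x y] z] t]. Qed.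

Lemma chvar_reflect3 c : chvar mu4 (reflect3 c) (fun=> 1).
Proof.
have cv := chvar_comp _ _ _ _ _ _ _ (chvar_comp _ _ _ _ _ _ _ chvar_swap34
  (chvar_reflect4 c)) chvar_swap34.
by apply: chvar_eq cv => // p; rewrite /= !mulr1.
Qed.

Lemma chvar_reflect2 c : chvar mu4 (reflect2 c) (fun=> 1).
Proof.
have cv := chvar_comp _ _ _ _ _ _ _ (chvar_comp _ _ _ _ _ _ _ chvar_swap23
  (chvar_reflect3 c)) chvar_swap23.
by apply: chvar_eq cv => // p; rewrite /= !mulr1.
Qed.

Lemma chvar_reflect1 c : chvar mu4 (reflect1 c) (fun=> 1).
Proof.
have cv := chvar_comp _ _ _ _ _ _ _ (chvar_comp _ _ _ _ _ _ _ chvar_swap12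
  (chvar_reflect2 c)) chvar_swap12.
by apply: chvar_eq cv => // p; rewrite /= !mulr1.
Qed.

Definition hadamard (p : R4) : R4 :=
  ((p.1.1.1 + p.1.1.2 + p.1.2 + p.2) / 2, (p.1.1.1 + p.1.1.2 - p.1.2 - p.2) / 2,
   (p.1.1.1 - p.1.1.2 + p.1.2 - p.2) / 2, (p.1.1.1 - p.1.1.2 - p.1.2 + p.2) / 2).

(* The matrix factors as a product of plane rotations by pi/4, each acting on a
   pair of coordinates, and permutations. *)
Lemma chvar_hadamard : chvar mu4 hadamard (fun=> 1).
Proof.
have k0 : 0 < (Num.sqrt 2)^-1 :> R by rewrite invr_gt0 sqrtr_gt0.
set k := (Num.sqrt 2)^-1 in k0.
have k2 : k ^+ 2 = 2^-1 by rewrite exprVn sqr_sqrtr.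
have r : chvar mu4 (fun p => (p.1.1.1, p.1.1.2, k * (p.1.2 + p.2), k * (p.1.2 - p.2)))
    (fun=> 1).
  apply: (chvar_eq _ _ _ _ _ _ _ (chvar_butterfly (xleb mu) k k0)).
    by move=> [[[x y] z] t].
  by move=> p /=; rewrite k2 divff.
have comp f g := chvar_comp _ _ mu4 f g (fun=> 1) (fun=> 1).
have unit f : chvar mu4 f (fun=> 1 * 1) -> chvar mu4 f (fun=> 1).
  by apply: chvar_eq => // p; rewrite mulr1.
pose s12 := chvar_swap12; pose s23 := chvar_swap23; pose s34 := chvar_swap34.
have block : chvar mu4 (fun p => (p.1.2, p.2, p.1.1.1, p.1.1.2)) (fun=> 1).
  exact: unit _ (comp _ _ (unit _ (comp _ _ (unit _ (comp _ _ s23 s12)) s34)) s23).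
have ends : chvar mu4 (fun p => (p.2, p.1.1.2, p.1.2, p.1.1.1)) (fun=> 1).
  exact: unit _ (comp _ _ (unit _ (comp _ _ (unit _ (comp _ _ (unit _
    (comp _ _ s12 s23)) s34)) s23)) s12).
have two : chvar mu4 (fun p => (k * (p.1.2 + p.2), k * (p.1.2 - p.2),
    k * (p.1.1.1 + p.1.1.2), k * (p.1.1.1 - p.1.1.2))) (fun=> 1).
  exact: unit _ (comp _ _ (unit _ (comp _ _ r block)) r).
have four := unit _ (comp _ _ (unit _ (comp _ _ two ends)) two).
apply: chvar_eq four => // -[[[x y] z] t] /=; rewrite /hadamard /=.
by congr (_, _, _, _); rewrite -[_ / 2]mulrC -k2; ring.
Qed.

End Dimension4.

(** * From the cube to its ordered part *)

Section Symmetrization.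
Context {R : realType}.
Let mu := @lebesgue_measure R.
Let MR := measurableTypeR R.
Let R4 := (MR * MR * MR * MR)%type.
Local Notation mu4 := (xleb (xleb (xleb mu))).
Implicit Types (b : R4 -> bool) (g : R4 -> R).

Lemma weight_swap12 (p : R4) : weight (swap12 p) = weight p.
Proof. by rewrite /weight /=; congr (_ ^+ 2)^-1; ring. Qed.

Lemma weight_swap23 (p : R4) : weight (swap23 p) = weight p.
Proof. by rewrite /weight /=; congr (_ ^+ 2)^-1; ring. Qed.

Lemma weight_swap34 (p : R4) : weight (swap34 p) = weight p.
Proof. by rewrite /weight /=; congr (_ ^+ 2)^-1; ring. Qed.

Lemma admissible_weight b : measurable_fun setT b -> admissible b weight.
Proof. by split => // [|p _]; [exact: measurable_weight|exact: weight_ge0]. Qed.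

Definition wint b : \bar R := bint mu4 b weight.

Lemma wintE b : wint b = bint mu4 b weight.
Proof. by []. Qed.

Lemma wint_eq b b' : b =1 b' -> wint b = wint b'.
Proof. by move=> /funext->. Qed.

Lemma wint_ge0 b : measurable_fun setT b -> (0 <= wint b)%E.
Proof. by move=> mb; apply: bint_ge0; exact: admissible_weight. Qed.

Definition nonconst_affine (l : R4 -> R) := exists a1 a2 a3 a4 c : R,
  (forall p, l p = a1 * p.1.1.1 + a2 * p.1.1.2 + a3 * p.1.2 + a4 * p.2 + c) /\
  [|| a1 != 0, a2 != 0, a3 != 0 | a4 != 0].

Lemma nonconst_affine_null l : nonconst_affine l -> measurable_fun setT l /\
  mu4 [set p | l p = 0] = 0%E.
Proof.
move=> [a1 [a2 [a3 [a4 [c [lE a0]]]]]]; split; last exact: null_affine lE a0.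
by rewrite (funext lE); meas.
Qed.

Lemma wint_split (l : R4 -> R) b : nonconst_affine l -> measurable_fun setT b ->
  wint b = (wint (fun p => b p && (0 < l p)%R) + wint (fun p => b p && (l p < 0)%R))%E.
Proof.
move=> /nonconst_affine_null[ml l0] mb; apply: (bint_split b weight ml l0).
exact: admissible_weight.
Qed.

Lemma wint_restrict (l : R4 -> R) b : nonconst_affine l -> measurable_fun setT b ->
  (forall p, b p -> 0 <= l p) -> wint b = wint (fun p => b p && (0 < l p)).
Proof.
move=> /nonconst_affine_null[ml l0] mb bl; apply: (bint_restrict _ l b weight ml l0 _ bl).
exact: admissible_weight.
Qed.

Lemma wint_sym f b b' : chvar mu4 f (fun=> 1) -> (forall p, weight (f p) = weight p) ->
  measurable_fun setT b -> b' =1 (fun p => b (f p)) -> wint b' = wint b.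
Proof.
move=> cf wf mb b'E; apply: (bint_sym _ f b b' weight cf _ b'E wf).
exact: admissible_weight.
Qed.

Lemma wint_double f (l : R4 -> R) b : chvar mu4 f (fun=> 1) ->
  (forall p, weight (f p) = weight p) -> nonconst_affine l -> measurable_fun setT b ->
  (forall p, b (f p) = b p) -> (forall p, l (f p) = - l p) ->
  wint b = (2%:E * wint (fun p => b p && (0 < l p)%R))%E.
Proof.
move=> cf wf /nonconst_affine_null[ml l0] mb bf lf.
apply: (bint_double b weight cf ml l0 _ bf _ lf); first exact: admissible_weight.
by move=> p _; exact: wf.
Qed.

Lemma affine34 : nonconst_affine (fun p => p.1.2 - p.2).
Proof.
exists 0, 0, 1, (-1), 0; split => [p|]; first by ring.
by rewrite oner_eq0 !orbT.
Qed.

Lemma affine23 : nonconst_affine (fun p => p.1.1.2 - p.1.2).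
Proof.
exists 0, 1, (-1), 0, 0; split => [p|]; first by ring.
by rewrite oner_eq0 !orbT.
Qed.

Lemma affine12 : nonconst_affine (fun p => p.1.1.1 - p.1.1.2).
Proof.
exists 1, (-1), 0, 0, 0; split => [p|]; first by ring.
by rewrite oner_eq0.
Qed.

Opaque wint.

Lemma wint_sort_last b : measurable_fun setT b ->
  (forall p, b (swap34 p) = b p) ->
  wint b = (2%:E * wint (fun p => b p && (p.2 < p.1.2)%R))%E.
Proof.
move=> mb b34.
rewrite (wint_double _ _ _ chvar_swap34 weight_swap34 affine34 mb b34).
  by congr (_ * _)%E; apply: wint_eq => p; rewrite subr_gt0.
by move=> p; rewrite opprB.
Qed.

(** Insertion of the second coordinate into the sorted last two: either it exceeds the third, or a
    swap makes it the largest of the three, with the other two unsorted. The second case counts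
    twice by [wint_sort_last]. *)
Lemma wint_sort_three b : measurable_fun setT b ->
  (forall p, b (swap23 p) = b p) -> (forall p, b (swap34 p) = b p) ->
  wint (fun p => b p && (p.2 < p.1.2)) =
  (3%:E * wint (fun p => [&& b p, (p.2 < p.1.2)%R & (p.1.2 < p.1.1.2)%R]))%E.
Proof.
move=> mb b23 b34.
have m1 : measurable_fun setT (fun p : R4 => b p && (p.2 < p.1.2)) by meas.
rewrite (wint_split _ _ affine23 m1).
have -> : wint (fun p => (b p && (p.2 < p.1.2)) && (0 < p.1.1.2 - p.1.2)) =
    wint (fun p => [&& b p, (p.2 < p.1.2) & (p.1.2 < p.1.1.2)]).
  by apply: wint_eq => p; rewrite subr_gt0 -andbA.
pose b' (p : R4) := [&& b p, p.2 < p.1.1.2 & p.1.2 < p.1.1.2].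
have mb' : measurable_fun setT b' by rewrite /b'; meas.
have -> : wint (fun p => (b p && (p.2 < p.1.2)) && (p.1.1.2 - p.1.2 < 0)) = wint b'.
  apply: (wint_sym _ _ _ chvar_swap23 weight_swap23 mb').
  by move=> p; rewrite /b' b23/= subr_lt0 andbA.
rewrite (wint_sort_last b' mb'); last first.
  by move=> p; rewrite /b' b34 /= [X in _ && X]andbC.
have -> : wint (fun p => b' p && (p.2 < p.1.2)) =
    wint (fun p => [&& b p, (p.2 < p.1.2) & (p.1.2 < p.1.1.2)]).
  apply: wint_eq => p; rewrite /b'; case: (b p) => //=.
  case: (ltrP p.2 p.1.2) => h1; last by rewrite !andbF.
  by rewrite andbT; case: (ltrP p.1.2 p.1.1.2) => h2; rewrite ?andbF//= (lt_trans h1).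
by rewrite -[X in (X + _)%E]mul1e -ge0_muleDl ?lee_fin//.
Qed.

Definition cube (p : R4) : bool :=
  [&& 0 < p.1.1.1 < 2^-1, 0 < p.1.1.2 < 2^-1, 0 < p.1.2 < 2^-1 & 0 < p.2 < 2^-1].

(** Sorting by insertion: the factors [2], [3] and [4 = 1 + 3] account for the [24] orders. The [3]
    in the last one is [wint_sort_three] applied where the first coordinate is the largest. *)
Lemma wint_cube : wint cube = (- (slob (pi / 2) / 3))%:E.
Proof.
have mc : measurable_fun setT cube by rewrite /cube; meas.
rewrite (wint_sort_last _ mc); last first.
  by move=> p; rewrite /cube /=; do 2 congr (_ && _); rewrite andbC.
rewrite (wint_sort_three _ mc); last 2 first.
- by move=> p; rewrite /cube /=; congr (_ && _); rewrite andbCA.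
- by move=> p; rewrite /cube /=; do 2 congr (_ && _); rewrite andbC.
pose b1 (p : R4) := [&& cube p, p.2 < p.1.2 & p.1.2 < p.1.1.2].
have m1 : measurable_fun setT b1 by rewrite /b1; meas.
rewrite (wint_split _ _ affine12 m1).
pose b2 (p : R4) := [&& cube p, p.1.1.2 < p.1.1.1, p.1.2 < p.1.1.1 & p.2 < p.1.1.1].
have m2 : measurable_fun setT b2 by rewrite /b2; meas.
have m3 : measurable_fun setT (fun p => b2 p && (p.2 < p.1.2)) by meas.
pose b3 (p : R4) :=
  [&& 0 < p.2, p.2 < p.1.2, p.1.2 < p.1.1.2, p.1.1.2 < p.1.1.1 & p.1.1.1 < 2^-1].
have -> : wint (fun p => b1 p && (0 < p.1.1.1 - p.1.1.2)) = wint b3.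
  apply: wint_eq => p; rewrite /b1 /b3 /cube subr_gt0.
  by apply/idP/idP => h; lra.
have -> : wint (fun p => b1 p && (p.1.1.1 - p.1.1.2 < 0)) =
    wint (fun p => b2 p && (p.2 < p.1.2)).
  apply: (wint_sym _ _ _ chvar_swap12 weight_swap12 m3) => p.
  by rewrite /b1 /b2 /cube /= subr_lt0; apply/idP/idP => h; lra.
rewrite (wint_sort_three _ m2); last 2 first.
- by move=> p; rewrite /b2 /cube /=; apply/idP/idP => h; lra.
- by move=> p; rewrite /b2 /cube /=; apply/idP/idP => h; lra.
have -> : wint (fun p => [&& b2 p, p.2 < p.1.2 & p.1.2 < p.1.1.2]) = wint b3.
  by apply: wint_eq => p; rewrite /b2 /b3 /cube; apply/idP/idP => h; lra.
have -> : wint b3 = (- (slob (pi / 2) / 72))%:E := bint_ordered.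
by rewrite -EFinM; congr (_%:E); field.
Qed.

End Symmetrization.

(** * The relation [P = 12 E] *)

Section Octant.
Context {R : realType}.
Let mu := @lebesgue_measure R.
Let MR := measurableTypeR R.
Let R4 := (MR * MR * MR * MR)%type.
Local Notation mu4 := (xleb (xleb (xleb mu))).

Definition corner (p : R4) : bool :=
  [&& 0 < p.1.1.2, 0 < p.1.2, 0 < p.2, p.1.1.2 + p.1.2 + p.2 < p.1.1.1 & p.1.1.1 < 2^-1].

Definition octant (p : R4) : bool :=
  cube p && (p.1.1.1 + p.1.1.2 + p.1.2 + p.2 < 1).

Definition diamond (p : R4) : bool :=
  (`|p.1.1.2| + `|p.1.2| + `|p.2| < p.1.1.1) && (p.1.1.1 < 2^-1).

(** One inequality for each face of an octahedron, a form on which linear arithmetic works. *)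
Lemma norm3_lt (a b c e : R) : (`|a| + `|b| + `|c| < e) =
  [&& a + b + c < e, a + b - c < e, a - b + c < e, a - b - c < e,
      - a + b + c < e, - a + b - c < e, - a - b + c < e & - a - b - c < e].
Proof.
by case: (ger0P a) => a0; case: (ger0P b) => b0; case: (ger0P c) => c0;
  apply/idP/idP => h; lra.
Qed.

Lemma measurable_corner : measurable_fun setT corner.
Proof. by rewrite /corner; meas. Qed.

Lemma measurable_octant : measurable_fun setT octant.
Proof. by rewrite /octant /cube; meas. Qed.

Lemma measurable_diamond : measurable_fun setT diamond.
Proof. by rewrite /diamond; meas. Qed.

Lemma weight_hadamard (p : R4) : weight (hadamard p) = weight p.
Proof. by rewrite /weight /=; congr (_ ^+ 2)^-1; field. Qed.

Lemma weight_reflect1 (p : R4) : weight (reflect1 0 p) = weight p.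
Proof. by rewrite /weight /=; congr (_ ^+ 2)^-1; ring. Qed.

Lemma weight_reflect2 (p : R4) : weight (reflect2 0 p) = weight p.
Proof. by rewrite /weight /=; congr (_ ^+ 2)^-1; ring. Qed.

Lemma weight_reflect3 (p : R4) : weight (reflect3 0 p) = weight p.
Proof. by rewrite /weight /=; congr (_ ^+ 2)^-1; ring. Qed.

Lemma weight_reflect4 (p : R4) : weight (reflect4 0 p) = weight p.
Proof. by rewrite /weight /=; congr (_ ^+ 2)^-1; ring. Qed.

Lemma affine1 : nonconst_affine (fun p : R4 => p.1.1.1).
Proof. by exists 1, 0, 0, 0, 0; split => [p|]; [ring|rewrite oner_eq0]. Qed.

Lemma affine2 : nonconst_affine (fun p : R4 => p.1.1.2).
Proof. by exists 0, 1, 0, 0, 0; split => [p|]; [ring|rewrite oner_eq0 !orbT]. Qed.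

Lemma affine3 : nonconst_affine (fun p : R4 => p.1.2).
Proof. by exists 0, 0, 1, 0, 0; split => [p|]; [ring|rewrite oner_eq0 !orbT]. Qed.

Lemma affine4 : nonconst_affine (fun p : R4 => p.2).
Proof. by exists 0, 0, 0, 1, 0; split => [p|]; [ring|rewrite oner_eq0 !orbT]. Qed.

Lemma wint_diamond : wint diamond = (8%:E * wint corner)%E.
Proof.
have md := measurable_diamond.
rewrite (wint_double _ _ _ (chvar_reflect2 0) weight_reflect2 affine2 md); last 2 first.
- by move=> p; rewrite /diamond /= sub0r normrN.
- by move=> p; rewrite /= sub0r.
pose d2 (p : R4) := diamond p && (0 < p.1.1.2).
have m2 : measurable_fun setT d2 by rewrite /d2; meas.
rewrite (wint_double _ _ _ (chvar_reflect3 0) weight_reflect3 affine3 m2); last 2 first.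
- by move=> p; rewrite /d2 /diamond /= sub0r normrN.
- by move=> p; rewrite /= sub0r.
pose d3 (p : R4) := d2 p && (0 < p.1.2).
have m3 : measurable_fun setT d3 by rewrite /d3; meas.
rewrite (wint_double _ _ _ (chvar_reflect4 0) weight_reflect4 affine4 m3); last 2 first.
- by move=> p; rewrite /d3 /d2 /diamond /= sub0r normrN.
- by move=> p; rewrite /= sub0r.
rewrite !muleA -!EFinM; congr (_%:E * _)%E; first by ring.
apply: wint_eq => p; rewrite /d3 /d2 /diamond norm3_lt /corner.
by apply/idP/idP => h; lra.
Qed.

Let l1 (p : R4) : R := p.1.1.1 - (p.1.1.2 + p.1.2 + p.2).
Let l2 (p : R4) : R := p.1.1.2 - (p.1.1.1 + p.1.2 + p.2).
Let l3 (p : R4) : R := p.1.2 - (p.1.1.1 + p.1.1.2 + p.2).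
Let l4 (p : R4) : R := p.2 - (p.1.1.1 + p.1.1.2 + p.1.2).

Let a1 : nonconst_affine l1.
Proof.
exists 1, (-1), (-1), (-1), 0; split => [p|]; first by rewrite /l1; ring.
by rewrite oner_eq0.
Qed.

Let a2 : nonconst_affine l2.
Proof.
exists (-1), 1, (-1), (-1), 0; split => [p|]; first by rewrite /l2; ring.
by rewrite oner_eq0 !orbT.
Qed.

Let a3 : nonconst_affine l3.
Proof.
exists (-1), (-1), 1, (-1), 0; split => [p|]; first by rewrite /l3; ring.
by rewrite oner_eq0 !orbT.
Qed.

Let a4 : nonconst_affine l4.
Proof.
exists (-1), (-1), (-1), 1, 0; split => [p|]; first by rewrite /l4; ring.
by rewrite oner_eq0 !orbT.
Qed.

Lemma wint_octant : wint octant = (12%:E * wint corner)%E.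
Proof.
pose c2 p := corner (swap12 p); pose c3 p := c2 (swap23 p); pose c4 p := c3 (swap34 p).
pose o1 p := octant p && (l1 p < 0); pose o2 p := o1 p && (l2 p < 0).
pose o3 p := o2 p && (l3 p < 0); pose o4 p := o3 p && (l4 p < 0).
have b1E p : octant p && (0 < l1 p) = corner p.
  by rewrite /octant /cube /corner /l1; apply/idP/idP => h; lra.
have b2E p : o1 p && (0 < l2 p) = c2 p.
  by rewrite /o1 /octant /cube /c2 /corner /l1 /l2 /=; apply/idP/idP => h; lra.
have b3E p : o2 p && (0 < l3 p) = c3 p.
  by rewrite /o2 /o1 /octant /cube /c3 /c2 /corner /l1 /l2 /l3 /=; apply/idP/idP => h; lra.
have b4E p : o3 p && (0 < l4 p) = c4 p.
  rewrite /o3 /o2 /o1 /octant /cube /c4 /c3 /c2 /corner /l1 /l2 /l3 /l4 /=.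
  by apply/idP/idP => h; lra.
(* Writing [y] for the image of [x], the sums [y1 + y2 + y3 + y4] and their like with two minus
   signs are the [2 x_i]; those with an odd number of minus signs are the sums of three coordinates
   minus the fourth. The bound [y1 < 1/2] is [sum x_i < 1]. *)
have b5E p : o4 p = diamond (hadamard p).
  rewrite /o4 /o3 /o2 /o1 /octant /cube /diamond norm3_lt /l1 /l2 /l3 /l4 /=.
  by apply/idP/idP => h; lra.
have mo := measurable_octant; have mc := measurable_corner.
have [[ml1 _] [ml2 _] [ml3 _] [ml4 _]] := And4 (nonconst_affine_null _ a1)
  (nonconst_affine_null _ a2) (nonconst_affine_null _ a3) (nonconst_affine_null _ a4).
have m2 : measurable_fun setT c2 by rewrite /c2 /corner /=; meas.
have m3 : measurable_fun setT c3 by rewrite /c3 /c2 /corner /=; meas.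
have mo1 : measurable_fun setT o1 by rewrite /o1; meas.
have mo2 : measurable_fun setT o2 by rewrite /o2; meas.
have mo3 : measurable_fun setT o3 by rewrite /o3; meas.
have e2 : wint c2 = wint corner := wint_sym _ _ _ chvar_swap12 weight_swap12 mc (fun=> erefl).
have e3 : wint c3 = wint c2 := wint_sym _ _ _ chvar_swap23 weight_swap23 m2 (fun=> erefl).
have e4 : wint c4 = wint c3 := wint_sym _ _ _ chvar_swap34 weight_swap34 m3 (fun=> erefl).
have f1 := wint_eq _ _ b1E; have f2 := etrans (wint_eq _ _ b2E) e2.
have f3 := etrans (wint_eq _ _ b3E) (etrans e3 e2).
have f4 := etrans (wint_eq _ _ b4E) (etrans e4 (etrans e3 e2)).
have f5 : wint o4 = wint diamond :=
  wint_sym _ _ _ chvar_hadamard weight_hadamard measurable_diamond b5E.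
rewrite (wint_split _ _ a1 mo) f1 -/o1 (wint_split _ _ a2 mo1) f2 -/o2.
rewrite (wint_split _ _ a3 mo2) f3 -/o3 (wint_split _ _ a4 mo3) f4 -/o4 f5 wint_diamond.
have -> : 12 = 1 + (1 + (1 + (1 + 8))) :> R by ring.
by rewrite !(EFinD, ge0_muleDl, mul1e)// lee_fin.
Qed.

End Octant.

(** * Scaling and inversion in the coordinates [(q, s)] *)

Section Dimension5.
Context {R : realType}.
Let mu := @lebesgue_measure R.
Let MR := measurableTypeR R.
Let R4 := (MR * MR * MR * MR)%type.
Let R5 := (MR * MR * MR * MR * MR)%type.
Local Notation mu4 := (xleb (xleb (xleb mu))).
Local Notation mu5 := (xleb (xleb (xleb (xleb mu)))).

Definition last_first (p : R5) : R5 := (p.2, p.1.1.1.1, p.1.1.1.2, p.1.1.2, p.1.2).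
Definition first_last (p : R5) : R5 := (p.1.1.1.2, p.1.1.2, p.1.2, p.2, p.1.1.1.1).

Let unit5 f : chvar mu5 f (fun=> 1 * 1) -> chvar mu5 f (fun=> 1).
Proof. by apply: chvar_eq => // p; rewrite mulr1. Qed.

Let s45 : chvar mu5 (fun p => (p.1.1, p.2, p.1.2)) (fun=> 1).
Proof. exact: (chvar_swap _ _ (xleb (xleb mu))). Qed.

Let s34 : chvar mu5 (fun p => (p.1.1.1, p.1.2, p.1.1.2, p.2)) (fun=> 1).
Proof. exact: (chvar_lift _ _ _ _ _ (chvar_swap _ _ (xleb mu))). Qed.

Let s23 : chvar mu5 (fun p => (p.1.1.1.1, p.1.1.2, p.1.1.1.2, p.1.2, p.2)) (fun=> 1).
Proof. exact: (chvar_lift _ _ _ _ _ (chvar_lift _ _ _ _ _ (chvar_swap _ _ mu))). Qed.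

Let s12 : chvar mu5 (fun p => (p.1.1.1.2, p.1.1.1.1, p.1.1.2, p.1.2, p.2)) (fun=> 1).
Proof.
exact: (chvar_lift _ _ _ _ _ (chvar_lift _ _ _ _ _ (chvar_lift _ _ _ _ _ (chvar_swap2 R)))).
Qed.

Lemma chvar_last_first : chvar mu5 last_first (fun=> 1).
Proof.
have cv := unit5 _ (chvar_comp _ _ _ _ _ _ _ (unit5 _ (chvar_comp _ _ _ _ _ _ _
  (unit5 _ (chvar_comp _ _ _ _ _ _ _ s45 s34)) s23)) s12).
exact: cv.
Qed.

Lemma chvar_first_last : chvar mu5 first_last (fun=> 1).
Proof.
have cv := unit5 _ (chvar_comp _ _ _ _ _ _ _ (unit5 _ (chvar_comp _ _ _ _ _ _ _
  (unit5 _ (chvar_comp _ _ _ _ _ _ _ s12 s23)) s34)) s45).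
by apply: chvar_eq cv => // -[[[[x y] z] t] u].
Qed.

(* The value for nonpositive arguments keeps the scaling below invertible. *)
Definition inv_pos (s : R) : R := if 0 < s then s^-1 else 1.

Lemma inv_pos_gt0 s : 0 < inv_pos s.
Proof. by rewrite /inv_pos; case: ifPn => // s0; rewrite invr_gt0. Qed.

Lemma measurable_inv_pos : measurable_fun setT inv_pos.
Proof. by rewrite /inv_pos; meas; exact: measurable_inv. Qed.

Definition scale (p : R5) : R5 :=
  (p.1.1.1.1 * inv_pos p.2, p.1.1.1.2 * inv_pos p.2, p.1.1.2 * inv_pos p.2,
   p.1.2 * inv_pos p.2, p.2).

(** The scaling parameter is rotated to the front, so that it precedes each coordinate it scales, as
    in [chvar_affine_last], and is rotated back afterwards. *)
Lemma chvar_scale : chvar mu5 scale (fun p => inv_pos p.2 ^+ 4).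
Proof.
have a0 s : inv_pos s != 0 by rewrite gt_eqF// inv_pos_gt0.
have m1 : measurable_fun setT (inv_pos : MR -> R) := measurable_inv_pos.
have m2 : measurable_fun setT (fun p : MR * MR => inv_pos p.1).
  exact: measurableT_comp.
have m3 : measurable_fun setT (fun p : MR * MR * MR => inv_pos p.1.1).
  exact: measurableT_comp m2 (@measurable_fst _ _ _ _).
have m4 : measurable_fun setT (fun p : R4 => inv_pos p.1.1.1).
  exact: measurableT_comp m3 (@measurable_fst _ _ _ _).
have k1 := chvar_lift _ _ _ _ _ (chvar_lift _ _ _ _ _ (chvar_lift _ _ _ _ _
  (chvar_affine_last _ _ mu _ (fun=> 0) m1 (measurable_cst _) a0))).
have k2 := chvar_lift _ _ _ _ _ (chvar_lift _ _ _ _ _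
  (chvar_affine_last _ _ (xleb mu) _ (fun=> 0) m2 (measurable_cst _) (fun p => a0 p.1))).
have k3 := chvar_lift _ _ _ _ _
  (chvar_affine_last _ _ (xleb (xleb mu)) _ (fun=> 0) m3 (measurable_cst _) (fun p => a0 p.1.1)).
have k4 := chvar_affine_last _ _ mu4 _ (fun=> 0) m4 (measurable_cst _) (fun p => a0 p.1.1.1).
have {}k1 : chvar mu5 (fun p => (p.1.1.1.1, p.1.1.1.2 * inv_pos p.1.1.1.1, p.1.1.2, p.1.2, p.2))
    (fun p => inv_pos p.1.1.1.1).
  apply: chvar_eq k1; last by move=> p /=; rewrite gtr0_norm ?inv_pos_gt0.
  by move=> p; rewrite /affine/= addr0 mulrC.
have {}k2 : chvar mu5 (fun p => (p.1.1.1.1, p.1.1.1.2, p.1.1.2 * inv_pos p.1.1.1.1, p.1.2, p.2))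
    (fun p => inv_pos p.1.1.1.1).
  apply: chvar_eq k2; last by move=> p /=; rewrite gtr0_norm ?inv_pos_gt0.
  by move=> -[[[[x y] z] t] u]; rewrite /affine/= addr0 mulrC.
have {}k3 : chvar mu5 (fun p => (p.1.1.1.1, p.1.1.1.2, p.1.1.2, p.1.2 * inv_pos p.1.1.1.1, p.2))
    (fun p => inv_pos p.1.1.1.1).
  apply: chvar_eq k3; last by move=> p /=; rewrite gtr0_norm ?inv_pos_gt0.
  by move=> -[[[[x y] z] t] u]; rewrite /affine/= addr0 mulrC.
have {}k4 : chvar mu5 (fun p => (p.1.1.1.1, p.1.1.1.2, p.1.1.2, p.1.2, p.2 * inv_pos p.1.1.1.1))
    (fun p => inv_pos p.1.1.1.1).
  apply: chvar_eq k4; last by move=> p /=; rewrite gtr0_norm ?inv_pos_gt0.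
  by move=> -[[[[x y] z] t] u]; rewrite /affine/= addr0 mulrC.
have k := chvar_comp _ _ _ _ _ _ _ (chvar_comp _ _ _ _ _ _ _
  (chvar_comp _ _ _ _ _ _ _ k1 k2) k3) k4.
have {}k : chvar mu5 (fun p => (p.1.1.1.1, p.1.1.1.2 * inv_pos p.1.1.1.1,
    p.1.1.2 * inv_pos p.1.1.1.1, p.1.2 * inv_pos p.1.1.1.1, p.2 * inv_pos p.1.1.1.1))
    (fun p => inv_pos p.1.1.1.1 ^+ 4).
  by apply: chvar_eq k => // p; rewrite /=; ring.
have cv := chvar_comp _ _ _ _ _ _ _ (chvar_comp _ _ _ _ _ _ _ chvar_last_first k)
  chvar_first_last.
by apply: chvar_eq cv => // p; rewrite /= mulr1 mul1r.
Qed.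

End Dimension5.

Section Inversion.
Context {R : realType}.
Let mu := @lebesgue_measure R.

(** Both sides are [c (ln hi - ln lo)], or [0] when the interval is empty. *)
Lemma integral_inversion (b : R -> bool) (N lo hi c : R) : 0 < N -> 0 < lo -> 0 < hi ->
  0 <= c -> b =1 (fun s => lo < s < hi) ->
  (\int[mu]_s ind b (fun s => c / s)%R s =
   \int[mu]_s ind (fun s : R => (0 < s) && b (N / s))%R (fun s => c / s)%R s)%E.
Proof.
move=> N0 lo0 hi0 c0 bE.
have b'E s : (0 < s) && b (N / s) = (N / hi < s < N / lo).
  rewrite bE; have [s0|s0] := ltrP 0 s => /=.
    have -> : (lo < N / s) = (s < N / lo) by rewrite !ltr_pdivlMr// mulrC.
    have -> : (N / s < hi) = (N / hi < s) by rewrite !ltr_pdivrMr// mulrC.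
    by rewrite andbC.
  by apply/esym/negbTE; rewrite negb_and -leNgt (le_trans s0)// divr_ge0 ?ltW.
have [hl|lh] := leP hi lo.
  rewrite !ind_set0// => s.
    rewrite b'E; apply/negbTE/negP => /andP[h1 h2].
    have := lt_trans h1 h2; rewrite ltr_pdivrMr// mulrAC ltr_pdivlMr// ltr_pM2l//.
    by rewrite ltNge hl.
  by rewrite bE; apply/negbTE/negP => /andP[h1 /(lt_trans h1)]; rewrite ltNge hl.
have FTC x y (b0 : R -> bool) : 0 < x -> x < y -> b0 =1 (fun s => x < s < y) ->
    (\int[mu]_s ind b0 (fun s => c / s)%R s = (c * (ln y - ln x))%:E)%E.
  move=> x0 xy b0E.
  apply: (ge0_FTC_val _ _ (fun s => c * ln s) x y) => [|//|s /andP[xs _]|s /andP[xs _]|s /andP[xs _]|||].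
  - exact: ltW.
  - have s0 := lt_trans x0 xs.
    by rewrite /derives; derive => //; field; rewrite gt_eqF.
  - by cont; rewrite gt_eqF// (lt_trans x0).
  - by rewrite divr_ge0// ltW// (lt_trans x0).
  - by cont.
  - by cont; exact: lt_trans xy.
  - by rewrite mulrBr.
rewrite (FTC lo hi)// (FTC (N / hi) (N / lo) _ _ _ b'E) ?divr_gt0//; last first.
  by rewrite ltr_pM2l// ltf_pV2.
by rewrite !ln_div ?posrE//; congr (_%:E); ring.
Qed.

End Inversion.

(** * The relation [Q = 3 P + 4 E] *)

Section CubeOctantCorner.
Context {R : realType}.
Let mu := @lebesgue_measure R.
Let MR := measurableTypeR R.
Let R4 := (MR * MR * MR * MR)%type.
Let R5 := (MR * MR * MR * MR * MR)%type.
Local Notation mu4 := (xleb (xleb (xleb mu))).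
Local Notation mu5 := (xleb (xleb (xleb (xleb mu)))).

Definition nsq (p : R4) : R := p.1.1.1 ^+ 2 + p.1.1.2 ^+ 2 + p.1.2 ^+ 2 + p.2 ^+ 2.
Definition tot (p : R4) : R := p.1.1.1 + p.1.1.2 + p.1.2 + p.2.
Definition pos4 (p : R4) : bool := [&& 0 < p.1.1.1, 0 < p.1.1.2, 0 < p.1.2 & 0 < p.2].

Lemma measurable_nsq : measurable_fun setT nsq.
Proof. by rewrite /nsq; meas. Qed.

Lemma measurable_tot : measurable_fun setT tot.
Proof. by rewrite /tot; meas. Qed.

Lemma measurable_pos4 : measurable_fun setT pos4.
Proof. by rewrite /pos4; meas. Qed.

Lemma nsq_ge0 p : 0 <= nsq p.
Proof. by rewrite /nsq !addr_ge0 ?sqr_ge0. Qed.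

Lemma sqr_lt_self (x : R) : 0 < x -> x < 1 -> x ^+ 2 < x.
Proof. by move=> x0 x1; rewrite expr2 gtr_pMr. Qed.

Lemma nsq_lt_tot p : pos4 p -> tot p < 1 -> nsq p < tot p.
Proof.
rewrite /pos4 /tot /nsq => /and4P[h1 h2 h3 h4] h.
have := sqr_lt_self p.1.1.1 h1; have := sqr_lt_self p.1.1.2 h2.
have := sqr_lt_self p.1.2 h3; have := sqr_lt_self p.2 h4.
have [k1 k2 k3 k4] : [/\ p.1.1.1 < 1, p.1.1.2 < 1, p.1.2 < 1 & p.2 < 1] by split; lra.
by move=> /(_ k4) ? /(_ k3) ? /(_ k2) ? /(_ k1) ?; lra.
Qed.

Lemma sqrtV_gt0 (A : R) : 0 < A -> 0 < Num.sqrt A^-1.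
Proof. by move=> A0; rewrite sqrtr_gt0 invr_gt0. Qed.

Lemma lt_sqrtV (A s : R) : 0 < A -> 0 < s -> (s ^+ 2 * A < 1) = (s < Num.sqrt A^-1).
Proof.
move=> A0 s0; rewrite -[RHS](ltr_pXn2r (n := 2))// ?nnegrE ?sqrtr_ge0 ?ltW//.
by rewrite sqr_sqrtr ?invr_ge0 ?ltW// -[A^-1]mul1r ltr_pdivlMr.
Qed.

Lemma gt_sqrtV (A s : R) : 0 < A -> 0 < s -> (1 < s ^+ 2 * A) = (Num.sqrt A^-1 < s).
Proof.
move=> A0 s0; rewrite -[RHS](ltr_pXn2r (n := 2))// ?nnegrE ?sqrtr_ge0 ?ltW//.
by rewrite sqr_sqrtr ?invr_ge0 ?ltW// -[A^-1]mul1r ltr_pdivrMr.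
Qed.

Lemma sqrtV_exp4 (A : R) : 0 < A -> Num.sqrt A^-1 ^+ 4 = (A ^+ 2)^-1.
Proof.
move=> A0; have -> : Num.sqrt A^-1 ^+ 4 = (Num.sqrt A^-1 ^+ 2) ^+ 2 by ring.
rewrite sqr_sqrtr ?invr_ge0 ?ltW//; by rewrite exprVn.
Qed.

Lemma integral_cube_power (b : R -> bool) (lo hi : R) : 0 <= lo -> lo <= hi ->
  b =1 (fun s => lo < s < hi) ->
  (\int[mu]_s ind b (fun s => 4 * s ^+ 3)%R s = (hi ^+ 4 - lo ^+ 4)%:E)%E.
Proof.
move=> lo0 lohi bE.
apply: (ge0_FTC_val _ _ (fun s => s ^+ 4) lo hi) => [//|//|s _|s _|s /andP[h _]|||//].
- by rewrite /derives; derive; rewrite mulr1.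
- by cont.
- by rewrite mulr_ge0// exprn_ge0// (le_trans lo0)// ltW.
- by cont.
- by cont.
Qed.

Let half : R := 2^-1.
(** This is [weight (v - p) - weight p] for [v = (1/2, 1/2, 1/2, 1/2)], because
    [1 - |v - p|^2 = tot p - nsq p]. *)
Definition gap (p : R4) : R := ((tot p - nsq p) ^+ 2)^-1 - ((1 - nsq p) ^+ 2)^-1.
Let bD (p : R5) : bool :=
  [&& octant p.1, 0 < p.2, p.2 ^+ 2 * (tot p.1 - nsq p.1) < 1
    & 1 < p.2 ^+ 2 * (1 - nsq p.1)].
Let gD (p : R5) : R := 4 * p.2 ^+ 3.
Let bB (p : R5) : bool :=
  [&& pos4 p.1, 0 < p.2, [&& 2 * p.1.1.1.1 < p.2, 2 * p.1.1.1.2 < p.2, 2 * p.1.1.2 < p.2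
    & 2 * p.1.2 < p.2], p.2 * tot p.1 < 1 + nsq p.1 & 1 + nsq p.1 < p.2 ^+ 2].
Let gB (p : R5) : R := 4 / p.2.
Let bC (p : R5) : bool :=
  [&& pos4 p.1, 0 < p.2, [&& p.2 * (2 * p.1.1.1.1) < 1 + nsq p.1,
    p.2 * (2 * p.1.1.1.2) < 1 + nsq p.1, p.2 * (2 * p.1.1.2) < 1 + nsq p.1
    & p.2 * (2 * p.1.2) < 1 + nsq p.1], tot p.1 < p.2 & p.2 ^+ 2 < 1 + nsq p.1].
Let bZ (p : R5) : bool :=
  [&& pos4 p.1, tot p.1 < 1, 0 < p.2, p.2 ^+ 2 * (1 - nsq p.1) < 1
    & [&& p.2 ^+ 2 * (2 * p.1.1.1.1 - nsq p.1) < 1, p.2 ^+ 2 * (2 * p.1.1.1.2 - nsq p.1) < 1,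
      p.2 ^+ 2 * (2 * p.1.1.2 - nsq p.1) < 1 & p.2 ^+ 2 * (2 * p.1.2 - nsq p.1) < 1]].

Let octantE p : octant p -> [/\ pos4 p, tot p < 1, 0 < tot p - nsq p & 0 < 1 - nsq p].
Proof.
move=> op; have [h1 h2] : pos4 p /\ tot p < 1.
  by move: op; rewrite /octant /cube /pos4 /tot => h; split; lra.
by have h3 := nsq_lt_tot _ h1 h2; split => //; lra.
Qed.

Let mN (f : R5 -> R4) : measurable_fun setT f -> measurable_fun setT (fun p => nsq (f p)).
Proof. exact: measurableT_comp measurable_nsq. Qed.
Let mT (f : R5 -> R4) : measurable_fun setT f -> measurable_fun setT (fun p => tot (f p)).
Proof. exact: measurableT_comp measurable_tot. Qed.
Let mP (f : R5 -> R4) : measurable_fun setT f -> measurable_fun setT (fun p => pos4 (f p)).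
Proof. exact: measurableT_comp measurable_pos4. Qed.
Let m1 : measurable_fun setT (fun p : R5 => p.1).
Proof. exact: measurable_fst. Qed.

Let admD : admissible bD gD.
Proof.
have mo := measurableT_comp (@measurable_octant R) m1.
have mn := mN _ m1; have mt := mT _ m1.
split; [by rewrite /bD; meas|by rewrite /gD; meas|move=> p /and4P[_ s0 _ _]].
by rewrite mulr_ge0// exprn_ge0// ltW.
Qed.

Let admZ : admissible bZ gD.
Proof.
have mp := mP _ m1; have mn := mN _ m1; have mt := mT _ m1.
split; [by rewrite /bZ; meas|by rewrite /gD; meas|move=> p /and5P[_ _ s0 _ _]].
by rewrite mulr_ge0// exprn_ge0// ltW.
Qed.

Let admB : admissible bB gB.
Proof.
have mp := mP _ m1; have mn := mN _ m1; have mt := mT _ m1.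
split; [by rewrite /bB; meas|by rewrite /gB; meas|move=> p /and5P[_ s0 _ _ _]].
by rewrite divr_ge0// ltW.
Qed.

Let admC : admissible bC gB.
Proof.
have mp := mP _ m1; have mn := mN _ m1; have mt := mT _ m1.
split; [by rewrite /bC; meas|by rewrite /gB; meas|move=> p /and5P[_ s0 _ _ _]].
by rewrite divr_ge0// ltW.
Qed.

Let stepD : bint mu4 octant gap = bint mu5 bD gD.
Proof.
apply/esym; apply: bint_fubini => // x; rewrite [RHS]/ind; case: ifPn => ox; last first.
  by rewrite integral0_eq// => s _; rewrite /ind /bD/= (negbTE ox).
have [_ t1 h1 h2] := octantE _ ox.
rewrite (integral_cube_power _ (Num.sqrt (1 - nsq x)^-1) (Num.sqrt (tot x - nsq x)^-1)).
- by rewrite !sqrtV_exp4.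
- exact: sqrtr_ge0.
- by apply: ler_wsqrtr; rewrite lef_pV2 ?posrE//; lra.
move=> s; rewrite /bD/= ox /=; have [s0|s0] := ltrP 0 s => /=.
  by rewrite lt_sqrtV// gt_sqrtV// andbC.
by apply/esym/negbTE; rewrite negb_and -leNgt (le_trans s0)// ltW// sqrtV_gt0.
Qed.

Let nsq_scale (p : R5) : 0 < p.2 -> nsq (scale p).1 = nsq p.1 / p.2 ^+ 2.
Proof.
by move=> s0; rewrite /nsq /scale /inv_pos s0 /=; field; rewrite gt_eqF.
Qed.

Let tot_scale (p : R5) : 0 < p.2 -> tot (scale p).1 = tot p.1 / p.2.
Proof. by move=> s0; rewrite /tot /scale /inv_pos s0 /=; ring. Qed.

Let pos4_scale (p : R5) : pos4 (scale p).1 = pos4 p.1.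
Proof. by rewrite /pos4 /scale /= !pmulr_lgt0 ?inv_pos_gt0. Qed.

Let jac_scale (p : R5) : 0 < p.2 -> inv_pos p.2 ^+ 4 * gD (scale p) = gB p.
Proof.
move=> s0; rewrite /gD /gB /scale /inv_pos s0 /=; field; rewrite gt_eqF//.
Qed.

Let stepB : bint mu5 bD gD = bint mu5 bB gB.
Proof.
rewrite -[LHS](bint_chvar _ _ chvar_scale); last exact: admD.
have bE p : bD (scale p) = bB p.
  rewrite /bD /bB; have [s0|s0] := ltrP 0 p.2; last first.
    by rewrite /= !andbF.
  rewrite nsq_scale// tot_scale// /octant -!/(tot _) tot_scale//.
  have -> : cube (scale p).1 = pos4 p.1 && [&& 2 * p.1.1.1.1 < p.2, 2 * p.1.1.1.2 < p.2,
      2 * p.1.1.2 < p.2 & 2 * p.1.2 < p.2].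
    rewrite /cube /pos4 /scale /inv_pos s0 /= !ltr_pdivrMr// !pmulr_lgt0 ?invr_gt0//.
    by apply/idP/idP => h; lra.
  have e1 : (scale p).2 ^+ 2 * (tot p.1 / p.2 - nsq p.1 / p.2 ^+ 2) =
    p.2 * tot p.1 - nsq p.1 by rewrite /scale /=; field; rewrite gt_eqF.
  have e2 : (scale p).2 ^+ 2 * (1 - nsq p.1 / p.2 ^+ 2) = p.2 ^+ 2 - nsq p.1.
    by rewrite /scale /=; field; rewrite gt_eqF.
  rewrite e1 e2 ltr_pdivrMr// mul1r /= ltrBlDr ltrBrDr.
  case: (pos4 p.1) => //=; set H := [&& _, _, _ & _]; case: H => //=.
  apply/idP/idP => h; first by lra.
  have ht : tot p.1 < p.2 by rewrite -(ltr_pM2l s0) -expr2; lra.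
  by lra.
apply: bint_eq => [//|p]; rewrite bE => /and5P[_ s0 _ _ _]; exact: jac_scale.
Qed.

(** For fixed [q] the region is an interval in [s], from the largest of [sqrt (1 + |q|^2)] and the
    [2 q_i] to [(1 + |q|^2) / tot q]; the inversion with [N = 1 + |q|^2] is applied to it. *)
Let stepC : bint mu5 bB gB = bint mu5 bC gB.
Proof.
have mB := measurable_ind _ _ admB; have mC := measurable_ind _ _ admC.
rewrite /bint (fubini_tonelli1 _ mB (fun x => ind_ge0 _ _ x admB)).
rewrite (fubini_tonelli1 _ mC (fun x => ind_ge0 _ _ x admC)).
apply: eq_integral => x _; rewrite /fubini_F.
have [px|px] := boolP (pos4 x); last first.
  by rewrite !integral0_eq// => s _; rewrite /ind /bB /bC /= (negbTE px).
have N0 : 0 < 1 + nsq x by rewrite ltr_wpDr// nsq_ge0.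
have t0 : 0 < tot x by move: px; rewrite /pos4 /tot => h; lra.
have r0 : 0 < Num.sqrt (1 + nsq x) by rewrite sqrtr_gt0.
have rE s : 0 < s -> (1 + nsq x < s ^+ 2) = (Num.sqrt (1 + nsq x) < s).
  move=> s0; rewrite -[RHS](ltr_pXn2r (n := 2))// ?nnegrE ?sqrtr_ge0 ?ltW//.
  by rewrite sqr_sqrtr// ltW.
pose lo := Num.max (Num.sqrt (1 + nsq x)) (Num.max (2 * x.1.1.1)
  (Num.max (2 * x.1.1.2) (Num.max (2 * x.1.2) (2 * x.2)))).
have lo0 : 0 < lo by rewrite lt_max r0.
have bE : (fun s => bB (x, s)) =1 (fun s => lo < s < (1 + nsq x) / tot x).
  move=> s; rewrite /lo !gt_max ltr_pdivlMr// /bB/= px /=.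
  have [s0|s0] := ltrP 0 s => /=; last first.
    by rewrite (ltNge _ s) (le_trans s0)// ltW.
  rewrite rE//; case: (Num.sqrt _ < s); last by rewrite !andbF.
  by rewrite !andbT /= -!andbA.
have := integral_inversion _ _ _ _ 4 N0 lo0 (divr_gt0 N0 t0) (ler0n _ _) bE.
move=> H; apply: (etrans (etrans _ H)); first exact: eq_integral.
apply: eq_integral => s _; rewrite /ind; congr (if _ then _ else _).
rewrite /bC /bB /= px /=; have [s0|//] := ltrP 0 s; rewrite divr_gt0//=.
set N := 1 + nsq x in N0 *.
have e1 : (N / s * tot x < N) = (tot x < s).
  by rewrite mulrAC ltr_pdivrMr// ltr_pM2l.
have e2 : (N < (N / s) ^+ 2) = (s ^+ 2 < N).
  rewrite exprMn exprVn ltr_pdivlMr ?exprn_gt0//.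
  by rewrite [N ^+ 2]expr2 ltr_pM2l.
by rewrite e1 e2 !ltr_pdivlMr// ![s * _]mulrC.
Qed.

Let stepZ : bint mu5 bC gB = bint mu5 bZ gD.
Proof.
rewrite -[RHS](bint_chvar _ _ chvar_scale); last exact: admZ.
have bE p : bZ (scale p) = bC p.
  rewrite /bZ /bC; have [s0|s0] := ltrP 0 p.2; last by rewrite /= !andbF.
  rewrite nsq_scale// tot_scale// pos4_scale.
  have e0 : (scale p).2 ^+ 2 * (1 - nsq p.1 / p.2 ^+ 2) = p.2 ^+ 2 - nsq p.1.
    by rewrite /scale /=; field; rewrite gt_eqF.
  have e (y : R) : (scale p).2 ^+ 2 * (2 * (y * inv_pos p.2) - nsq p.1 / p.2 ^+ 2) =
    p.2 * (2 * y) - nsq p.1.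
    by rewrite /scale /inv_pos s0 /=; field; rewrite gt_eqF.
  rewrite e0 [(scale p).1.1.1.1]/= [(scale p).1.1.1.2]/= [(scale p).1.1.2]/= [(scale p).1.2]/=.
  rewrite !e ltr_pdivrMr// mul1r /= !ltrBlDr.
  by case: (pos4 p.1) => //=; apply/idP/idP => h; lra.
apply/esym; apply: bint_eq => [//|p]; rewrite bE => /and5P[_ s0 _ _ _]; exact: jac_scale.
Qed.

Let bS (p : R4) : bool := pos4 p && (tot p < 1).
(** Since [2 x_i - nsq x = 1 - |x - e_i|^2], this is [1] minus the squared distance to the nearest
    of [0] and the unit vectors; on [bS] at most one coordinate exceeds [1/2]. *)
Let cS (p : R4) : R := if half < p.1.1.1 then 2 * p.1.1.1 - nsq p else
  if half < p.1.1.2 then 2 * p.1.1.2 - nsq p else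
  if half < p.1.2 then 2 * p.1.2 - nsq p else
  if half < p.2 then 2 * p.2 - nsq p else 1 - nsq p.
Let gS (p : R4) : R := (cS p ^+ 2)^-1.

Let cSE p : bS p -> 0 < cS p /\ (forall s, 0 < s ->
  [&& s ^+ 2 * (1 - nsq p) < 1, s ^+ 2 * (2 * p.1.1.1 - nsq p) < 1,
    s ^+ 2 * (2 * p.1.1.2 - nsq p) < 1, s ^+ 2 * (2 * p.1.2 - nsq p) < 1
    & s ^+ 2 * (2 * p.2 - nsq p) < 1] = (s ^+ 2 * cS p < 1)).
Proof.
move=> /andP[p0 p1]; have h := nsq_lt_tot _ p0 p1.
have mono (a b s : R) : a <= b -> s ^+ 2 * b < 1 -> s ^+ 2 * a < 1.
  by move=> ab; apply: le_lt_trans; rewrite ler_wpM2l ?sqr_ge0.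
have [c0 [c1 c2 c3 c4 c5]] : 0 < cS p /\ [/\ 1 - nsq p <= cS p, 2 * p.1.1.1 - nsq p <= cS p,
    2 * p.1.1.2 - nsq p <= cS p, 2 * p.1.2 - nsq p <= cS p & 2 * p.2 - nsq p <= cS p].
  move: p0 p1 h; rewrite /pos4 /tot /cS /half => p0 p1 h.
  by do ! case: ifPn => ?; split; try split; lra.
split=> // s s0; apply/idP/idP => [/and5P[h1 h2 h3 h4 h5]|hs].
  by rewrite /cS; do ! case: ifPn.
by rewrite !(mono _ _ _ _ hs).
Qed.

Let mS : measurable_fun setT gS.
Proof. by have mn := measurable_nsq; rewrite /gS /cS; meas. Qed.

Let admS : admissible bS gS.
Proof.
have mp := measurable_pos4; have mt := measurable_tot.
split; [by rewrite /bS; meas|exact: mS|move=> p _].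
by rewrite invr_ge0 sqr_ge0.
Qed.

Let stepS : bint mu5 bZ gD = bint mu4 bS gS.
Proof.
apply: bint_fubini => // x; rewrite [RHS]/ind; case: ifPn => ox; last first.
  rewrite integral0_eq// => s _; rewrite /ind ifF//; apply: contraNF ox.
  by rewrite /bZ /bS/= => /and5P[-> ->].
have [c0 cE] := cSE _ ox.
rewrite (integral_cube_power _ 0 (Num.sqrt (cS x)^-1)) ?sqrtr_ge0//.
  by rewrite sqrtV_exp4// expr0n subr0.
move=> s; have /andP[h1 h2] := ox; rewrite /bZ/= h1 h2/=; have [s0|s0] := ltrP 0 s => //=.
by rewrite cE// lt_sqrtV.
Qed.

Let unit4 f : chvar mu4 f (fun=> 1 * 1) -> chvar mu4 f (fun=> 1).
Proof. by apply: chvar_eq => // p; rewrite mulr1. Qed.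

Let piece f b : chvar mu4 f (fun=> 1) -> (forall p, b p = corner (f p)) ->
  (forall p, b p -> cS p = 1 - nsq (f p)) -> bint mu4 b gS = wint corner.
Proof.
move=> cf bE gE; have ac := admissible_weight _ (@measurable_corner R).
rewrite wintE -[RHS](bint_chvar _ _ cf ac); apply: bint_eq => [//|p bp].
by rewrite mul1r /gS gE.
Qed.

(** Where [x_i > 1/2], the reflection [x_i -> 1 - x_i], followed by a permutation, sends [e_i] to
    [0] and the piece onto the corner; the rest of the simplex is the octant. *)
Let stepE : bint mu4 bS gS = (4%:E * wint corner + wint octant)%E.
Proof.
pose f1 := @reflect1 R 1; pose f2 p := f1 (swap12 p).
pose f3 p := f2 (swap23 p); pose f4 p := f3 (swap34 p).
pose l1 (p : R4) := p.1.1.1 - half; pose l2 (p : R4) := p.1.1.2 - half.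
pose l3 (p : R4) := p.1.2 - half; pose l4 (p : R4) := p.2 - half.
pose o1 p := bS p && (l1 p < 0); pose o2 p := o1 p && (l2 p < 0).
pose o3 p := o2 p && (l3 p < 0); pose o4 p := o3 p && (l4 p < 0).
have b1E p : bS p && (0 < l1 p) = corner (f1 p).
  by rewrite /bS /pos4 /tot /corner /l1 /half /=; apply/idP/idP => h; lra.
have b2E p : o1 p && (0 < l2 p) = corner (f2 p).
  by rewrite /o1 /bS /pos4 /tot /corner /l1 /l2 /half /=; apply/idP/idP => h; lra.
have b3E p : o2 p && (0 < l3 p) = corner (f3 p).
  by rewrite /o2 /o1 /bS /pos4 /tot /corner /l1 /l2 /l3 /half /=; apply/idP/idP => h; lra.
have b4E p : o3 p && (0 < l4 p) = corner (f4 p).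
  rewrite /o3 /o2 /o1 /bS /pos4 /tot /corner /l1 /l2 /l3 /l4 /half /=.
  by apply/idP/idP => h; lra.
have b5E p : o4 p = octant p.
  rewrite /o4 /o3 /o2 /o1 /bS /pos4 /octant /cube /tot /l1 /l2 /l3 /l4 /half.
  by apply/idP/idP => h; lra.
have k1 : chvar mu4 f1 (fun=> 1) := chvar_reflect1 1.
have k2 : chvar mu4 f2 (fun=> 1) := unit4 _ (chvar_comp _ _ _ _ _ _ _ chvar_swap12 k1).
have k3 : chvar mu4 f3 (fun=> 1) := unit4 _ (chvar_comp _ _ _ _ _ _ _ chvar_swap23 k2).
have k4 : chvar mu4 f4 (fun=> 1) := unit4 _ (chvar_comp _ _ _ _ _ _ _ chvar_swap34 k3).
have n1 p : 1 - nsq (f1 p) = 2 * p.1.1.1 - nsq p by rewrite /nsq /=; ring.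
have n2 p : 1 - nsq (f2 p) = 2 * p.1.1.2 - nsq p by rewrite /nsq /=; ring.
have n3 p : 1 - nsq (f3 p) = 2 * p.1.2 - nsq p by rewrite /nsq /=; ring.
have n4 p : 1 - nsq (f4 p) = 2 * p.2 - nsq p by rewrite /nsq /=; ring.
have a1 : nonconst_affine l1.
  by exists 1, 0, 0, 0, (- half); split => [p|]; [rewrite /l1; ring|rewrite oner_eq0].
have a2 : nonconst_affine l2.
  by exists 0, 1, 0, 0, (- half); split => [p|]; [rewrite /l2; ring|rewrite oner_eq0 !orbT].
have a3 : nonconst_affine l3.
  by exists 0, 0, 1, 0, (- half); split => [p|]; [rewrite /l3; ring|rewrite oner_eq0 !orbT].
have a4 : nonconst_affine l4.
  by exists 0, 0, 0, 1, (- half); split => [p|]; [rewrite /l4; ring|rewrite oner_eq0 !orbT].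
have [[ml1 z1] [ml2 z2] [ml3 z3] [ml4 z4]] := And4 (nonconst_affine_null _ a1) (nonconst_affine_null _ a2)
  (nonconst_affine_null _ a3) (nonconst_affine_null _ a4).
have ltm (l : R4 -> R) : measurable_fun setT l -> measurable_fun setT (fun p => l p < 0).
  by move=> ml; meas.
have q1 : admissible o1 gS := admissible_and _ _ _ admS (ltm _ ml1).
have q2 : admissible o2 gS := admissible_and _ _ _ q1 (ltm _ ml2).
have q3 : admissible o3 gS := admissible_and _ _ _ q2 (ltm _ ml3).
have w1 : bint mu4 (fun p => bS p && (0 < l1 p)) gS = wint corner.
  apply: (piece f1 _ k1 b1E) => p; rewrite n1.
  by rewrite /l1 /cS subr_gt0 => /andP[_ ->].
have w2 : bint mu4 (fun p => o1 p && (0 < l2 p)) gS = wint corner.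
  apply: (piece f2 _ k2 b2E) => p; rewrite n2.
  rewrite /o1 /l1 /l2 /cS subr_gt0 subr_lt0 => /andP[/andP[_ h1] h2].
  by rewrite h2 (ltNge half) (ltW h1).
have w3 : bint mu4 (fun p => o2 p && (0 < l3 p)) gS = wint corner.
  apply: (piece f3 _ k3 b3E) => p; rewrite n3.
  rewrite /o2 /o1 /l1 /l2 /l3 /cS subr_gt0 !subr_lt0 => /andP[/andP[/andP[_ h1] h2] h3].
  by rewrite h3 !(ltNge half) (ltW h1) (ltW h2).
have w4 : bint mu4 (fun p => o3 p && (0 < l4 p)) gS = wint corner.
  apply: (piece f4 _ k4 b4E) => p; rewrite n4.
  rewrite /o3 /o2 /o1 /l1 /l2 /l3 /l4 /cS subr_gt0 !subr_lt0.
  move=> /andP[/andP[/andP[/andP[_ h1] h2] h3] h4].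
  by rewrite h4 !(ltNge half) (ltW h1) (ltW h2) (ltW h3).
have w5 : bint mu4 o4 gS = wint octant.
  rewrite wintE; apply: bint_eq b5E _ => p.
  rewrite /o4 /o3 /o2 /o1 /l1 /l2 /l3 /l4 !subr_lt0.
  move=> /andP[/andP[/andP[/andP[_ h1] h2] h3] h4].
  by rewrite /gS /cS !(ltNge half) (ltW h1) (ltW h2) (ltW h3) (ltW h4).
rewrite (bint_split bS gS ml1 z1 admS) w1 -/o1 (bint_split o1 gS ml2 z2 q1) w2 -/o2.
rewrite (bint_split o2 gS ml3 z3 q2) w3 -/o3 (bint_split o3 gS ml4 z4 q3) w4 -/o4 w5.
have c0 := wint_ge0 _ (@measurable_corner R).
have -> : 4 = 1 + (1 + (1 + 1)) :> R by ring.
rewrite !(EFinD, ge0_muleDl, mul1e)// ?lee_fin//.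
by rewrite !addeA.
Qed.

Let reflect_all (p : R4) : R4 := reflect4 half (reflect3 half (reflect2 half (reflect1 half p))).

Let chvar_reflect_all : chvar mu4 reflect_all (fun=> 1).
Proof.
exact: unit4 _ (chvar_comp _ _ _ _ _ _ _ (unit4 _ (chvar_comp _ _ _ _ _ _ _ (unit4 _
  (chvar_comp _ _ _ _ _ _ _ (chvar_reflect1 half) (chvar_reflect2 half)))
  (chvar_reflect3 half))) (chvar_reflect4 half)).
Qed.

(* Reflecting the cube, [weight + gap] is the reflected weight on the octant. *)
Lemma wint_cube_octant :
  @wint R cube = (3%:E * @wint R octant + 4%:E * @wint R corner)%E.
Proof.
have mo := @measurable_octant R.
have aw := admissible_weight _ mo.
have mc : measurable_fun setT (@cube R) by rewrite /cube; meas.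
pose l (p : R4) := 1 - tot p.
have al : nonconst_affine l.
  exists (-1), (-1), (-1), (-1), 1; split => [p|]; first by rewrite /l /tot; ring.
  by rewrite oppr_eq0 oner_eq0.
have [ml _] := nonconst_affine_null _ al.
rewrite (wint_split _ _ al mc).
have -> : wint (fun p => cube p && (0 < l p)) = wint octant.
  by apply: wint_eq => p; rewrite /l subr_gt0.
have mb : measurable_fun setT (fun p => cube p && (l p < 0)) by meas.
rewrite (wintE (fun p => cube p && (l p < 0))).
rewrite -(bint_chvar _ _ chvar_reflect_all (admissible_weight _ mb)).
have -> : bint mu4 (fun p => cube (reflect_all p) && (l (reflect_all p) < 0))
    (fun p => 1 * weight (reflect_all p)) = bint mu4 octant (fun p => weight p + gap p).
  apply: bint_eq => p.
    by rewrite /octant /cube /l /tot /reflect_all /half /=; apply/idP/idP => h; lra.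
  move=> _; rewrite /gap addrC subrK mul1r.
  by rewrite /weight /tot /nsq /reflect_all /half /=; congr (_ ^+ 2)^-1; field.
have ag : admissible octant gap.
  have mn := measurable_nsq; have mt := measurable_tot.
  split => //; first by rewrite /gap; meas.
  move=> p /octantE[_ h1 h2 h3]; rewrite subr_ge0 lef_pV2 ?posrE ?exprn_gt0//.
  by rewrite ler_pXn2r ?nnegrE ?ltW//; lra.
rewrite bintD// stepD stepB stepC stepZ stepS stepE -wintE.
have c0 := wint_ge0 _ (@measurable_corner R); have o0 := wint_ge0 _ mo.
have -> : 3 = 1 + (1 + 1) :> R by ring.
rewrite !(EFinD, ge0_muleDl, mul1e)// ?lee_fin//.
by rewrite [X in (_ + (_ + X))%E = _]addeC !addeA.
Qed.

End CubeOctantCorner.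

(** * From the domain of integration to one orthant *)

Section Octants.
Context {R : realType}.
Let mu := @lebesgue_measure R.
Let MR := measurableTypeR R.
Let R4 := (MR * MR * MR * MR)%type.
Let R5 := (MR * MR * MR * MR * MR)%type.
Local Notation mu4 := (xleb (xleb (xleb mu))).
Local Notation mu5 := (xleb (xleb (xleb (xleb mu)))).

Definition cell24 (p : R4) : bool :=
  [&& `|p.1.1.1| <= 2^-1, `|p.1.1.2| <= 2^-1, `|p.1.2| <= 2^-1, `|p.2| <= 2^-1
    & `|p.1.1.1| + `|p.1.1.2| + `|p.1.2| + `|p.2| <= 1].

Lemma measurable_cell24 : measurable_fun setT cell24.
Proof. by rewrite /cell24; meas. Qed.

Lemma wint_cell24 : wint cell24 = (16%:E * wint octant)%E.
Proof.
pose d1 (p : R4) := cell24 p && (0 < p.1.1.1).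
pose d2 (p : R4) := d1 p && (0 < p.1.1.2).
pose d3 (p : R4) := d2 p && (0 < p.1.2).
pose d4 (p : R4) := d3 p && (0 < p.2).
pose e1 (p : R4) := d4 p && (0 < 2^-1 - p.1.1.1).
pose e2 (p : R4) := e1 p && (0 < 2^-1 - p.1.1.2).
pose e3 (p : R4) := e2 p && (0 < 2^-1 - p.1.2).
pose e4 (p : R4) := e3 p && (0 < 2^-1 - p.2).
have d4E p : d4 p -> [/\ 0 <= 2^-1 - p.1.1.1, 0 <= 2^-1 - p.1.1.2, 0 <= 2^-1 - p.1.2,
    0 <= 2^-1 - p.2 & 0 <= 1 - tot p].
  move=> /andP[/andP[/andP[/andP[+ h1] h2] h3] h4].
  rewrite /cell24 !gtr0_norm// /tot => h.
  by split; lra.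
have eE p : e4 p && (0 < 1 - tot p) = octant p.
  apply/idP/idP.
    rewrite /e4 /e3 /e2 /e1 /d4 /d3 /d2 /d1 /octant /cube /tot.
    move: (cell24 p) => b h; lra.
  move=> h; have [h1 h2 h3 h4] : [/\ 0 < p.1.1.1, 0 < p.1.1.2, 0 < p.1.2 & 0 < p.2].
    by move: h; rewrite /octant /cube => h; split; lra.
  rewrite /e4 /e3 /e2 /e1 /d4 /d3 /d2 /d1 /cell24 !gtr0_norm// h1 h2 h3 h4.
  by move: h; rewrite /octant /cube /tot => h; lra.
have ms := measurable_cell24.
have m1 : measurable_fun setT d1 by rewrite /d1; meas.
have m2 : measurable_fun setT d2 by rewrite /d2; meas.
have m3 : measurable_fun setT d3 by rewrite /d3; meas.
have m4 : measurable_fun setT d4 by rewrite /d4; meas.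
have n1 : measurable_fun setT e1 by rewrite /e1; meas.
have n2 : measurable_fun setT e2 by rewrite /e2; meas.
have n3 : measurable_fun setT e3 by rewrite /e3; meas.
have n4 : measurable_fun setT e4 by rewrite /e4; meas.
have a1 : nonconst_affine (fun p : R4 => 2^-1 - p.1.1.1).
  by exists (-1), 0, 0, 0, 2^-1; split => [p|]; [ring|rewrite oppr_eq0 oner_eq0].
have a2 : nonconst_affine (fun p : R4 => 2^-1 - p.1.1.2).
  by exists 0, (-1), 0, 0, 2^-1; split => [p|]; [ring|rewrite oppr_eq0 oner_eq0 !orbT].
have a3 : nonconst_affine (fun p : R4 => 2^-1 - p.1.2).
  by exists 0, 0, (-1), 0, 2^-1; split => [p|]; [ring|rewrite oppr_eq0 oner_eq0 !orbT].
have a4 : nonconst_affine (fun p : R4 => 2^-1 - p.2).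
  by exists 0, 0, 0, (-1), 2^-1; split => [p|]; [ring|rewrite oppr_eq0 oner_eq0 !orbT].
have a5 : nonconst_affine (fun p : R4 => 1 - tot p).
  exists (-1), (-1), (-1), (-1), 1; split => [p|]; first by rewrite /tot; ring.
  by rewrite oppr_eq0 oner_eq0.
rewrite (wint_double _ _ _ (chvar_reflect1 0) weight_reflect1 affine1 ms); last 2 first.
- by move=> p; rewrite /cell24 /= sub0r normrN.
- by move=> p; rewrite /= sub0r.
rewrite -/d1 (wint_double _ _ _ (chvar_reflect2 0) weight_reflect2 affine2 m1); last 2 first.
- by move=> p; rewrite /d1 /cell24 /= sub0r normrN.
- by move=> p; rewrite /= sub0r.
rewrite -/d2 (wint_double _ _ _ (chvar_reflect3 0) weight_reflect3 affine3 m2); last 2 first.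
- by move=> p; rewrite /d2 /d1 /cell24 /= sub0r normrN.
- by move=> p; rewrite /= sub0r.
rewrite -/d3 (wint_double _ _ _ (chvar_reflect4 0) weight_reflect4 affine4 m3); last 2 first.
- by move=> p; rewrite /d3 /d2 /d1 /cell24 /= sub0r normrN.
- by move=> p; rewrite /= sub0r.
rewrite -/d4 !muleA -!EFinM; congr (_%:E * _)%E; first by ring.
rewrite (wint_restrict _ _ a1 m4); last by move=> p /d4E[].
rewrite -/e1 (wint_restrict _ _ a2 n1); last by move=> p /andP[/d4E[]].
rewrite -/e2 (wint_restrict _ _ a3 n2); last by move=> p /andP[/andP[/d4E[]]].
rewrite -/e3 (wint_restrict _ _ a4 n3); last by move=> p /andP[/andP[/andP[/d4E[]]]].
rewrite -/e4 (wint_restrict _ _ a5 n4); last by move=> p /andP[/andP[/andP[/andP[/d4E[]]]]].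
exact: wint_eq.
Qed.

Let bA (p : R5) : bool := [&& 0 < p.2, 1 - 1 / p.2 ^+ 4 <= nsq p.1 & cell24 p.1].
Let gA (p : R5) : R := p.2 ^+ 7.

(** Each [x^2] is at most [|x| / 2], so [nsq p <= 1/2]. *)
Lemma nsq_cell24 p : cell24 p -> 0 < 1 - nsq p.
Proof.
have sqr_le (x : R) : `|x| <= 2^-1 -> x ^+ 2 <= `|x| / 2.
  move=> h; rewrite -real_normK ?num_real// expr2.
  by rewrite ler_wpM2l.
rewrite /cell24 /nsq => /and5P[/sqr_le h1 /sqr_le h2 /sqr_le h3 /sqr_le h4 h].
lra.
Qed.

Lemma integral_power7 (A : R) : 0 < A ->
  (\int[mu]_t ind (fun t : R => (0 < t) && (t ^+ 4 * A <= 1))%R (fun t : R => t ^+ 7)%R t =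
   (8^-1 * (A ^+ 2)^-1)%:E)%E.
Proof.
move=> A0; pose r := Num.sqrt (Num.sqrt A^-1).
have r0 : 0 < r by rewrite sqrtr_gt0 sqrtr_gt0 invr_gt0.
have r4 : r ^+ 4 = A^-1.
  have -> : r ^+ 4 = (r ^+ 2) ^+ 2 by ring.
  by rewrite !sqr_sqrtr ?sqrtr_ge0 ?invr_ge0 ?ltW.
have bE t : (0 < t) && (t ^+ 4 * A <= 1) = (0 < t) && (t <= r).
  have [t0|//] := ltrP 0 t; rewrite -[RHS](ler_pXn2r (n := 4)) ?nnegrE ?(ltW t0) ?(ltW r0)//.
  by rewrite r4 -[A^-1]mul1r ler_pdivlMr.
transitivity (bint mu (fun t : MR => (0 < t) && (t <= r)) (fun t => t ^+ 7)).
  by apply: eq_integral => t _; rewrite /ind bE.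
rewrite (bint_restrict mu (fun t => r - t)); last first.
- by move=> t /andP[_]; rewrite subr_ge0.
- by split; [meas|meas|move=> t /andP[t0 _]; rewrite exprn_ge0// ltW].
- rewrite (_ : [set x | _] = [set r]); first exact: lebesgue_measure_set1.
  by apply/seteqP; split => t /= h; lra.
- exact: measurable_funB.
apply: (ge0_FTC_val _ _ (fun t : R => t ^+ 8 / 8) 0 r) => [|t|t _|t _|t /andP[t0 _]|||].
- exact: ltW.
- by rewrite subr_gt0; case: (ltrP t r) => h; rewrite ?andbF// (ltW h) !andbT.
- by rewrite /derives; derive; field.
- by cont.
- by rewrite exprn_ge0// ltW.
- by cont.
- by cont.
have -> : r ^+ 8 = (r ^+ 4) ^+ 2 by ring.
by rewrite r4 exprVn expr0n mul0r subr0 mulrC.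
Qed.

Let admA : admissible bA gA.
Proof.
have mn := measurableT_comp (@measurable_nsq R) (@measurable_fst _ _ R4 MR).
have ms := measurableT_comp measurable_cell24 (@measurable_fst _ _ R4 MR).
split; [by rewrite /bA; meas|by rewrite /gA; meas|move=> p /and3P[t0 _ _]].
by rewrite exprn_ge0// ltW.
Qed.

Lemma bint_cell24 : bint mu5 bA gA = (2%:E * wint octant)%E.
Proof.
have as24 := admissible_weight _ measurable_cell24.
transitivity (bint mu4 cell24 (fun p => 8^-1 * weight p)).
  apply: bint_fubini; first exact: admA.
  move=> x; rewrite [RHS]/ind; case: ifPn => [sx|/negbTE sx]; last first.
    by rewrite integral0_eq// => t _; rewrite /ind /bA /= sx !andbF.
  rewrite -(integral_power7 _ (nsq_cell24 _ sx)); apply: eq_integral => t _.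
  rewrite /ind /bA /gA /= sx andbT; congr (if _ then _ else _).
  case: (ltrP 0 t) => //= t0; have t4 : 0 < t ^+ 4 by rewrite exprn_gt0.
  rewrite lerBlDr addrC -lerBlDr ler_pdivlMr// mulrC//.
rewrite bintZ ?invr_ge0// -wintE wint_cell24 muleA -EFinM.
by congr (_%:E * _)%E; field.
Qed.

Lemma domainDE (p : R5) : domainD R p <-> bA (first_last p).
Proof.
move: p => [[[[t x] y] z] u]; rewrite /domainD /bA /cell24 /nsq /= !div1r; split.
  by move=> [-> h [h1 h2 h3 h4] h5]; apply/and3P; split => //; apply/and5P.
by move=> /and3P[t0 h /and5P[? ? ? ? ?]].
Qed.

Lemma integral_domainD :
  (\int[lebesgue5 R]_(p in domainD R)
     (let: (t, _, _, _, _) := p in (t ^+ 7)%:E))%E = bint mu5 bA gA.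
Proof.
have lE (A : set R5) : measurable A -> A `<=` setT -> lebesgue5 R A = mu5 A.
  by move=> _ _; rewrite /lebesgue5 /xleb.
rewrite -(bint_chvar _ _ chvar_first_last admA) integral_mkcond.
rewrite (eq_measure_integral mu5 lE); apply: eq_integral => p _.
rewrite patchE /ind; have -> : (p \in domainD R) = bA (first_last p).
  by apply/idP/idP => [/set_mem/domainDE//|h]; apply/mem_set/domainDE.
by case: ifP => // _; move: p => [[[[t x] y] z] u]; rewrite mul1r.
Qed.

End Octants.

Theorem proposition26 (R : realType) :
  (\int[lebesgue5 R]_(p in domainD R)
     (let: (t, _, _, _, _) := p in (t ^+ 7)%:E))%E
  = (7 * riemann_zeta (3 : R) / 80)%:E.
Proof.
rewrite integral_domainD bint_cell24 wint_octant riemann_zeta3.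
have := @wint_cube_octant R; rewrite wint_cube wint_octant.
have := wint_ge0 _ (@measurable_corner R).
(* The relation [Q = 40 E] holds at first in the extended reals; since [Q] is a real number, [E] is
   not infinite. Then [2 P = 24 E = 3/5 Q]. *)
case: (wint corner) => [c _|_|//].
  by rewrite -!EFinM -EFinD => -[h]; congr (_%:E); lra.
have oo (k : R) : 0 < k -> (k%:E * +oo = +oo :> \bar R)%E.
  by move=> k0; rewrite gt0_muley// lte_fin.
by rewrite (oo 12)// (oo 3)// (oo 4).
Qed.
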